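(* Let $\rho:\pi_1(\mathrm{T}^* )\to \mathrm{SL}(2,\mathbb{R})$ be a representation of the fundamental group of the once-punctured torus which is not simple Fuchsian, is injective, and has no parabolic elements in its image. Then the spectrum $\mathrm{Sp}(\rho)\subset S^1$ is a Cantor set.
   Context: Let $\mathrm{T}=\mathbb{R}^2/\mathbb{Z}^2$ with its flat metric of area $1$, $p=(0,0)$, $\mathrm{T}^*=\mathrm{T}\setminus\{p\}$. The group $\pi_1(\mathrm{T}^* )$ is free on two generators $a,b$; the boundary (puncture) curve is the conjugacy class of $[a,b]$. Parabolic: an element of $\mathrm{SL}(2,\mathbb{R})$ of trace $\pm 2$ other than $\pm\mathrm{Id}$. Simple Fuchsian: $\rho$ is simple Fuchsian if, writing $c=\operatorname{tr}\rho([a,b])$, either $c<2$, or $c>2$ and $\rho$ is the holonomy of a hyperbolic structure on a pair of pants (whose fundamental group, like that of $\mathrm{T}^*$, is free of rank 2). Measured foliations: the space of oriented measured foliations is identified with the unit circle $S^1$; $\theta\in S^1$ corresponds to the foliation $\mathcal{F}_\theta$ of $\mathrm{T}$ by straight lines directed by $\theta$. Lyapunov exponent: let $E_\rho=(\widetilde{\mathrm{T}^*}\times\mathbb{R}^2)/\big((x,v)\sim(\gamma\cdot x,\rho(\gamma)v)\big)$ be the flat rank 2 vector bundle over $\mathrm{T}^*$ defined by $\rho$. The underlying smooth bundle extends to $\mathrm{T}$ (the flat connection does not); equip this extension with a smooth metric. Let $(\varphi_t)$ be the unit speed linear flow on $\mathrm{T}$ in direction $\theta$ and let $\phi_t(x):E_\rho(x)\to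 E_\rho(\varphi_t(x))$ be the parallel transport along the orbit of $x$ (defined for almost every $x$). Define $$\chi(\rho,\mathcal{F}_\theta)=\lim_{t\to+\infty}\frac1t\int_{\mathrm{T}}\log\|\phi_t(x)\|\,dx .$$ Spectrum: $\mathrm{Sp}(\rho)=\{\theta\in S^1 : \chi(\rho,\mathcal{F}_\theta)=0\}$. A Cantor set is a nonempty closed subset of $S^1$ with empty interior and no isolated points. *)

(* Defs.v *)
From HB Require Import structures.
From mathcomp Require Import all_boot all_order all_algebra.
From mathcomp Require Import all_classical all_reals all_analysis.

Set Implicit Arguments.
Unset Strict Implicit.
Unset Printing Implicit Defensive.

Import Order.TTheory GRing.Theory Num.Theory.
Import numFieldNormedType.Exports.

Local Open Scope classical_set_scope.
Local Open Scope ring_scope.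

(* The free group of rank 2, as reduced words. A letter is a pair
   (generator, sign): (false, false) is a, (true, false) is b, and
   (_, true) is the inverse of (_, false). *)
Definition letter := (bool * bool)%type.

Definition linv (l : letter) : letter := (l.1, ~~ l.2).

Definition reduced (w : seq letter) : bool :=
  sorted (fun l l' => l' != linv l) w.

Definition push (l : letter) (w : seq letter) : seq letter :=
  if w is l' :: w' then (if l' == linv l then w' else l :: w) else [:: l].

Definition wmul (v w : seq letter) : seq letter := foldr push w v.

Definition winv (w : seq letter) : seq letter := rev (map linv w).

Lemma linvK : involutive linv.
Proof. by case=> g s; rewrite /linv /= negbK. Qed.

Lemma reduced_push l w : reduced w -> reduced (push l w).
Proof.
case: w => [|l' w] //= rw; case: (eqVneq l' (linv l)) => [_|ne].
  exact: path_sorted rw.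
by rewrite /= ne.
Qed.

Lemma reduced_wmul v w : reduced w -> reduced (wmul v w).
Proof. by move=> rw; elim: v => //= l v; apply: reduced_push. Qed.

Lemma reduced_winv w : reduced w -> reduced (winv w).
Proof.
rewrite /reduced /winv rev_sorted sorted_map; congr (is_true _).
apply: eq_sorted => l l' /=.
by rewrite linvK eq_sym; congr (~~ _); apply/eqP/eqP => [<-|->]; rewrite ?linvK.
Qed.

Lemma push_linvK l w : reduced w -> push l (push (linv l) w) = w.
Proof.
case: w => [|l' w] rw /=; first by rewrite eqxx.
rewrite linvK; case: (eqVneq l' l) rw => [->|ne] rw; last by rewrite /= eqxx.
by case: w rw => [|l'' w] //= /andP[/negPf-> _].
Qed.

Lemma wmul_push l v w : reduced v -> reduced w ->
  wmul (push l v) w = push l (wmul v w).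
Proof.
case: v => [|l' v] //= rv rw; case: (eqVneq l' (linv l)) => [->|//].
by rewrite push_linvK // reduced_wmul.
Qed.

Lemma wmulA u v w : reduced v -> reduced w ->
  wmul u (wmul v w) = wmul (wmul u v) w.
Proof.
move=> rv rw; elim: u => //= l u IHu.
by rewrite wmul_push // ?IHu // reduced_wmul.
Qed.

Lemma wmul_nil w : reduced w -> wmul w [::] = w.
Proof.
elim: w => //= l w IHw rw; rewrite IHw; last exact: path_sorted rw.
by case: w rw {IHw} => [|l' w] //= /andP[/negPf-> _].
Qed.

Lemma wmul_cat u v w : wmul (u ++ v) w = wmul u (wmul v w).
Proof. exact: foldr_cat. Qed.

Lemma wmul_rev_linvK v w : reduced w -> wmul v (wmul (winv v) w) = w.
Proof.
elim: v w => //= l v IHv w rw; rewrite /winv /= rev_cons -cats1 wmul_cat /=.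
by rewrite IHv ?push_linvK // reduced_push.
Qed.

Lemma winvK : involutive winv.
Proof. by move=> w; rewrite /winv map_rev revK mapK //; apply: linvK. Qed.

Record free2 := Free2 { word : seq letter; word_reduced : reduced word }.

HB.instance Definition _ := [isSub for word].
HB.instance Definition _ := [Choice of free2 by <:].

Definition free2_one : free2 := @Free2 [::] isT.
Definition free2_mul (x y : free2) : free2 :=
  Free2 (reduced_wmul (word x) (word_reduced y)).
Definition free2_inv (x : free2) : free2 :=
  Free2 (reduced_winv (word_reduced x)).

Lemma free2_mulA : associative free2_mul.
Proof. by move=> x y z; apply/val_inj/wmulA; apply: word_reduced. Qed.

Lemma free2_mul1 : left_id free2_one free2_mul.
Proof. by move=> x; apply/val_inj. Qed.

Lemma free2_1mul : right_id free2_one free2_mul.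
Proof. by move=> x; apply/val_inj/wmul_nil/word_reduced. Qed.

Lemma free2_mulV : right_inverse free2_one free2_inv free2_mul.
Proof.
move=> x; apply/val_inj => /=.
by rewrite -[winv _]wmul_nil ?wmul_rev_linvK // reduced_winv // word_reduced.
Qed.

Lemma free2_Vmul : left_inverse free2_one free2_inv free2_mul.
Proof.
move=> x; rewrite -[X in free2_mul _ X](_ : free2_inv (free2_inv x) = x).
  exact: free2_mulV.
exact/val_inj/winvK.
Qed.

HB.instance Definition _ := isGroup.Build free2
  free2_mulA free2_mul1 free2_1mul free2_Vmul free2_mulV.

Definition gen_a : free2 := @Free2 [:: (false, false)] isT.
Definition gen_b : free2 := @Free2 [:: (true, false)] isT.

Definition zexpg (x : free2) (n : int) : free2 :=
  match n with Posz k => (x ^+ k)%g | Negz k => (x ^- k.+1)%g end.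

Section Representations.
Variable R : realType.
Implicit Types (rho : free2 -> 'M[R]_2) (M : 'M[R]_2).

Definition sl2_representation rho : Prop :=
  (forall x, \det (rho x) = 1) /\
  (forall x y, rho (x * y)%g = rho x *m rho y).

Definition parabolic M : Prop :=
  [/\ \tr M = 2 \/ \tr M = -2, M <> 1%:M & M <> - 1%:M].

Definition half_plane : set (R * R) := [set z | 0 < z.2].

(* z |-> (a z + b) / (c z + d), in real coordinates, for det M = 1. *)
Definition mobius M (z : R * R) : R * R :=
  let a := M 0 0 in let b := M 0 1 in let c := M 1 0 in let d := M 1 1 in
  let n := (c * z.1 + d) ^+ 2 + (c * z.2) ^+ 2 in
  (((a * z.1 + b) * (c * z.1 + d) + a * c * z.2 ^+ 2) / n, z.2 / n).

(* The plane minus two points, homeomorphic to the interior of a pair of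
   pants. *)
Definition pants : set (R * R) := ~` [set (0, 0); (1, 0)].

(* rho is the holonomy of a hyperbolic structure on a pair of pants: it acts
   freely and properly discontinuously on the half-plane, with quotient
   (through q) homeomorphic to an open pair of pants. A structure with geodesic
   boundary is the convex core of such a quotient, with the same holonomy. *)
Definition pants_holonomy rho : Prop :=
  exists q : R * R -> R * R,
  [/\ (forall z, half_plane z -> {for z, continuous q}),
      q @` half_plane = pants,
      (forall U, open U -> U `<=` half_plane -> open (q @` U)),
      (forall z w, half_plane z -> half_plane w ->
         (q z = q w <-> exists g, w = mobius (rho g) z)) &
      (forall z, half_plane z -> exists2 U, nbhs z U &
         forall g, g <> 1%g -> U `&` (mobius (rho g) @` U) = set0)].

Definition simple_fuchsian rho : Prop :=
  let c := \tr (rho (gen_a * gen_b * gen_a^-1 * gen_b^-1)%g) in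
  c < 2 \/ (2 < c /\ pants_holonomy rho).

End Representations.

Section Smooth.
Variables (R : realType) (V W : normedModType R).

Fixpoint Ck (k : nat) (U : set V) (f : V -> W) : Prop :=
  (forall x, U x -> {for x, continuous f}) /\
  (if k is k'.+1 then forall v,
     (forall x, U x -> derivable f x v) /\ Ck k' U ('D_v f)
   else True).

Definition smooth_at (f : V -> W) (x : V) : Prop :=
  exists U, [/\ open U, U x & forall k, Ck k U f].

End Smooth.

Section PuncturedTorus.
Variable R : realType.
Implicit Types (rho : free2 -> 'M[R]_2) (x u theta : R * R).

Definition frac (s : R) : R := s - (Num.floor s)%:~R.

(* Fundamental domain [0,1)^2 \ {0} for T^*. *)
Definition cell : set (R * R) := (`[0, 1[ `*` `[0, 1[) `\ (0, 0).

(* The universal cover of T^*: one copy (g, -) of the cell for each g in the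
   free group, the copy g being glued along its right (top) side to the copy
   g * a (resp. g * b). Only the points (g, x) with [cell x] are meaningful. The
   fundamental group acts by deck transformations, on the left. *)
Definition cover := (free2 * (R * R))%type.

Definition deck (g : free2) (y : cover) : cover := ((g * y.1)%g, y.2).

(* For small u, the lift of the translation by u: u |-> translate y u is a chart
   of the cover at y. At most one side is crossed when u is small enough, so
   the order of the two factors is irrelevant. *)
Definition translate (y : cover) (u : R * R) : cover :=
  ((y.1 * zexpg gen_a (Num.floor (y.2.1 + u.1))
        * zexpg gen_b (Num.floor (y.2.2 + u.2)))%g,
   (frac (y.2.1 + u.1), frac (y.2.2 + u.2))).

Definition smooth_on_cover (f : cover -> 'M[R]_2) (y : cover) : Prop :=
  smooth_at (fun u => f (translate y u)) (0 : R * R).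

Definition qform (A : 'M[R]_2) (v : 'cV[R]_2) : R := (v^T *m A *m v) 0 0.

Definition posdef (A : 'M[R]_2) : Prop :=
  A^T = A /\ forall v, v != 0 -> 0 < qform A v.

Definition punctured_disc (r : R) : set (R * R) :=
  [set u | 0 < u.1 ^+ 2 + u.2 ^+ 2 < r ^+ 2].

Definition above (u : R * R) (y : cover) : Prop :=
  y.2 = (frac u.1, frac u.2).

(* A vector of E_rho over a point of T^* is a class of pairs (y, v), y in the
   cover, under (y, v) ~ (deck g y, rho g *m v). This record packages an
   extension of the smooth bundle E_rho across p and a smooth metric on it:
   - [gram y] is the Gram matrix of the metric in the flat frame at y; the
     equivariance says that it is a metric on the quotient;
   - the columns of [frame y] form the smooth frame of E_rho on a punctured disc
     around p which is declared to extend across p (this is the choice of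
     extension), and [gram0] is the Gram matrix of the metric in this frame,
     smooth up to p.
   The extension is required to be tame: the frame is bounded, with bounded
   inverse, in the flat frames on the four sectors cut at p by the cell. This
   holds e.g. if the frame is parallel along the rays from p. Without it,
   log ||phi_t|| need not be integrable, nor its mean growth well defined. *)
Record bundle_metric rho := BundleMetric {
  gram : cover -> 'M[R]_2;
  gram_posdef : forall y, cell y.2 -> posdef (gram y);
  gram_equivariant : forall g y, cell y.2 ->
    (rho g)^T *m gram (deck g y) *m rho g = gram y;
  gram_smooth : forall y, cell y.2 -> smooth_on_cover gram y;
  radius : R;
  radius_gt0 : 0 < radius < 1 / 2;
  frame : cover -> 'M[R]_2;
  frame_unit : forall u y, punctured_disc radius u -> above u y ->
    frame y \in unitmx;
  frame_equivariant : forall u y g, punctured_disc radius u -> above u y ->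
    frame (deck g y) = rho g *m frame y;
  frame_smooth : forall u y, punctured_disc radius u -> above u y ->
    smooth_on_cover frame y;
  frame_tame : exists C : R, forall u, punctured_disc radius u ->
    let y : cover := (1%g, (frac u.1, frac u.2)) in
    `|frame y| <= C /\ `|invmx (frame y)| <= C;
  gram0 : R * R -> 'M[R]_2;
  gram0_smooth : forall u, u = 0 \/ punctured_disc radius u ->
    smooth_at gram0 u;
  gram0_posdef : posdef (gram0 0);
  gram0E : forall u y, punctured_disc radius u -> above u y ->
    (frame y)^T *m gram y *m frame y = gram0 u
}.

(* c is a lift to the cover of the orbit of the unit speed linear flow in
   direction theta, on the time interval [0, t], starting at y. *)
Definition lifted_orbit theta (t : R) (y : cover) (c : R -> cover) : Prop :=
  c 0 = y /\
  forall s, 0 <= s <= t -> cell (c s).2 /\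
    (\forall s' \near s, 0 <= s' <= t ->
       c s' = translate (c s) ((s' - s) * theta.1, (s' - s) * theta.2)).

Section Lyapunov.
Variables (rho : free2 -> 'M[R]_2) (m : bundle_metric rho).

Definition vnorm (y : cover) (v : 'cV[R]_2) : R := Num.sqrt (qform (gram m y) v).

(* Parallel transport along the projection of a path c from y to y' in the cover
   maps the class of (y, v) to the class of (y', v); this is its norm. *)
Definition transport_opnorm (y y' : cover) : R :=
  sup [set vnorm y' v | v in [set v | vnorm y v <= 1]].

(* ||phi_t(x)||, given the default value 1 on the null set of x whose orbit
   meets p before time t. *)
Definition phi_norm theta (t : R) x : R :=
  xget 1 [set n | exists2 c, lifted_orbit theta t (1%g, x) c &
                  n = transport_opnorm (c 0) (c t)].

Definition mean_log_norm theta (t : R) : \bar R :=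
  (t^-1%:E * \int[lebesgue_measure \x lebesgue_measure]_(x in cell)
               (ln (phi_norm theta t x))%:E)%E.

(* chi(rho, F_theta) exists and is equal to chi. *)
Definition lyapunov_exponent theta (chi : \bar R) : Prop :=
  mean_log_norm theta t @[t --> +oo] --> chi.

Definition circle : set (R * R) := [set theta | theta.1 ^+ 2 + theta.2 ^+ 2 = 1].

Definition spectrum : set (R * R) :=
  [set theta | circle theta /\ lyapunov_exponent theta 0%E].

End Lyapunov.

(* The interior is taken in the circle. *)
Definition cantor_in_circle (K : set (R * R)) : Prop :=
  [/\ K `<=` circle, K !=set0, closed K,
      (forall U, open U -> U `&` circle `<=` K -> U `&` circle = set0) &
      isolated K = set0].

End PuncturedTorus.

(* Main.v *)
(* Write c = tr rho [a, b]; the hypotheses force c > 2. For a basis (al, be) of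
   the free group, let e, f be its abelianisation and A = rho al, B = rho be. A
   line of direction u e + v f with u, v >= 0 crosses the sides of the
   parallelogram (e, f) in a positive word in al, be, with about t u letters al
   and t v letters be after time t; subdividing the sector of directions as
   (e, e + f), (e + f, f) is the subtractive Euclidean algorithm.

   If |tr A|, |tr B| > 2 and tr AB >= (tr A)(tr B) / 2 up to sign ([escape]), then
   A and B preserve a cone, positive words grow exponentially, and the sector is
   disjoint from the spectrum. If no sector around an irrational direction is of
   this kind, then tr A and tr B decrease along the subdivision (by Fricke's
   identity) until every sector has an elliptic side; from then on the traces
   involved are at most c + 6, the matrices grow at most geometrically in the
   number k of steps while k (u_k + v_k) is arbitrarily small, and the exponent
   vanishes. A rational direction e is in the spectrum iff A is elliptic.

   Beside a hyperbolic axis there are escaping sectors on both sides, so the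
   spectrum is closed. An elliptic A has infinite order, so tr (A^n B) is both
   less and greater than 2 in absolute value for infinitely many n: directions
   n e + f in and out of the spectrum accumulate at e, and elliptic axes
   accumulate at every irrational direction of the spectrum. If there were no
   elliptic axis, the descent of traces would end at a basis with
   (tr A)(tr B)(tr AB) < 0; then A and B are products of reflections in three
   disjoint geodesics, and rho is the holonomy of a pair of pants. *)
From Pilot Require Import Defs.
From mathcomp Require Import all_boot all_order all_algebra.
From mathcomp Require Import all_classical all_reals all_analysis.
From mathcomp Require Import measurable_realfun.
From mathcomp Require Import ring lra zify.

Set Implicit Arguments.
Unset Strict Implicit.
Unset Printing Implicit Defensive.

Import Order.TTheory GRing.Theory Num.Theory.
Import numFieldNormedType.Exports.

Local Open Scope classical_set_scope.
Local Open Scope ring_scope.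
(* [frac] is also the name of a field of fractions in MathComp. *)
Import Pilot.Defs.

(** * Two by two matrices *)

Section Mat2.
Variable R : realType.
Implicit Types (A B M N : 'M[R]_2).

(** The exponent is a limit of means of a function whose measurability is never established.
    Directions are therefore tested only by bounds on the transport matrices that are uniform in the
    starting point, [slow] and [fast]. The passage to matrices rests on compactness of the closed
    square, on which the metric in the flat frame is comparable to the Euclidean one. The cover is
    combinatorial, so a change of parallelogram is a renaming of its points by finitely many group
    elements; these bounded factors vanish in the mean.

    Fricke's identity is read as a quadratic in one trace, of discriminant (X^2 - 4)(Z^2 - 4) + 4 (c
    - 2). Hence c > 2 gives the descent a fixed decrement sqrt (c - 2), and it also makes tr (A^n B)
    oscillate with amplitude above 2 when A is elliptic. The absence of parabolics excludes c = 2,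
    traces 2 and -2 on bases, and a B sending one fixed point of a hyperbolic A to the other.

    A pair of pants has to be exhibited as an explicit map onto the plane minus two points: the
    half-plane is folded onto the region outside three half-discs, which is then straightened. *)

Lemma ord2P (i : 'I_2) : i = 0 \/ i = 1.
Proof. by case: i => [[|[|//]] hi]; [left|right]; apply/val_inj. Qed.

Lemma mx2P M N : M 0 0 = N 0 0 -> M 0 1 = N 0 1 -> M 1 0 = N 1 0 ->
  M 1 1 = N 1 1 -> M = N.
Proof.
move=> h0 h1 h2 h3; apply/matrixP => i j.
by case: (ord2P i) => ->; case: (ord2P j) => ->.
Qed.

Lemma sum2 (F : 'I_2 -> R) : \sum_i F i = F 0 + F 1.
Proof.
rewrite big_ord_recl big_ord1; congr (_ + F _); exact/val_inj.
Qed.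

Lemma mul2E n (M : 'M[R]_2) (N : 'M[R]_(2, n)) i j :
  (M *m N) i j = M i 0 * N 0 j + M i 1 * N 1 j.
Proof. by rewrite mxE sum2. Qed.

Lemma tr2E M : \tr M = M 0 0 + M 1 1.
Proof. by rewrite /mxtrace sum2. Qed.

Lemma det2E M : \det M = M 0 0 * M 1 1 - M 0 1 * M 1 0.
Proof.
rewrite (expand_det_row _ 0) sum2 /cofactor !det_mx11 !mxE /=.
have -> : lift 0 (0 : 'I_1) = 1 :> 'I_2 by exact/val_inj.
have -> : lift 1 (0 : 'I_1) = 0 :> 'I_2 by exact/val_inj.
by rewrite /= expr0 expr1 mul1r mulN1r mulrN.
Qed.

Definition mk2 (a b c d : R) : 'M[R]_2 :=
  \matrix_(i, j) (if i == 0 then (if j == 0 then a else b)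
                  else (if j == 0 then c else d)).

Definition mx2E := (mul2E, tr2E, det2E).

Lemma mk2E a b c d : ((mk2 a b c d 0 0 = a) * (mk2 a b c d 0 1 = b)
  * (mk2 a b c d 1 0 = c) * (mk2 a b c d 1 1 = d))%type.
Proof. by rewrite /mk2 !mxE. Qed.

Lemma scalar2E (a : R) : (((a%:M : 'M[R]_2) 0 0 = a) * ((a%:M : 'M[R]_2) 0 1 = 0)
  * ((a%:M : 'M[R]_2) 1 0 = 0) * ((a%:M : 'M[R]_2) 1 1 = a))%type.
Proof. by rewrite !mxE /= !mulr1n !mulr0n. Qed.

Lemma cayley M : M *m M = \tr M *: M - (\det M)%:M.
Proof.
apply: mx2P; rewrite !(mx2E, mxE) /= ?mulr1n ?mulr0n; ring.
Qed.

Definition inv2 M : 'M[R]_2 := mk2 (M 1 1) (- M 0 1) (- M 1 0) (M 0 0).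

Lemma mul2V M : \det M = 1 -> M *m inv2 M = 1%:M.
Proof.
rewrite det2E => h; apply: mx2P; rewrite !mul2E !mk2E scalar2E; lra.
Qed.

Lemma mulV2 M : \det M = 1 -> inv2 M *m M = 1%:M.
Proof.
rewrite det2E => h; apply: mx2P; rewrite !mul2E !mk2E scalar2E; lra.
Qed.

Lemma inv2_unique M N : \det M = 1 -> M *m N = 1%:M -> N = inv2 M.
Proof.
move=> dM MN; by rewrite -[inv2 M]mulmx1 -MN mulmxA mulV2 // mul1mx.
Qed.

Lemma det_inv2 M : \det (inv2 M) = \det M.
Proof. by rewrite !det2E !mk2E; ring. Qed.

(** By [fricke], the trace of the commutator of A and B. It is kept as a polynomial in three traces
    because the descent is carried out on traces. *)
Definition kap A B : R :=
  (\tr A) ^+ 2 + (\tr B) ^+ 2 + (\tr (A *m B)) ^+ 2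
  - \tr A * \tr B * \tr (A *m B) - 2.

Lemma fricke A B : \det A = 1 -> \det B = 1 ->
  \tr (A *m B *m inv2 A *m inv2 B) = kap A B.
Proof.
rewrite !det2E /kap !(mx2E, mk2E) => hA hB.
move: (A 0 0) (A 0 1) (A 1 0) (A 1 1) hA => a b c d hA.
move: (B 0 0) (B 0 1) (B 1 0) (B 1 1) hB => p q r s hB.
(* Inserting determinants makes every term of degree two in the entries of A and in those of B; the
   identity is then polynomial. *)
have -> : 2 = (a * d - b * c) * (p * s - q * r) + (p * s - q * r)
  + (a * d - b * c) * (p * s - q * r) - (p * s - q * r) :> R by rewrite hA hB; ring.
have e1 : (a + d) ^+ 2 = (a + d) ^+ 2 * (p * s - q * r) by rewrite hB mulr1.
have e2 : (p + s) ^+ 2 = (p + s) ^+ 2 * (a * d - b * c) by rewrite hA mulr1.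
rewrite e1 e2; ring.
Qed.

Lemma kapC A B : kap B A = kap A B.
Proof. rewrite /kap [\tr (B *m A)]mxtrace_mulC; ring. Qed.

Lemma tr_mulL A B : \det A = 1 ->
  \tr (A *m (A *m B)) = \tr A * \tr (A *m B) - \tr B.
Proof.
move=> dA; rewrite mulmxA cayley dA mulmxBl -scalemxAl mul1mx.
by rewrite raddfB /= mxtraceZ.
Qed.

Lemma tr_mulV A B : \tr (inv2 A *m B) = \tr A * \tr B - \tr (A *m B).
Proof. by rewrite !(mx2E, mk2E); ring. Qed.

Lemma tr_inv2 A : \tr (inv2 A) = \tr A.
Proof. by rewrite !(mx2E, mk2E); ring. Qed.

(** A Vieta move: for fixed X = tr A and Z = tr (A B), the polynomial takes equal values at Y = tr B
    and at X Z - Y, the trace of A (A B). *)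
Lemma kapL A B : \det A = 1 -> kap A (A *m B) = kap A B.
Proof. by move=> dA; rewrite /kap tr_mulL //; ring. Qed.

Lemma kapV A B : kap (inv2 A) B = kap A B.
Proof. by rewrite /kap tr_inv2 tr_mulV; ring. Qed.

(** The quotient is unchanged when A or B changes sign. As tr (A^-1 B) = tr A tr B - tr (A B), it
    says that tr (A B) is at least tr (A^-1 B) once signs make tr A and tr B positive. *)
Definition escape A B : Prop :=
  [/\ 2 < `|\tr A|, 2 < `|\tr B| & 1 <= 2 * \tr (A *m B) / (\tr A * \tr B)].

End Mat2.

(** * A matrix norm and eigenframes of hyperbolic matrices *)

Section Hyperbolic.
Variable R : realType.
Implicit Types (A B M N P : 'M[R]_2).

(** The entry sum suits SL(2,R): inversion only permutes entries up to sign, and determinant 1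
    forces the norm to be at least 1, so that logarithms are nonnegative. *)
Definition nm M : R := `|M 0 0| + `|M 0 1| + `|M 1 0| + `|M 1 1|.

Lemma nm_ge0 M : 0 <= nm M.
Proof. by rewrite /nm !addr_ge0. Qed.

Lemma nm_entry M i j : `|M i j| <= nm M.
Proof.
have := (normr_ge0 (M 0 0), normr_ge0 (M 0 1), normr_ge0 (M 1 0), normr_ge0 (M 1 1)).
move=> [[[h1 h2] h3] h4]; rewrite /nm.
by case: (ord2P i) => ->; case: (ord2P j) => ->; lra.
Qed.

Lemma nmM M N : nm (M *m N) <= nm M * nm N.
Proof.
rewrite /nm !mul2E.
have H (a b c d : R) : `|a * b + c * d| <= `|a| * `|b| + `|c| * `|d|.
  by rewrite -!normrM; exact: ler_normD.
apply: (le_trans (lerD (lerD (lerD (H _ _ _ _) (H _ _ _ _)) (H _ _ _ _)) (H _ _ _ _))).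
have := (normr_ge0 (M 0 0), normr_ge0 (M 0 1), normr_ge0 (M 1 0), normr_ge0 (M 1 1)).
have := (normr_ge0 (N 0 0), normr_ge0 (N 0 1), normr_ge0 (N 1 0), normr_ge0 (N 1 1)).
move: `|N 0 0| `|N 0 1| `|N 1 0| `|N 1 1| => e f g h [[[h1 h2] h3] h4].
move: `|M 0 0| `|M 0 1| `|M 1 0| `|M 1 1| => a b c d [[[k1 k2] k3] k4].
rewrite -subr_ge0.
have -> : (a + b + c + d) * (e + f + g + h) -
  (a * e + b * g + (a * f + b * h) + (c * e + d * g) + (c * f + d * h)) =
  a * (g + h) + b * (e + f) + c * (g + h) + d * (e + f) by ring.
by rewrite !addr_ge0 // mulr_ge0 // addr_ge0.
Qed.

Lemma nmD M N : nm (M + N) <= nm M + nm N.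
Proof.
rewrite /nm !mxE.
have H (a b : R) : `|a + b| <= `|a| + `|b| by exact: ler_normD.
have := (H (M 0 0) (N 0 0), H (M 0 1) (N 0 1), H (M 1 0) (N 1 0), H (M 1 1) (N 1 1)).
by move=> [[[]]]; lra.
Qed.

Lemma nmZ a M : nm (a *: M) = `|a| * nm M.
Proof. by rewrite /nm !mxE !normrM; ring. Qed.

Lemma nmN M : nm (- M) = nm M.
Proof. by rewrite /nm !mxE !normrN. Qed.

Lemma nm_inv2 M : nm (inv2 M) = nm M.
Proof. by rewrite /nm !mk2E !normrN; ring. Qed.

Lemma nm1 : nm 1%:M = 2.
Proof. by rewrite /nm !scalar2E normr1 normr0; ring. Qed.

Lemma nm_sl2 M : \det M = 1 -> 1 <= nm M.
Proof.
rewrite det2E => h; have := (normr_ge0 (M 0 0), normr_ge0 (M 0 1), normr_ge0 (M 1 0), normr_ge0 (M 1 1)).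
move=> [[[h1 h2] h3] h4].
have : 1 <= `|M 0 0| * `|M 1 1| + `|M 0 1| * `|M 1 0|.
  rewrite -!normrM -[X in X <= _](normr1 R) -h; exact: ler_normB.
rewrite /nm; nra.
Qed.

Definition mxw A B (w : seq bool) : 'M[R]_2 :=
  foldr (fun (b : bool) M => (if b then B else A) *m M) 1%:M w.

Lemma mxw_opp A B w : exists e : R, `|e| = 1 /\ mxw A (- B) w = e *: mxw A B w.
Proof.
elim: w => [|b w [e [He IH]]] /=; first by exists 1; rewrite normr1 scale1r.
exists (if b then - e else e); rewrite IH; split; first by case: b; rewrite ?normrN.
by case: b; rewrite -?scalemxAr ?mulNmx ?scalerN ?scaleNr.
Qed.

Lemma mxw_conj P A B A' B' w : P *m A = A' *m P -> P *m B = B' *m P ->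
  P *m mxw A B w = mxw A' B' w *m P.
Proof.
move=> hA hB; elim: w => [|b w IH] /=; first by rewrite mulmx1 mul1mx.
by rewrite -[RHS]mulmxA -IH !mulmxA; case: b; rewrite ?hA ?hB.
Qed.

Lemma hyp_eig (X : R) : 2 < `|X| -> exists l : R, [/\ 1 < `|l|, l != 0 & X = l + l^-1].
Proof.
move=> hX.
wlog X0 : X hX / 0 < X.
  move=> H; have [X0|X0] := ltP 0 X; first exact: H.
  have [||l [l1 l0 lX]] := H (- X); first by rewrite normrN.
    by rewrite oppr_gt0 lt_neqAle X0 andbT; apply: contraTneq hX => ->; rewrite normr0 -leNgt.
  exists (- l); rewrite normrN oppr_eq0 l1 l0; split => //.
  by rewrite invrN -opprD -lX opprK.
rewrite gtr0_norm // in hX.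
have D0 : 0 < X ^+ 2 - 4 by nra.
pose s := Num.sqrt (X ^+ 2 - 4).
have s0 : 0 < s by rewrite sqrtr_gt0.
have s2 : s ^+ 2 = X ^+ 2 - 4 by rewrite sqr_sqrtr // ltW.
have l1 : 1 < (X + s) / 2 by lra.
exists ((X + s) / 2); split; first by rewrite gtr0_norm //; lra.
  by rewrite gt_eqF //; lra.
have -> : ((X + s) / 2)^-1 = (X - s) / 2.
  apply: (mulfI (x := (X + s) / 2)); first by rewrite gt_eqF //; lra.
  rewrite mulfV; last by rewrite gt_eqF //; lra.
  nra.
lra.
Qed.

Lemma hyp_frame A : \det A = 1 -> 2 < `|\tr A| -> exists P l,
  [/\ P \in unitmx, 1 < `|l|, \tr A = l + l^-1 & P *m A = mk2 l 0 0 l^-1 *m P].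
Proof.
move=> dA hA; have [l [l1 l0 lX]] := hyp_eig hA.
have dl : l - l^-1 != 0.
  apply: contraTneq l1 => /eqP; rewrite subr_eq0 => /eqP h.
  have : l ^+ 2 = 1 by rewrite expr2 {1}h mulVf.
  by move/eqP; rewrite sqrf_eq1 -leNgt => /orP[] /eqP ->; rewrite ?normrN normr1.
move: dA lX; rewrite det2E tr2E => dA lX.
have qe : l * l^-1 = 1 by rewrite mulfV.
set a := A 0 0 in dA lX; set b := A 0 1 in dA.
set c := A 1 0 in dA; set d := A 1 1 in dA lX.
(* The rows of P are left eigenvectors of A: one formula for b <> 0, one for c <> 0, and what
   remains is diagonal. *)
have [b0|b0] := eqVneq b 0; last first.
  exists (mk2 (l - d) b (l^-1 - d) b), l; split => //; last first.
    apply: mx2P; rewrite !mul2E !mk2E -/a -/b -/c -/d; try ring; nra.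
  rewrite unitmxE unitfE det2E !mk2E.
  have -> : (l - d) * b - b * (l^-1 - d) = b * (l - l^-1) by ring.
  by rewrite mulf_neq0.
have [c0|c0] := eqVneq c 0; last first.
  exists (mk2 c (l - a) c (l^-1 - a)), l; split => //; last first.
    apply: mx2P; rewrite !mul2E !mk2E -/a -/b -/c -/d; try ring; nra.
  rewrite unitmxE unitfE det2E !mk2E.
  have -> : c * (l^-1 - a) - (l - a) * c = - (c * (l - l^-1)) by ring.
  by rewrite oppr_eq0 mulf_neq0.
have : (a - l) * (a - l^-1) = 0 by rewrite b0 c0 in dA; nra.
move/eqP; rewrite mulf_eq0 !subr_eq0 => /orP[] /eqP al.
  exists 1%:M, l; split => //; first exact: unitmx1.
  rewrite mul1mx mulmx1; apply: mx2P; rewrite !mk2E -/a -/b -/c -/d //; lra.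
exists (mk2 0 1 1 0), l; split => //.
  by rewrite unitmxE unitfE det2E !mk2E !mulr1 mulr0 sub0r oppr_eq0 oner_neq0.
apply: mx2P; rewrite !mul2E !mk2E -/a -/b -/c -/d; lra.
Qed.

(** In an eigenframe of A the excess of [kap] over 2 is carried by the off-diagonal entries of B:
    for l <> l^-1 it is positive exactly when q and r have opposite signs. *)
Lemma kap_frame P A B l p q r s : P \in unitmx -> \det A = 1 -> \det B = 1 ->
  l != 0 ->
  P *m A = mk2 l 0 0 l^-1 *m P -> P *m B = mk2 p q r s *m P ->
  [/\ \tr B = p + s, \tr (A *m B) = l * p + s / l, p * s - q * r = 1 &
      kap A B - 2 = - (q * r) * (l - l^-1) ^+ 2].
Proof.
move=> uP dA dB l0 hA hB.
have conj M M' : P *m M = M' *m P -> M = invmx P *m M' *m P.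
  by move=> h; rewrite -mulmxA -h mulKmx.
have trc M M' : P *m M = M' *m P -> \tr M = \tr M'.
  by move=> /conj ->; rewrite -mulmxA mxtrace_mulC mulmxK.
have dB' : p * s - q * r = 1.
  have : \det B = \det (mk2 p q r s).
    rewrite (conj _ _ hB) !det_mulmx mulrAC -det_mulmx mulVmx // det1 mul1r //.
  by rewrite dB det2E !mk2E => <-.
have tA : \tr A = l + l^-1 by rewrite (trc _ _ hA) tr2E !mk2E.
have tB : \tr B = p + s by rewrite (trc _ _ hB) tr2E !mk2E.
have tAB : \tr (A *m B) = l * p + s / l.
  rewrite (trc _ (mk2 l 0 0 l^-1 *m mk2 p q r s)).
    by rewrite tr2E !mul2E !mk2E; ring.
  by rewrite mulmxA hA -!mulmxA hB.
split => //; rewrite /kap tA tB tAB.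
have -> : q * r = p * s - 1 by rewrite -dB'; ring.
field.
exact: l0.
Qed.


End Hyperbolic.

(** * Growth of positive words *)

Section Cone.
Variable R : realType.
Implicit Types (A B M N P : 'M[R]_2).

(* With slopes [t = y / x]: the interval [0, m], whose upper end is a fixed point
   of the projective action, is mapped into itself, and |x| is multiplied at
   least by [mu]. *)
Lemma cone_step (p q r s m mu x y : R) : x != 0 -> q < 0 -> 0 < r ->
  0 < m -> mu = p + q * m -> 0 < mu -> m * mu = r + s * m -> 0 <= s - q * m ->
  0 <= x * y <= m * x ^+ 2 ->
  [/\ mu * x ^+ 2 <= x * (p * x + q * y),
     0 <= (p * x + q * y) * (r * x + s * y) &
     (p * x + q * y) * (r * x + s * y) <= m * (p * x + q * y) ^+ 2].
Proof.
move=> x0 q0 r0 m0 muE mu0 fixm sq /andP[h0 h1].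
have x2 : 0 < x ^+ 2 by rewrite exprn_even_gt0.
have e1 : mu * x ^+ 2 <= x * (p * x + q * y).
  have : 0 <= - q * (m * x ^+ 2 - x * y) by rewrite mulr_ge0 //; lra.
  by rewrite muE; nra.
have e2 : 0 <= x * (r * x + s * y).
  have [s0|s0] := leP 0 s.
    have : 0 <= r * x ^+ 2 by rewrite mulr_ge0 // ltW.
    have : 0 <= s * (x * y) by rewrite mulr_ge0.
    nra.
  have a1 : 0 <= - s * (m * x ^+ 2 - x * y) by rewrite mulr_ge0 //; lra.
  have a2 : 0 <= (m * mu) * x ^+ 2 by apply: mulr_ge0; [apply: mulr_ge0; lra|exact: ltW].
  rewrite fixm in a2; nra.
have e1' : 0 <= x * (p * x + q * y).
  by apply: le_trans e1; rewrite mulr_ge0 // ltW.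
split=> //.
  have := mulr_ge0 e1' e2.
  have -> : x * (p * x + q * y) * (x * (r * x + s * y)) =
    x ^+ 2 * ((p * x + q * y) * (r * x + s * y)) by ring.
  by rewrite pmulr_rge0.
(* The defect factors through the distance of the old slope to m. As (1, m) is an eigenvector for
   [mu], [s - q * m] is the other eigenvalue. *)
rewrite -subr_ge0 -(pmulr_rge0 _ x2).
have -> : x ^+ 2 * (m * (p * x + q * y) ^+ 2 - (p * x + q * y) * (r * x + s * y)) =
  (x * (p * x + q * y)) * ((s - q * m) * (m * x ^+ 2 - x * y))
  + (x * (p * x + q * y)) * x ^+ 2 * (m * mu - r - s * m).
  by rewrite muE; ring.
rewrite fixm; have -> : r + s * m - r - s * m = 0 by ring.
rewrite mulr0 addr0; apply: mulr_ge0 => //; apply: mulr_ge0 => //; lra.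
Qed.

(** The edges of the invariant cone are the attracting directions of the two matrices: slope 0 for
    the diagonal one, slope [m], of eigenvalue [mu], for the other; s <= p makes [m] positive. The
    first column of a word stays in the cone, and its first entry is multiplied at each letter by at
    least the smaller of |l| and [mu]. *)
Lemma diag_cone (l p q r s : R) : 1 < `|l| -> p * s - q * r = 1 -> q < 0 -> 0 < r ->
  s <= p -> 2 < p + s -> exists2 k : R, 1 < k &
  forall w, k ^+ size w <= `|mxw (mk2 l 0 0 l^-1) (mk2 p q r s) w 0 0|.
Proof.
move=> l1 det q0 r0 sp ps.
pose D := (p + s) ^+ 2 - 4.
have D0 : 0 < D by rewrite /D; nra.
pose d := Num.sqrt D.
have d0 : 0 < d by rewrite sqrtr_gt0.
have d2 : d ^+ 2 = (p + s) ^+ 2 - 4 by rewrite sqr_sqrtr // ltW.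
have psd : d < p - s.
  have ps0 : 0 <= p - s by lra.
  rewrite -(ltr_pXn2r (n := 2)) ?nnegrE ?(ltW d0) // d2; nra.
pose m := (p - s - d) / (- (2 * q)).
have q2 : 0 < - (2 * q) by lra.
have m0 : 0 < m by rewrite divr_gt0 //; lra.
have qm : q * m = - (p - s - d) / 2.
  by rewrite /m; field; lra.
pose mu := p + q * m.
have muE : mu = (p + s + d) / 2 by rewrite /mu qm; lra.
have mu1 : 1 < mu by rewrite muE; lra.
have fixm : m * mu = r + s * m.
  apply: (mulfI (x := q)); first by lra.
  have -> : q * (m * mu) = (q * m) * mu by ring.
  have -> : q * (r + s * m) = q * r + s * (q * m) by ring.
  rewrite qm muE.
  have -> : q * r = p * s - 1 by lra.
  nra.
have sq : 0 <= s - q * m.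
  rewrite qm.
  have ps0 : 0 <= p + s by lra.
  have : d < p + s by rewrite -(ltr_pXn2r (n := 2)) ?nnegrE ?(ltW d0) // d2 gtrDl oppr_lt0.
  lra.
pose k := Num.min `|l| mu.
have k1 : 1 < k by rewrite lt_min l1 mu1.
have k0 : 0 < k by lra.
exists k => // w.
suff [] : k ^+ size w <= `|mxw (mk2 l 0 0 l^-1) (mk2 p q r s) w 0 0| /\
  0 <= mxw (mk2 l 0 0 l^-1) (mk2 p q r s) w 0 0 *
   mxw (mk2 l 0 0 l^-1) (mk2 p q r s) w 1 0
   <= m * mxw (mk2 l 0 0 l^-1) (mk2 p q r s) w 0 0 ^+ 2 by [].
elim: w => [|b w [IH1 IH2]] /=.
  by rewrite !scalar2E normr1 expr0 mulr0 expr1n mulr1 !lexx (ltW m0).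
set x := mxw _ _ w 0 0 in IH1 IH2 *; set y := mxw _ _ w 1 0 in IH2 *.
have x0 : x != 0.
  by rewrite -normr_gt0; apply: lt_le_trans IH1; rewrite exprn_gt0.
have x2 : 0 < x ^+ 2 by rewrite exprn_even_gt0.
have l0 : l != 0 by rewrite -normr_gt0; lra.
rewrite exprS; case: b; rewrite !mul2E !mk2E -/x -/y; last first.
  rewrite mul0r !addr0 mul0r add0r; split.
    by rewrite normrM ler_pM ?exprn_ge0 ?(ltW k0) // ge_min lexx.
  have -> : l * x * (l^-1 * y) = x * y by field.
  case/andP: IH2 => -> /= h2; apply: (le_trans h2).
  rewrite ler_wpM2l ?(ltW m0) // exprMn ler_peMl ?(ltW x2) //.
  by rewrite -real_normK ?num_real // expr_ge1 ?normr_ge0 // ltW.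
have [e1 e2 e3] := cone_step x0 q0 r0 m0 (erefl mu) (lt_trans ltr01 mu1) fixm sq IH2.
split; last by rewrite e2 e3.
have : mu * `|x| ^+ 2 <= `|x| * `|p * x + q * y|.
  by rewrite real_normK ?num_real // -normrM; apply: (le_trans e1); exact: ler_norm.
have x1 : 0 < `|x| by rewrite normr_gt0.
rewrite expr2 mulrCA ler_pM2l // => h; apply: le_trans h.
by rewrite ler_pM ?exprn_ge0 ?(ltW k0) // ge_min lexx orbT.
Qed.

(** In an eigenframe of A, [kap] above 2 reads q r < 0 and escape reads s <= p: these are the
    hypotheses of [diag_cone]. The constant d pays for the change of frame. *)
Lemma escape_growth A B : \det A = 1 -> \det B = 1 -> 2 < kap A B -> escape A B ->
  exists k d : R, [/\ 1 < k, 0 < d & forall w, d * k ^+ size w <= nm (mxw A B w)].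
Proof.
move=> dA dB kB eB.
wlog tB : B dB kB eB / 0 < \tr B.
  move=> H; have [tB|tB] := ltP 0 (\tr B); first exact: H.
  have tN : \tr (- B) = - \tr B by rewrite raddfN.
  have tAN : \tr (A *m - B) = - \tr (A *m B) by rewrite mulmxN raddfN.
  case: eB => e1 e2 e3.
  have tB' : 0 < - \tr B.
    by rewrite oppr_gt0 lt_neqAle tB andbT; apply: contraTneq e2 => ->; rewrite normr0 -leNgt.
  have [||||k [d [k1 d0 H1]]] := H (- B).
  - by rewrite det2E !mxE; rewrite det2E in dB; lra.
  - by move: kB; rewrite /kap tN tAN; lra.
  - split; rewrite ?tN ?tAN ?normrN //.
    suff -> : 2 * - \tr (A *m B) / (\tr A * - \tr B) = 2 * \tr (A *m B) / (\tr A * \tr B) by [].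
    by rewrite mulrN mulrN invrN mulrNN.
  - by rewrite tN.
  exists k, d; split=> // w; apply: (le_trans (H1 w)).
  by have [e [He ->]] := mxw_opp A B w; rewrite nmZ He mul1r.
case: eB => tA tB2; rewrite gtr0_norm // in tB2 => e3.
have [P0 [l [uP0 l1 lE PA0]]] := hyp_frame dA tA.
have l0 : l != 0 by rewrite -normr_gt0; lra.
pose B' := P0 *m B *m invmx P0.
have PB0 : P0 *m B = mk2 (B' 0 0) (B' 0 1) (B' 1 0) (B' 1 1) *m P0.
  have -> : mk2 (B' 0 0) (B' 0 1) (B' 1 0) (B' 1 1) = B' by apply: mx2P; rewrite mk2E.
  by rewrite /B' mulmxKV.
have [P [p [q [r [s [uP PA PB q0]]]]]] : exists P p q r s, [/\ P \in unitmx,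
  P *m A = mk2 l 0 0 l^-1 *m P, P *m B = mk2 p q r s *m P & q <= 0].
  have [q0|q0] := leP (B' 0 1) 0; first by exists P0, (B' 0 0), (B' 0 1), (B' 1 0), (B' 1 1).
  (* Conjugation by F fixes the diagonal matrix and changes the signs of q and r. *)
  pose F : 'M[R]_2 := mk2 1 0 0 (-1).
  exists (F *m P0), (B' 0 0), (- B' 0 1), (- B' 1 0), (B' 1 1); split; last by rewrite oppr_le0 ltW.
  - rewrite unitmx_mul uP0 andbT unitmxE unitfE det2E !mk2E; lra.
  - rewrite -mulmxA PA0 !mulmxA; congr (_ *m _).
    by apply: mx2P; rewrite !mul2E !mk2E; ring.
  - rewrite -mulmxA PB0 !mulmxA; congr (_ *m _).
    by apply: mx2P; rewrite !mul2E !mk2E; ring.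
have [tBE tABE det kapE] := kap_frame uP dA dB l0 PA PB.
have qr : q * r < 0.
  have : 0 < - (q * r) * (l - l^-1) ^+ 2 by rewrite -kapE; lra.
  by rewrite pmulr_lgt0; [lra|]; move=> *; rewrite exprn_even_gt0 //=;
   apply: contraTneq l1 => /eqP; rewrite subr_eq0 => /eqP h;
   have : l ^+ 2 = 1 by [rewrite expr2 {1}h mulVf];
   move/eqP; rewrite sqrf_eq1 -leNgt => /orP[] /eqP ->; rewrite ?normrN normr1.
have q0' : q < 0 by rewrite lt_neqAle q0 andbT; apply: contraTneq qr => ->; rewrite mul0r ltxx.
have r0 : 0 < r by nra.
have sp : s <= p.
  rewrite tABE tBE lE in e3; rewrite tBE in tB2.
  have l2 : 1 < l ^+ 2 by rewrite -real_normK ?num_real // expr_gt1 ?normr_ge0.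
  have -> : (s <= p) = (0 <= (p - s) * (l ^+ 2 - 1) / ((l ^+ 2 + 1) * (p + s))).
    rewrite pmulr_lge0; last by rewrite invr_gt0 mulr_gt0 //; lra.
    by rewrite pmulr_lge0 ?subr_ge0 // subr_gt0.
  suff -> : (p - s) * (l ^+ 2 - 1) / ((l ^+ 2 + 1) * (p + s)) =
    2 * (l * p + s / l) / ((l + l^-1) * (p + s)) - 1 by rewrite subr_ge0.
  field; rewrite l0 /=; repeat (apply/andP; split); apply/eqP; nra.
rewrite tBE in tB2.
have [k k1 H] := diag_cone l1 det q0' r0 sp tB2.
pose C := nm P * nm (invmx P).
have C0 : 0 < C.
  have := nmM P (invmx P); rewrite mulmxV // nm1 -/C; lra.
exists k, C^-1; split; rewrite ?invr_gt0 // => w.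
rewrite ler_pdivrMl //; apply: (le_trans (H w)).
apply: (le_trans (nm_entry _ _ _)).
have -> : mxw (mk2 l 0 0 l^-1) (mk2 p q r s) w = P *m mxw A B w *m invmx P.
  by rewrite (mxw_conj w PA PB) mulmxK.
apply: (le_trans (nmM _ _)); rewrite /C mulrAC ler_wpM2r ?nm_ge0 //.
exact: nmM.
Qed.

End Cone.

(** * Descent of traces *)

Section TraceScalars.
Variable R : realType.
Implicit Types (X Y Z : R).

Definition frk X Y Z : R := X ^+ 2 + Y ^+ 2 + Z ^+ 2 - X * Y * Z - 2.

Lemma half_lt_same (a b : R) : a != 0 -> ~ (1 <= 2 * (a - b) / a) ->
  0 < a * b /\ `|a| < 2 * `|b|.
Proof.
move=> a0 /negP; rewrite -ltNge => h.
have a2 : 0 < a ^+ 2 by rewrite exprn_even_gt0.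
have h2 : a ^+ 2 < 2 * (a * b).
  have : 2 * (a - b) / a * a ^+ 2 < a ^+ 2 by rewrite gtr_pMl.
  have -> : 2 * (a - b) / a * a ^+ 2 = 2 * a ^+ 2 - 2 * (a * b) by field.
  lra.
have ab : 0 < a * b by lra.
split => //; have a1 : 0 < `|a| by rewrite normr_gt0.
rewrite -(ltr_pM2l a1) -expr2 real_normK ?num_real // mulrCA -normrM (gtr0_norm ab).
lra.
Qed.

(** The failed inequality says that Y has the sign of X Z and |X Z| < 2 |Y|. The square of 2 Y - X Z
    is the discriminant (X^2 - 4)(Z^2 - 4) + 4 (frk - 2), so 2 |Y| exceeds |X Z|, itself at least 2
    |Z|, by at least 2 sqrt (frk - 2). *)
Lemma descent X Y Z : 2 < `|X| -> 2 < `|Z| -> 2 < frk X Y Z ->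
  ~ (1 <= 2 * (X * Z - Y) / (X * Z)) ->
  `|Z| + Num.sqrt (frk X Y Z - 2) <= `|Y|.
Proof.
move=> hX hZ hk hn.
have XZ0 : X * Z != 0.
  by rewrite mulf_neq0 // -normr_gt0; apply: lt_trans _ (_ : 2 < _); rewrite ?ltr0n.
have [ab hlt] := half_lt_same XZ0 hn.
pose s := Num.sqrt (frk X Y Z - 2).
have s2 : s ^+ 2 = frk X Y Z - 2 by rewrite sqr_sqrtr //; lra.
have s0 : 0 <= s by exact: sqrtr_ge0.
have X4 : 4 < X ^+ 2.
  by rewrite -real_normK ?num_real //; move: `|X| hX => u hu; nra.
have Z4 : 4 < Z ^+ 2.
  by rewrite -real_normK ?num_real //; move: `|Z| hZ => u hu; nra.
have e : (2 * `|Y| - `|X * Z|) ^+ 2 = (2 * Y - X * Z) ^+ 2.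
  have -> : (2 * `|Y| - `|X * Z|) ^+ 2 = 4 * `|Y| ^+ 2 - 4 * (`|X * Z| * `|Y|) + `|X * Z| ^+ 2 by ring.
  rewrite -normrM (gtr0_norm ab) !real_normK ?num_real //; ring.
have e2 : (2 * Y - X * Z) ^+ 2 = (X ^+ 2 - 4) * (Z ^+ 2 - 4) + 4 * s ^+ 2.
  by rewrite s2 /frk; ring.
have e3 : (2 * s) ^+ 2 <= (2 * `|Y| - `|X * Z|) ^+ 2.
  rewrite e e2 exprMn; have : 0 <= (X ^+ 2 - 4) * (Z ^+ 2 - 4) by rewrite mulr_ge0; lra.
  lra.
have e4 : 2 * s <= 2 * `|Y| - `|X * Z|.
  by move: e3; rewrite ler_pXn2r // ?nnegrE; lra.
have : 2 * `|Z| <= `|X * Z|.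
  by rewrite normrM ler_wpM2r // ltW.
rewrite -/s; lra.
Qed.

Lemma descent_gt2 X Y Z : 2 < `|X| -> 2 < `|Z| -> 2 < frk X Y Z ->
  ~ (1 <= 2 * (X * Z - Y) / (X * Z)) -> 2 < `|Y|.
Proof.
move=> hX hZ hk hn; have := descent hX hZ hk hn.
have := sqrtr_ge0 (frk X Y Z - 2); lra.
Qed.

(** X^2 is at most [frk X Y Z] + 2 + |X Y Z|, and |Y Z| <= 4 turns this into a quadratic inequality
    for |X|. *)
Lemma frk_bound X Y Z : 2 < frk X Y Z -> `|Y| <= 2 -> `|Z| <= 2 -> `|X| <= frk X Y Z + 6.
Proof.
move=> hk hY hZ.
have hYZ : `|Y * Z| <= 4 by rewrite normrM; 
  by rewrite (_ : 4 = 2 * 2) ?ler_pM //; lra.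
have h : X ^+ 2 <= frk X Y Z + 2 + 4 * `|X|.
  have : X * (Y * Z) <= 4 * `|X|.
    by apply: (le_trans (ler_norm _)); rewrite normrM mulrC ler_wpM2r.
  have kE : frk X Y Z = X ^+ 2 + Y ^+ 2 + Z ^+ 2 - X * (Y * Z) - 2 by rewrite /frk; ring.
  rewrite kE; have := (sqr_ge0 Y, sqr_ge0 Z); move=> []; lra.
rewrite leNgt; apply/negP => hX.
rewrite -real_normK ?num_real // in h.
move: `|X| (frk X Y Z) h hX hk => u k h hX hk.
have a1 : 0 < u * (u - k - 6) by rewrite mulr_gt0 //; lra.
have a2 : 0 < k * (u - 1) by rewrite mulr_gt0 //; lra.
lra.
Qed.

(** For y <= z <= x y / 2 the quadratic decreases in z, so z = y is the worst case, then y = x,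
    where 2 - frk x x x = (x - 2)^2 (x + 1). *)
Lemma sink_sorted (x y z : R) : 2 < x -> x <= y -> y <= z -> 2 * z <= x * y ->
  frk x y z <= 2.
Proof.
move=> x2 xy yz h; rewrite /frk.
have a1 : (z - y) * (z + y - x * y) <= 0 by rewrite mulr_ge0_le0 //; lra.
have a2 : (x - 2) * (y ^+ 2 - x ^+ 2) >= 0.
  rewrite mulr_ge0 //; first lra.
  by rewrite subr_ge0 ler_pXn2r ?nnegrE //; lra.
have a3 : 0 <= (x - 2) ^+ 2 * (x + 1) by rewrite mulr_ge0 ?sqr_ge0 //; lra.
nra.
Qed.

Lemma sink_pos (x y z : R) : 2 < x -> 2 < y -> 2 < z ->
  2 * z <= x * y -> 2 * y <= x * z -> 2 * x <= y * z -> frk x y z <= 2.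
Proof.
move=> hx hy hz h1 h2 h3.
have fC a b d : frk a b d = frk b a d by rewrite /frk; ring.
have fC' a b d : frk a b d = frk a d b by rewrite /frk; ring.
have [xy|/ltW xy] := leP x y; have [yz|/ltW yz] := leP y z; have [xz|/ltW xz] := leP x z.
- exact: sink_sorted.
- exact: sink_sorted.
- by rewrite fC'; apply: sink_sorted => //; lra.
- by rewrite fC' fC; apply: sink_sorted => //; lra.
- by rewrite fC; apply: sink_sorted => //; lra.
- by rewrite fC fC'; apply: sink_sorted => //; lra.
- have e : x = y by lra.
  by rewrite fC' fC; apply: sink_sorted => //; lra.
- by rewrite fC' fC fC'; apply: sink_sorted => //; lra.
Qed.

(** No Vieta move lowers the absolute value of a trace. Were the product positive, the absolute
    values would satisfy the same identity and inequalities, against [sink_pos]. *)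
Lemma sink X Y Z : 2 < `|X| -> 2 < `|Y| -> 2 < `|Z| -> 2 < frk X Y Z ->
  ~ (1 <= 2 * Z / (X * Y)) -> 1 <= 2 * (X * Z - Y) / (X * Z) ->
  1 <= 2 * (Y * Z - X) / (Y * Z) -> X * Y * Z < 0.
Proof.
move=> hX hY hZ hk h1 h2 h3.
have X0 : X != 0 by rewrite -normr_gt0; lra.
have Y0 : Y != 0 by rewrite -normr_gt0; lra.
have Z0 : Z != 0 by rewrite -normr_gt0; lra.
have p0 : X * Y * Z != 0 by rewrite !mulf_neq0.
rewrite lt_neqAle p0 /= leNgt; apply/negP => pos.
have key (a b d : R) : a != 0 -> b != 0 -> 0 < a * b * d -> 2 * d / (a * b) <= 1 ->
  2 * `|d| <= `|a| * `|b|.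
  move=> a0 b0 abd h; have ab0 : a * b != 0 by rewrite mulf_neq0.
  have ab2 : 0 < (a * b) ^+ 2 by rewrite exprn_even_gt0.
  have h' : 2 * (a * b * d) <= (a * b) ^+ 2.
    have : 2 * d / (a * b) * (a * b) ^+ 2 <= (a * b) ^+ 2 by rewrite ger_pMl.
    suff -> : 2 * d / (a * b) * (a * b) ^+ 2 = 2 * (a * b * d) by [].
    field; exact/andP.
  have ab1 : 0 < `|a * b| by rewrite normr_gt0.
  rewrite -normrM -(ler_pM2l ab1) mulrCA -normrM (gtr0_norm abd) -expr2 real_normK ?num_real //.
have /negP := h1; rewrite -ltNge => /ltW h1'.
have k1 := key X Y Z X0 Y0 pos h1'.
have k2 : 2 * `|Y| <= `|X| * `|Z|.
  apply: key => //; first by rewrite mulrAC.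
  suff : 2 * Y / (X * Z) = 2 - 2 * (X * Z - Y) / (X * Z) by move=> ->; lra.
  by field; exact/andP.
have k3 : 2 * `|X| <= `|Y| * `|Z|.
  apply: key => //; first by rewrite mulrC mulrA.
  suff : 2 * X / (Y * Z) = 2 - 2 * (Y * Z - X) / (Y * Z) by move=> ->; lra.
  by field; exact/andP.
have := sink_pos hX hY hZ k1 k2 k3.
suff -> : frk `|X| `|Y| `|Z| = frk X Y Z by lra.
rewrite /frk !real_normK ?num_real // -!normrM gtr0_norm //.
Qed.

End TraceScalars.

(** * Powers of elliptic and hyperbolic matrices *)

Section Elliptic.
Variable R : realType.
Implicit Types (A B J : 'M[R]_2).

Lemma dirichlet (a e : R) : 0 < e -> exists m (k : int),
  (0 < m)%N /\ `|m%:R * a - k%:~R| < e.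
Proof.
move=> e0; pose g (i : nat) : R := i%:R * a - (Num.floor (i%:R * a))%:~R.
have g01 i : 0 <= g i < 1.
  have := floor_itv (i%:R * a); rewrite intrD /g => /andP[h1 h2]; apply/andP; split; lra.
pose K := Num.truncn (e^-1).
have K0 : 0 < K.+1%:R :> R by rewrite ltr0n.
have Ke : e^-1 < K.+1%:R by exact: truncnS_gt.
(* Pigeonhole: K + 2 fractional parts fall into K + 1 boxes of width less than [e]. *)
pose h (i : 'I_K.+2) : 'I_K.+1 := inord (Num.truncn (K.+1%:R * g i)).
have hn : ~ injective h.
  by move/leq_card; rewrite !card_ord ltnn.
have [i [j [ij hij]]] : exists i j : 'I_K.+2, (i < j)%N /\ h i = h j.
  apply: contrapT => H; apply: hn => i j hij; apply/val_inj.
  by case: (ltngtP i j) => // l; case: H; [exists i, j|exists j, i].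
have tr (l : 'I_K.+2) : (h l)%:R <= K.+1%:R * g l < (h l).+1%:R.
  have /andP[g0 g1] := g01 l.
  have p0 : 0 <= K.+1%:R * g l by rewrite mulr_ge0 // ltW.
  rewrite inordK; first exact: truncn_itv.
  by rewrite truncn_lt_nat // gtr_pMr.
have := tr i; have := tr j; rewrite hij -natr1 => /andP[j1 j2] /andP[i1 i2].
have d1 : `|g j - g i| < e.
  rewrite -(ltr_pM2l K0) -{1}(gtr0_norm K0) -normrM; apply: (@lt_trans _ _ 1).
    rewrite mulrBr ltr_norml; apply/andP; split; lra.
  by rewrite -ltr_pdivrMr // div1r.
exists (j - i)%N, (Num.floor (j%:R * a) - Num.floor (i%:R * a)); split; first by rewrite subn_gt0.
rewrite natrB 1?ltnW // intrB.
suff -> : (j%:R - i%:R) * a - ((Num.floor (j%:R * a))%:~R - (Num.floor (i%:R * a))%:~R) = g j - g i by [].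
by rewrite /g; ring.
Qed.

(** Some multiple of [a] is, modulo T, a nonzero step [eta] shorter than [e], and repeating it
    passes within [e] of any target. The target is first shifted by many turns so that at least N
    repetitions are needed. *)
Lemma kronecker (a T t e : R) (N : nat) : 0 < T -> 0 < e ->
  (forall n (M : int), (0 < n)%N -> n%:R * a <> T * M%:~R) ->
  exists n (M : int), (N <= n)%N /\ `|n%:R * a - t - T * M%:~R| < e.
Proof.
move=> T0 e0 irr.
have [m [k [m0 hm]]] := @dirichlet (a / T) (e / T) (divr_gt0 e0 T0).
pose eta := m%:R * a - T * k%:~R.
have Tn : T != 0 by rewrite gt_eqF.
have eta_lt : `|eta| < e.
  have -> : eta = (m%:R * (a / T) - k%:~R) * T by rewrite /eta; field.
  by rewrite normrM (gtr0_norm T0) -ltr_pdivlMr.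
have eta0 : eta != 0 by rewrite subr_eq0; apply/eqP; exact: irr.
have [M HM] : exists M : int, N%:R <= (t + T * M%:~R) / eta.
  have [ep|en] := ltP 0 eta.
    exists (Num.ceil ((N%:R * eta - t) / T)); rewrite ler_pdivlMr //.
    have := ceil_ge ((N%:R * eta - t) / T); rewrite ler_pdivrMr // => h.
    by lra.
  have en' : eta < 0 by rewrite lt_neqAle eta0.
  exists (Num.floor ((N%:R * eta - t) / T)); rewrite ler_ndivlMr //.
  have := floor_le ((N%:R * eta - t) / T); rewrite ler_pdivlMr // => h.
  by lra.
pose y := (t + T * M%:~R) / eta.
have y0 : 0 <= y by apply: le_trans HM; exact: ler0n.
pose j := Num.truncn y.
have /andP[j1 j2] := truncn_itv y0; rewrite -/j -natr1 in j1 j2.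
exists (j * m)%N, (M + k * j%:Z); split.
  apply: (@leq_trans j); first by rewrite /j truncn_ge_nat.
  by rewrite leq_pmulr.
rewrite natrM intrD intrM.
have -> : (j%:Z)%:~R = j%:R :> R by [].
have -> : j%:R * m%:R * a - t - T * (M%:~R + k%:~R * j%:R) = (j%:R - y) * eta.
  have -> : (j%:R - y) * eta = j%:R * eta - (t + T * M%:~R) by rewrite mulrBl /y divfK.
  by rewrite /eta; ring.
apply: le_lt_trans eta_lt.
rewrite normrM ler_piMl // ler_norml; apply/andP; split; lra.
Qed.

Lemma cos_int (x : R) (M : int) : cos (x + (pi *+ 2) * M%:~R) = cos x.
Proof.
case: M => n.
  by rewrite -[_%:~R]/(n%:R) mulr_natr periodicn //; exact: cosD2pi.
rewrite NegzE mulrNz mulrN -[(n.+1)%:~R]/(n.+1%:R) mulr_natr.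
by rewrite -[LHS](periodicn (@cosD2pi R) n.+1) subrK.
Qed.

Lemma sin_int (x : R) (M : int) : sin (x + (pi *+ 2) * M%:~R) = sin x.
Proof.
case: M => n.
  by rewrite -[_%:~R]/(n%:R) mulr_natr periodicn //; exact: sinD2pi.
rewrite NegzE mulrNz mulrN -[(n.+1)%:~R]/(n.+1%:R) mulr_natr.
by rewrite -[LHS](periodicn (@sinD2pi R) n.+1) subrK.
Qed.

Lemma elliptic_pow A : \det A = 1 -> `|\tr A| < 2 -> exists (a : R) J,
  [/\ \tr A = 2 * cos a, sin a != 0, J = (sin a)^-1 *: (A - (cos a)%:M) &
   forall n, A ^+ n = (cos (n%:R * a))%:M + sin (n%:R * a) *: J].
Proof.
move=> dA tA; pose x := \tr A / 2.
have /andP[x1 x2] : -1 < x < 1 by rewrite ltr_norml in tA; rewrite /x; lra.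
have x3 : -1 <= x <= 1 by rewrite !ltW.
pose a := acos x.
have ca : cos a = x by rewrite acosK.
have sa : sin a = Num.sqrt (1 - x ^+ 2) by rewrite sin_acos.
have s0 : 0 < sin a by rewrite sa sqrtr_gt0; nra.
have cs := cos2Dsin2 a.
have trE : \tr A = 2 * cos a by rewrite ca /x; lra.
pose J := (sin a)^-1 *: (A - (cos a)%:M).
have sJ : sin a *: J = A - (cos a)%:M.
  by rewrite /J scalerA mulfV ?gt_eqF // scale1r.
have AE : A = (cos a)%:M + sin a *: J by rewrite sJ addrC subrK.
exists a, J; split=> //; first by rewrite gt_eqF.
have JJ : J *m J = (-1)%:M.
  have : sin a ^+ 2 *: (J *m J) = sin a ^+ 2 *: (-1)%:M.
    rewrite expr2 -scalerA scalemxAl scalemxAr sJ mulmxBr !mulmxBl cayley dA trE.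
    rewrite -scalar_mxM mul_scalar_mx mul_mx_scalar.
    apply: mx2P; rewrite !mxE /= ?mulr1n ?mulr0n; nra.
  by move/scalerI; apply; rewrite sqrf_eq0 gt_eqF.
move: J sJ AE JJ => J _ AE JJ.
elim=> [|n IH]; first by rewrite expr0 mul0r cos0 sin0 scale0r addr0.
rewrite exprS IH -natr1 mulrDl mul1r cosD sinD {1}AE -mulmxE.
rewrite mulmxDl !mulmxDr -!scalemxAl -!scalemxAr JJ.
rewrite -scalar_mxM mul_scalar_mx mul_mx_scalar.
apply: mx2P; rewrite !mxE /= ?mulr1n ?mulr0n; ring.
Qed.

Lemma elliptic_bounded A : \det A = 1 -> `|\tr A| < 2 ->
  exists C : R, forall n, nm (A ^+ n) <= C.
Proof.
move=> dA tA; have [a [J [_ _ _ H]]] := elliptic_pow dA tA.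
exists (2 + nm J) => n; rewrite H; apply: (le_trans (nmD _ _)); apply: lerD.
  rewrite -scalemx1 nmZ nm1 ler_piMl // ?cos_max //.
by rewrite nmZ ler_piMl ?nm_ge0 // sin_max.
Qed.

(** tr (A^n B) is a sinusoid evaluated at n a, and infinite order makes these angles dense modulo 2
    pi. Its amplitude exceeds 2 exactly because [kap A B] does, so values near the maximum and near
    a zero both occur beyond N. *)
Lemma elliptic_dense A B (N : nat) : \det A = 1 -> \det B = 1 -> 2 < kap A B ->
  `|\tr A| < 2 -> (forall n, (0 < n)%N -> A ^+ n <> 1) ->
  (exists2 n, (N <= n)%N & `|\tr (A ^+ n *m B)| < 2) /\
  (exists2 n, (N <= n)%N & 2 < `|\tr (A ^+ n *m B)|).
Proof.
move=> dA dB kB tA inf; have [a [J [tE s0 JE H]]] := elliptic_pow dA tA.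
pose W := \tr (J *m B); pose Y := \tr B.
pose g (x : R) := cos x * Y + sin x * W.
have gE n : \tr (A ^+ n *m B) = g (n%:R * a).
  rewrite H mulmxDl mul_scalar_mx -scalemxAl raddfD /= !mxtraceZ //.
have cs := cos2Dsin2 a.
have K4 : 4 < Y ^+ 2 + W ^+ 2.
  have WE : W = (\tr (A *m B) - cos a * Y) / sin a.
    rewrite /W JE -scalemxAl mxtraceZ mulmxBl mul_scalar_mx raddfB /= mxtraceZ mulrC //.
  have s2 : 0 < sin a ^+ 2 by rewrite exprn_even_gt0.
  have -> : (4 < Y ^+ 2 + W ^+ 2) = (4 * sin a ^+ 2 < Y ^+ 2 * sin a ^+ 2 + (W * sin a) ^+ 2).
    by rewrite exprMn -mulrDl ltr_pM2r.
  rewrite WE divfK //.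
  have -> : sin a ^+ 2 = 1 - cos a ^+ 2 by rewrite -cs; ring.
  by move: kB; rewrite /kap tE -/Y; move: (\tr (A *m B)) => Z; nra.
have g_cont : continuous g.
  move=> x; apply: cvgD; apply: cvgM; try exact: cvg_cst.
    exact: continuous_cos.
  exact: continuous_sin.
have irr n (M : int) : (0 < n)%N -> n%:R * a <> (pi *+ 2) * M%:~R.
  move=> n0 h; apply: (inf n n0); rewrite H h.
  by rewrite -[_ * _]add0r cos_int sin_int cos0 sin0 scale0r addr0.
have T0 : 0 < pi *+ 2 :> R by rewrite pmulrn_lgt0 // pi_gt0.
have approx t d : 0 < d -> exists2 n, (N <= n)%N & `|g (n%:R * a) - g t| < d.
  move=> d0; have /cvgrPdist_lt/(_ _ d0) := g_cont t.
  move=> /nbhs_ballP[e /= e0 He].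
  have [n [M [Nn hn]]] := kronecker t N T0 e0 irr.
  exists n => //; have -> : g (n%:R * a) = g (n%:R * a - (pi *+ 2) * M%:~R).
    by rewrite /g -{1}(subrK ((pi *+ 2) * M%:~R) (n%:R * a)) cos_int
      -{2}(subrK ((pi *+ 2) * M%:~R) (n%:R * a)) sin_int.
  rewrite distrC; apply: He; rewrite -ball_normE /= distrC.
  by move: hn; rewrite addrAC.
pose K := Num.sqrt (Y ^+ 2 + W ^+ 2).
have K2 : K ^+ 2 = Y ^+ 2 + W ^+ 2 by rewrite sqr_sqrtr // addr_ge0 ?sqr_ge0.
have K0 : 0 <= K by exact: sqrtr_ge0.
have Kgt2 : 2 < K by rewrite -(ltr_pXn2r (n := 2)) ?nnegrE // K2; lra.
have Kn : K != 0 by lra.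
(* [t] is the phase of the maximum [K], and t + pi / 2 is a zero. *)
have [t [ct st]] : exists t, cos t = Y / K /\ sin t = W / K.
  have yw : (Y / K) ^+ 2 + (W / K) ^+ 2 = 1.
    by rewrite !expr_div_n -mulrDl -K2 divff // sqrf_eq0.
  have yr : -1 <= Y / K <= 1.
    rewrite -ler_norml -(ler_pXn2r (n := 2)) ?nnegrE // real_normK ?num_real // expr1n -yw lerDl sqr_ge0 //.
  have sq : Num.sqrt (1 - (Y / K) ^+ 2) = `|W / K|.
    by rewrite -yw addrC addKr sqrtr_sqr.
  have [w0|w0] := leP 0 (W / K).
    by exists (acos (Y / K)); rewrite acosK // sin_acos // sq ger0_norm.
  by exists (- acos (Y / K)); rewrite cosN sinN acosK // sin_acos // sq ltr0_norm // opprK.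
split.
  have [n Nn hn] := approx (t + pi / 2) 2 (ltr0n _ 2).
  exists n => //; rewrite gE; move: hn.
  suff -> : g (t + pi / 2) = 0 by rewrite subr0.
  by rewrite /g cosDpihalf sinDpihalf ct st; field.
have [n Nn hn] := approx t (K - 2) ltac:(lra).
exists n => //; rewrite gE; move: hn.
have -> : g t = K.
  rewrite /g ct st; apply: (mulfI Kn); rewrite -[RHS]expr2 K2; field; exact: Kn.
rewrite ltr_norml => /andP[h1 h2]; apply: lt_le_trans (ler_norm _); lra.
Qed.

End Elliptic.

Section HyperbolicPowers.
Variable R : realType.
Implicit Types (A B P : 'M[R]_2).

Lemma expr_unbounded (l x : R) : 1 < l -> exists n, x < l ^+ n.
Proof.
move=> l1; have [n hn] : exists n : nat, x < n%:R * (l - 1).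
  exists (Num.truncn (x / (l - 1))).+1.
  by rewrite -ltr_pdivrMr ?truncnS_gt // subr_gt0.
exists n; apply: (lt_le_trans hn).
elim: n {hn} => [|n IH]; first by rewrite mul0r expr0.
have h : 1 <= l ^+ n by rewrite exprn_ege1 // ltW.
rewrite -natr1 exprS; nra.
Qed.

Lemma hyp_pow_frame P A l n : P *m A = mk2 l 0 0 l^-1 *m P ->
  P *m A ^+ n = mk2 (l ^+ n) 0 0 (l ^- n) *m P.
Proof.
move=> h; elim: n => [|n IH].
  rewrite expr0 mulmx1 invr1; have -> : mk2 1 0 0 1 = 1%:M :> 'M[R]_2.
    by apply: mx2P; rewrite mk2E scalar2E.
  by rewrite mul1mx.
rewrite exprS -mulmxE mulmxA h -mulmxA IH mulmxA; congr (_ *m _).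
by apply: mx2P; rewrite !mul2E !mk2E ?exprS ?invfM; ring.
Qed.

Lemma hyp_growth A : \det A = 1 -> 2 < `|\tr A| -> exists k d : R,
  [/\ 1 < k, 0 < d & forall n, d * k ^+ n <= nm (A ^+ n)].
Proof.
move=> dA tA; have [P [l [uP l1 _ PA]]] := hyp_frame dA tA.
pose C := nm P * nm (invmx P).
have C0 : 0 < C by have := nmM P (invmx P); rewrite mulmxV // nm1 -/C; lra.
exists `|l|, C^-1; split; rewrite ?invr_gt0 // => n.
rewrite ler_pdivrMl // -normrX.
have -> : l ^+ n = (P *m A ^+ n *m invmx P) 0 0.
  by rewrite (hyp_pow_frame n PA) mulmxK // mk2E.
apply: (le_trans (nm_entry _ _ _)); apply: (le_trans (nmM _ _)).
rewrite /C mulrAC ler_wpM2r ?nm_ge0 //; exact: nmM.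
Qed.

Lemma eig_sub_neq0 (l : R) : 1 < `|l| -> l - l^-1 != 0.
Proof.
move=> l1; have l0 : l != 0 by rewrite -normr_gt0; lra.
apply: contraTneq l1 => /eqP; rewrite subr_eq0 => /eqP h.
have : l ^+ 2 = 1 by rewrite expr2 {1}h mulVf.
by move/eqP; rewrite sqrf_eq1 -leNgt => /orP[] /eqP ->; rewrite ?normrN normr1.
Qed.

(** The excluded equality is p = 0 in [kap_frame]. For p <> 0 the term l^n p dominates tr (A^n B),
    and the escape quotient tends to 2 l / (l + l^-1), which exceeds 1. *)
Lemma hyp_escape A B : \det A = 1 -> \det B = 1 -> 2 < `|\tr A| ->
  kap A B != \tr A ^+ 2 - 2 -> exists n, escape A (A ^+ n *m B).
Proof.
move=> dA dB tA kne; have [P [l [uP l1 lE PA]]] := hyp_frame dA tA.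
have l0 : l != 0 by rewrite -normr_gt0; lra.
pose B' := P *m B *m invmx P.
have PB : P *m B = mk2 (B' 0 0) (B' 0 1) (B' 1 0) (B' 1 1) *m P.
  have -> : mk2 (B' 0 0) (B' 0 1) (B' 1 0) (B' 1 1) = B' by apply: mx2P; rewrite mk2E.
  by rewrite /B' mulmxKV.
move: (B' 0 0) (B' 0 1) (B' 1 0) (B' 1 1) PB => p q r s PB.
have [_ _ det kE] := kap_frame uP dA dB l0 PA PB.
have p0 : p != 0.
  apply: contraNneq kne => p0; apply/eqP.
  have -> : kap A B = 2 - (q * r) * (l - l^-1) ^+ 2 by lra.
  have -> : q * r = -1 by rewrite p0 in det; lra.
  by rewrite lE; field.
pose Y n := l ^+ n * p + l ^- n * s.
have conj M M' : P *m M = M' *m P -> M = invmx P *m M' *m P.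
  by move=> h; rewrite -mulmxA -h mulKmx.
have trc M M' : P *m M = M' *m P -> \tr M = \tr M'.
  by move=> /conj ->; rewrite -mulmxA mxtrace_mulC mulmxK.
have YE n : \tr (A ^+ n *m B) = Y n.
  rewrite (trc _ (mk2 (l ^+ n) 0 0 (l ^- n) *m mk2 p q r s)).
    by rewrite tr2E !mul2E !mk2E /Y !mul0r addr0 add0r.
  by rewrite mulmxA (hyp_pow_frame n PA) -!mulmxA PB.
have p1 : 0 < `|p| by rewrite normr_gt0.
have [n hn] := expr_unbounded ((`|s| + 3) / `|p|) l1.
exists n; rewrite /escape mulmxA mulmxE -exprS -mulmxE !YE.
set x := l ^+ n in hn *.
have x0 : x != 0 by rewrite expf_neq0.
have xE : `|x| = `|l| ^+ n by rewrite normrX.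
rewrite -xE ltr_pdivrMr // in hn.
have x1 : 1 <= `|x| by rewrite xE exprn_ege1 // ltW.
have i1 : `|x^-1| <= 1 by rewrite normfV invf_le1 // normr_gt0.
have sx : `|x^-1 * s| <= `|s| by rewrite normrM ler_piMl.
have px : `|x * p| = `|x| * `|p| by rewrite normrM.
have Yn : Y n = x * p + x^-1 * s by [].
have YS : Y n.+1 = l * (x * p) + l^-1 * (x^-1 * s).
  by rewrite /Y exprS -/x invfM; ring.
have sgt : `|x^-1 * s| + 3 < `|x * p| by rewrite px; lra.
rewrite YS Yn; move: (x * p) (x^-1 * s) sgt => u v sgt.
clear -lE l0 l1 tA sgt; have uv2 : 2 < `|u + v|.
  have := lerB_normD u v; lra.
split => //.
have uv0 : u + v != 0 by rewrite -normr_gt0; lra.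
have X0 : l + l^-1 != 0 by rewrite -lE -normr_gt0; lra.
have l2 : 1 < l ^+ 2 by rewrite -real_normK ?num_real // expr_gt1 ?normr_ge0.
rewrite lE -subr_ge0.
have -> : 2 * (l * u + l^-1 * v) / ((l + l^-1) * (u + v)) - 1 =
  ((l ^+ 2 - 1) / (l ^+ 2 + 1)) * ((u - v) * (u + v) / (u + v) ^+ 2).
  by field; rewrite uv0 l0 andbT /= gt_eqF // ltr_wpDl ?sqr_ge0.
apply: mulr_ge0; first by rewrite divr_ge0 //; lra.
rewrite divr_ge0 ?sqr_ge0 //.
have -> : (u - v) * (u + v) = u ^+ 2 - v ^+ 2 by ring.
rewrite subr_ge0 -(real_normK (num_real v)) -(real_normK (num_real u)).
rewrite ler_pXn2r ?nnegrE //; lra.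
Qed.

(* [kap A B = tr (A ^+ 2)] means that B maps a fixed point of A to the other one,
   so that A and its conjugate by B share a fixed point. *)
Lemma kap_degenerate A B (C := B *m inv2 A *m inv2 B) :
  \det A = 1 -> \det B = 1 -> 2 < `|\tr A| -> kap A B = \tr A ^+ 2 - 2 ->
  \tr (A *m C *m inv2 A *m inv2 C) = 2 /\
  (A *m C *m inv2 A *m inv2 C = 1%:M -> B *m B = - 1%:M).
Proof.
move=> dA dB tA kE.
have dC : \det C = 1 by rewrite /C !det_mulmx !det_inv2 dA dB !mulr1.
split.
  rewrite fricke // /kap.
  have -> : \tr C = \tr A by rewrite /C mxtrace_mulC mulmxA mulV2 // mul1mx tr_inv2.
  have -> : \tr (A *m C) = \tr A ^+ 2 - 2 by rewrite -kE -fricke // /C !mulmxA.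
  ring.
move=> h1.
have h2 : A *m C = C *m A.
  rewrite -[LHS]mulmx1 -(mulV2 dA) mulmxA -[A *m C *m inv2 A]mulmx1 -(mulV2 dC).
  by rewrite mulmxA h1 mul1mx.
have [P [l [uP l1 lE PA]]] := hyp_frame dA tA.
have l0 : l != 0 by rewrite -normr_gt0; lra.
pose B' := P *m B *m invmx P.
have PB : P *m B = mk2 (B' 0 0) (B' 0 1) (B' 1 0) (B' 1 1) *m P.
  have -> : mk2 (B' 0 0) (B' 0 1) (B' 1 0) (B' 1 1) = B' by apply: mx2P; rewrite mk2E.
  by rewrite /B' mulmxKV.
move: (B' 0 0) (B' 0 1) (B' 1 0) (B' 1 1) PB => p q r s PB.
have [tB _ det kpE] := kap_frame uP dA dB l0 PA PB.
have ll := eig_sub_neq0 l1.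
have ll2 : (l - l^-1) ^+ 2 != 0 by rewrite sqrf_eq0.
have qr : q * r = -1.
  have : \tr A ^+ 2 - 4 = (l - l^-1) ^+ 2 by rewrite lE; field.
  move=> h; apply: (mulIf ll2); lra.
have q0 : q != 0 by apply/eqP => q0; rewrite q0 in qr; lra.
have r0 : r != 0 by apply/eqP => r0; rewrite r0 in qr; lra.
have inv_frame M M' : \det M = 1 -> \det M' = 1 -> P *m M = M' *m P -> P *m inv2 M = inv2 M' *m P.
  move=> dM dM' h; rewrite -[RHS]mulmx1 -(mul2V dM) mulmxA -(mulmxA _ P M) h.
  by rewrite !mulmxA mulV2 // mul1mx.
have PiA := inv_frame _ _ dA _ PA.
have PiB := inv_frame _ _ dB _ PB.
have PC : P *m C = (mk2 p q r s *m inv2 (mk2 l 0 0 l^-1) *m inv2 (mk2 p q r s)) *m P.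
  rewrite /C !mulmxA PB -!mulmxA; congr (_ *m _).
  rewrite !mulmxA PiA; last by rewrite det2E !mk2E mulfV // mul0r subr0.
  by rewrite -!mulmxA PiB // det2E !mk2E.
pose D := mk2 p q r s *m inv2 (mk2 l 0 0 l^-1) *m inv2 (mk2 p q r s).
have [C' C'E] : exists C', C' = D by exists D.
rewrite -/D -C'E in PC.
have h3 : mk2 l 0 0 l^-1 *m C' = C' *m mk2 l 0 0 l^-1.
  have : (mk2 l 0 0 l^-1 *m C') *m P = (C' *m mk2 l 0 0 l^-1) *m P.
    transitivity (P *m (A *m C)); first by rewrite -(mulmxA (mk2 l 0 0 l^-1)) -PC (mulmxA _ P C) -PA -(mulmxA P).
    by rewrite h2 (mulmxA P C) PC -(mulmxA C') PA (mulmxA C').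
  by move/(congr1 (fun M => M *m invmx P)); rewrite !mulmxK.
(* Commuting with a diagonal matrix of distinct eigenvalues makes the conjugate of A^-1 by B
   diagonal; as q r = -1 this leaves p = s = 0, and Cayley-Hamilton gives B^2 = -1. *)
have h01 := congr1 (fun M : 'M[R]_2 => M 0 1) h3.
have h10 := congr1 (fun M : 'M[R]_2 => M 1 0) h3.
rewrite C'E /D !mul2E !mk2E in h01 h10.
have p0 : p = 0.
  have : (p * q) * (l - l^-1) ^+ 2 = 0.
    move: h01; rewrite /= => h; nra.
  by move/eqP; rewrite !mulf_eq0 (negbTE q0) !(negbTE ll) !orbF => /eqP.
have s0 : s = 0.
  have : (r * s) * (l - l^-1) ^+ 2 = 0.
    move: h10; rewrite /= => h; nra.
  by move/eqP; rewrite !mulf_eq0 (negbTE r0) !(negbTE ll) !orbF => /eqP.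
by rewrite cayley tB p0 s0 dB addr0 scale0r sub0r.
Qed.

End HyperbolicPowers.

(** * Lines in the punctured torus *)

Section FreeGroup.
Variable R : realType.
Implicit Types x y : free2.

Definition abl (b : bool) (l : letter) : R :=
  if l.1 == b then (if l.2 then -1 else 1) else 0.

(** The exponent sum of one generator, [false] for a and [true] for b. The pair is the homology
    class, with real values because it serves as a direction in the plane. *)
Definition abn (b : bool) x : R := \sum_(l <- word x) abl b l.

Lemma abl_linv b l : abl b (linv l) = - abl b l.
Proof.
by rewrite /abl /linv /=; case: (l.1 == b); case: l.2; rewrite ?opprK ?oppr0.
Qed.

Lemma abn_push b l w : \sum_(k <- push l w) abl b k = abl b l + \sum_(k <- w) abl b k.
Proof.
case: w => [|k w] /=; first by rewrite big_seq1 big_nil addr0.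
case: eqVneq => [->|_]; rewrite !big_cons // abl_linv; ring.
Qed.

Lemma abnM b x y : abn b (x * y)%g = abn b x + abn b y.
Proof.
rewrite /abn /= /wmul; elim: (word x) => [|l w IH] /=; first by rewrite big_nil add0r.
by rewrite abn_push IH big_cons addrA.
Qed.

Lemma abn1 b : abn b 1%g = 0.
Proof. by rewrite /abn big_nil. Qed.

Lemma abnV b x : abn b (x^-1)%g = - abn b x.
Proof. by apply/eqP; rewrite -addr_eq0 -abnM mulVg abn1. Qed.

Lemma abnX b x n : abn b (x ^+ n)%g = n%:R * abn b x.
Proof.
elim: n => [|n IH]; first by rewrite expg0 abn1 mul0r.
by rewrite expgS abnM IH -natr1; ring.
Qed.

Lemma abn_a : (abn false gen_a = 1) * (abn true gen_a = 0).
Proof. by rewrite /abn !big_seq1. Qed.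

Lemma abn_b : (abn false gen_b = 0) * (abn true gen_b = 1).
Proof. by rewrite /abn !big_seq1. Qed.

Lemma comm_ab_neq1 : (gen_a * gen_b * gen_a^-1 * gen_b^-1)%g <> 1%g.
Proof. by move=> /(congr1 word). Qed.

(** If x is its own inverse, its reduced word is invariant under reversal and inversion of the
    letters: the middle letter of an odd word would be its own inverse, and the two middle letters
    of an even word would cancel. *)
Lemma free2_sq x : (x * x)%g = 1%g -> x = 1%g.
Proof.
move=> xx; have xV : x = (x^-1)%g by rewrite -[LHS]mulg1 -(mulgV x) mulgA xx mul1g.
apply/val_inj => /=; have wE : word x = rev (map linv (word x)) := congr1 word xV.
have := word_reduced x; move: (word x) wE => w wE rw {xV}.
have lne (l : letter) : l != linv l by case: l => g s; rewrite /linv xpair_eqE /=; case: s; rewrite andbF.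
have [/eqP|w0] := posnP (size w); first by rewrite size_eq0 => /eqP.
have nthE i : (i < size w)%N -> nth (false, false) w i = linv (nth (false, false) w (size w - i.+1)).
  move=> hi; rewrite {1}wE nth_rev size_map // (nth_map (false, false)) //.
  by rewrite subnS prednK ?leq_subr // subn_gt0.
have [od|ev] := boolP (odd (size w)).
  have h : ((size w)./2 < size w)%N by rewrite -{2}(odd_double_half (size w)) od; lia.
  have := nthE _ h.
  have -> : (size w - (size w)./2.+1 = (size w)./2)%N.
    by rewrite -{1}(odd_double_half (size w)) od; lia.
  by move/eqP; rewrite (negbTE (lne _)).
have sE : size w = (size w)./2.*2 by rewrite -{1}(odd_double_half (size w)) (negbTE ev).
have k0 : (0 < (size w)./2)%N by rewrite half_gt0; move: sE; case: (size w) w0 => // -[].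
have h : ((size w)./2 < size w)%N by rewrite {2}sE; lia.
have := nthE _ h.
have -> : (size w - (size w)./2.+1 = (size w)./2.-1)%N by rewrite {1}sE; lia.
move: rw; rewrite /reduced => /(sortedP (false, false)) /(_ (size w)./2.-1).
by rewrite prednK // => /(_ h) /eqP hne E; case: hne.
Qed.

Lemma zexpg0 x : zexpg x 0 = 1%g. Proof. by []. Qed.
Lemma zexpg1 x : zexpg x 1 = x. Proof. by rewrite /= expg1. Qed.
Lemma zexpgN1 x : zexpg x (-1) = (x^-1)%g. Proof. by rewrite /= expg1. Qed.

End FreeGroup.

Section Frac.
Variable R : realType.
Implicit Types s d : R.

Lemma floor_int_eq s (k : int) : k%:~R <= s < k%:~R + 1 -> Num.floor s = k.
Proof. by move=> h; apply: floor_def; rewrite intrD. Qed.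

Lemma frac_itv s : 0 <= frac s < 1.
Proof.
rewrite /frac; have := floor_itv s; rewrite intrD => /andP[h1 h2].
by apply/andP; split; lra.
Qed.

Lemma floor_shift s d : Num.floor (s + d) = Num.floor s + Num.floor (frac s + d).
Proof.
apply: floor_int_eq; rewrite intrD.
have := floor_itv (frac s + d); rewrite intrD /frac => /andP[h1 h2].
by apply/andP; split; lra.
Qed.

Lemma frac_shift s d : frac (s + d) = frac (frac s + d).
Proof. by rewrite {1 2}/frac floor_shift intrD /frac; ring. Qed.

Lemma frac_int s (k : int) : frac (s + k%:~R) = frac s.
Proof.
rewrite /frac (_ : Num.floor (s + k%:~R) = Num.floor s + k) ?intrD; first ring.
apply: floor_int_eq; rewrite intrD; have := floor_itv s; rewrite intrD => /andP[h1 h2].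
by apply/andP; split; lra.
Qed.

Lemma floor_small s : -1 <= s < 1 -> Num.floor s = (if 0 <= s then 0 else -1) /\
  frac s = (if 0 <= s then s else s + 1).
Proof.
move=> /andP[h1 h2]; rewrite /frac.
case: leP => h0.
  by rewrite (_ : Num.floor s = 0) ?subr0 //; apply: floor_int_eq; apply/andP; split; lra.
rewrite (_ : Num.floor s = -1) ?opprK //.
by apply: floor_int_eq; rewrite rmorphN; apply/andP; split; lra.
Qed.

Lemma frac_id s : 0 <= s < 1 -> frac s = s.
Proof. by move=> /andP[h1 h2]; rewrite (floor_small _).2 ?h1 // h2 andbT; lra. Qed.

Lemma cellP (y : R * R) : cell y <->
  [/\ 0 <= y.1 < 1, 0 <= y.2 < 1 & y <> (0, 0)].
Proof.
rewrite /cell /= !in_itv /=; split; first by move=> [[]].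
by move=> [].
Qed.

Lemma cell_frac s d : cell (frac s, frac d) <-> (frac s, frac d) <> (0, 0) :> R * R.
Proof. by rewrite cellP /=; split=> [[]|h] //; split=> //; exact: frac_itv. Qed.

End Frac.

Section RealInduction.
Variable R : realType.

(** Truth propagates only forwards: from a point to those just after it, and to a point from those
    just before it. The supremum of the initial intervals on which P holds then reaches t. *)
Lemma real_ind (t : R) (P : R -> Prop) : P 0 ->
  (forall s, 0 <= s <= t -> exists2 e : R, 0 < e & forall s', `|s' - s| < e ->
     0 <= s' <= t -> (s <= s' -> P s -> P s') /\ (s' <= s -> P s' -> P s)) ->
  forall s, 0 <= s <= t -> P s.
Proof.
move=> P0 H s /andP[s0 st].
pose E := [set r : R | 0 <= r <= t /\ forall q, 0 <= q <= r -> P q].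
have t0 : 0 <= t by lra.
have E0 : E 0.
  by split; [rewrite lexx t0|move=> q /andP[q0 q1]; rewrite (_ : q = 0) //; lra].
have hE : has_sup E by split; [exists 0|exists t => r [/andP[]]].
pose sg := sup E.
have sg0 : 0 <= sg by apply: ub_le_sup => //; case: hE.
have sgt : sg <= t by apply: ge_sup; [exists 0|move=> r [/andP[]]].
have [e e0 He] := H sg ltac:(by rewrite sg0 sgt).
have below q : 0 <= q < sg -> P q.
  move=> /andP[q0 qs]; have [r [r1 r2] qr] := sup_adherent (eps := sg - q) ltac:(lra) hE; rewrite -/sg in qr.
  by apply: r2; rewrite q0 /=; lra.
have Psg : P sg.
  have [r [r1 r2] qr] := sup_adherent e0 hE; rewrite -/sg in qr.
  have rs : r <= sg by apply: ub_le_sup; [case: hE|split].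
  have r0 := andP r1.
  have [|_ h] := He r _ r1; first by rewrite ltr_norml; apply/andP; split; lra.
  by apply: h => //; apply: r2; lra.
have up q : sg <= q < sg + e -> q <= t -> P q.
  move=> /andP[q0 q1] qt; have [||h _] := He q; first by rewrite ltr_norml; apply/andP; split; lra.
    by apply/andP; split; lra.
  exact: h.
pose m := Num.min t (sg + e / 2).
have Em : E m.
  have m1 : m <= t by rewrite ge_min lexx.
  have m2 : m <= sg + e / 2 by rewrite ge_min lexx orbT.
  have m3 : 0 <= m by rewrite le_min t0 /=; lra.
  split; first by rewrite m3 m1.
  move=> q /andP[q0 qm]; have [qs|qs] := ltP q sg; first by apply: below; rewrite q0.
  by apply: up; [rewrite qs /=; lra|lra].
have : m <= sg by apply: ub_le_sup => //; case: hE.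
rewrite ge_min => /orP[ts|]; last by move=> h; exfalso; lra.
have [ss|ss] := ltP s sg; first by apply: below; rewrite s0.
by apply: up => //; rewrite ss /=; lra.
Qed.

End RealInduction.

(** * Words read along an orbit *)

Section Orbits.
Variable R : realType.
Implicit Types (al be g : free2) (y : cover R) (u v t s : R).

(* [translate] for an arbitrary pair of side pairings. *)
Definition trl al be y (d : R * R) : cover R :=
  ((y.1 * zexpg al (Num.floor (y.2.1 + d.1)) * zexpg be (Num.floor (y.2.2 + d.2)))%g,
   (frac (y.2.1 + d.1), frac (y.2.2 + d.2))).

(** For the pair [gen_a], [gen_b] this is [lifted_orbit] without its initial condition; other pairs
    follow the orbit through other parallelograms. *)
Definition orb al be u v t (c : R -> cover R) : Prop :=
  forall s, 0 <= s <= t -> cell (c s).2 /\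
    (\forall s' \near s, 0 <= s' <= t ->
       c s' = trl al be (c s) ((s' - s) * u, (s' - s) * v)).

(** A displacement shorter than e crosses neither the right nor the top side, and at most one of the
    left and bottom sides, from a point lying on it. Such a margin exists because the corner is
    removed. *)
Definition room (x : R * R) (e : R) : Prop :=
  [/\ 0 < e, e <= 1 / 4, x.1 + e <= 1 /\ x.2 + e <= 1,
      x.1 = 0 \/ e <= x.1 & (x.2 = 0 \/ e <= x.2) /\ (e <= x.1 \/ e <= x.2)].

Lemma roomP (x : R * R) : cell x -> exists e, room x e.
Proof.
move=> /cellP[/andP[x0 x1] /andP[y0 y1] xy].
case: x x0 x1 y0 y1 xy => x y /= x0 x1 y0 y1 xy.
pose m := Num.min (1 / 4) (Num.min (1 - x) (1 - y)).
have m0 : 0 < m by rewrite !lt_min; apply/and3P; split; lra.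
have [m1 m2 m3] : [/\ m <= 1 / 4, m <= 1 - x & m <= 1 - y].
  by split; rewrite /m !ge_min lexx ?orbT.
have [x00|x00] := eqVneq x 0; have [y00|y00] := eqVneq y 0.
- by rewrite x00 y00 in xy.
- have y0' : 0 < y by rewrite lt_neqAle eq_sym y00.
  have n1 : Num.min m y <= m by rewrite ge_min lexx.
  have n2 : Num.min m y <= y by rewrite ge_min lexx orbT.
  exists (Num.min m y); split => /=; rewrite ?lt_min ?m0 ?y0' //; try (split; lra); try lra; try (by left); try (by right);
    by split; first [by left|by right].
- have x0' : 0 < x by rewrite lt_neqAle eq_sym x00.
  have n1 : Num.min m x <= m by rewrite ge_min lexx.
  have n2 : Num.min m x <= x by rewrite ge_min lexx orbT.
  exists (Num.min m x); split => /=; rewrite ?lt_min ?m0 ?x0' //; try (split; lra); try lra; try (by left); try (by right);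
    by split; first [by left|by right].
have y0' : 0 < y by rewrite lt_neqAle eq_sym y00.
have x0' : 0 < x by rewrite lt_neqAle eq_sym x00.
pose n := Num.min m (Num.min x y).
have n1 : n <= m by rewrite /n ge_min lexx.
have nE : n <= Num.min x y by rewrite /n ge_min lexx orbT.
have n2 : n <= x by apply: (le_trans nE); rewrite ge_min lexx.
have n3 : n <= y by apply: (le_trans nE); rewrite ge_min lexx orbT.
have n0 : 0 < n by rewrite /n lt_min m0 lt_min x0' y0'.
exists n; split => //=;
  try (split; lra); try lra; try (by left); try (by right);
    by split; first [by left|by right].
Qed.

Lemma trl_small al be y d e : room y.2 e -> `|d.1| < e -> `|d.2| < e ->
  trl al be y d =
  ((y.1 * (if 0 <= y.2.1 + d.1 then 1 else al^-1) * (if 0 <= y.2.2 + d.2 then 1 else be^-1))%g,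
   (if 0 <= y.2.1 + d.1 then y.2.1 + d.1 else y.2.1 + d.1 + 1,
    if 0 <= y.2.2 + d.2 then y.2.2 + d.2 else y.2.2 + d.2 + 1)).
Proof.
case: y => g [x y]; rewrite /room /= => -[e0 e4 [h1 h2] h3 [h4 _]]; case: d => a b /=.
rewrite !ltr_norml => /andP[a1 a2] /andP[b1 b2]; rewrite /trl /=.
have x0 : 0 <= x by case: h3 => h; lra.
have y0 : 0 <= y by case: h4 => h; lra.
have [|fx gx] := floor_small (s := x + a); first by apply/andP; split; lra.
have [|fy gy] := floor_small (s := y + b); first by apply/andP; split; lra.
rewrite fx gx fy gy; case: leP => _; case: leP => _; by rewrite ?zexpgN1 ?zexpg0.
Qed.

(** Within the room at most one coordinate can leave the cell, so the two group factors never have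
    to commute and translations compose as in the plane. *)
Lemma trl_comp al be y d d' e : room y.2 e -> `|d.1| < e -> `|d.2| < e ->
  `|d.1 + d'.1| < e -> `|d.2 + d'.2| < e ->
  trl al be (trl al be y d) d' = trl al be y (d.1 + d'.1, d.2 + d'.2).
Proof.
case: y => g [x y]; rewrite /room /= => -[e0 e4 [h1 h2] h3 [h4 h5]]; case: d => a b; case: d' => a' b' /=.
rewrite !ltr_norml => /andP[a1 a2] /andP[b1 b2] /andP[c1 c2] /andP[d1 d2]; rewrite /trl /=.
rewrite !addrA [frac (x + a + a')]frac_shift [frac (y + b + b')]frac_shift; congr pair.
have x0 : 0 <= x by case: h3 => h; lra.
have y0 : 0 <= y by case: h4 => h; lra.
have := floor_shift (x + a) a'; have := floor_shift (y + b) b'.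
have [|fx _] := floor_small (s := x + a); first by apply/andP; split; lra.
have [|fy _] := floor_small (s := y + b); first by apply/andP; split; lra.
have [|fx' _] := floor_small (s := x + a + a'); first by apply/andP; split; lra.
have [|fy' _] := floor_small (s := y + b + b'); first by apply/andP; split; lra.
move: (Num.floor (frac (x + a) + a')) (Num.floor (frac (y + b) + b')) => m n.
have add (z : free2) (i j k : int) : (i = 0 \/ i = -1) -> (k = 0 \/ k = -1) -> k = i + j ->
  (zexpg z i * zexpg z j)%g = zexpg z k.
  move=> i0 k0 kE; have -> : j = k - i by rewrite kE addrC addKr.
  case: i0 => ->; case: k0 => ->; rewrite ?subr0 ?sub0r ?opprK ?addNr ?zexpg0 ?zexpgN1 ?zexpg1 ?mulg1 ?mul1g ?mulVg //.
have if01 (b0 : bool) : (if b0 then 0 else -1) = 0 :> int \/ (if b0 then 0 else -1) = -1 :> int by case: b0; [left|right].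
rewrite fx fy fx' fy'.
case: h5 => h5 hn hm.
  have e1 : 0 <= x + a by lra.
  have e2 : 0 <= x + a + a' by lra.
  rewrite e1 e2 add0r in hm *; rewrite -hm !zexpg0 !mulg1 -mulgA.
  by rewrite (add _ _ _ _ (if01 _) (if01 _) hn).
have e1 : 0 <= y + b by lra.
have e2 : 0 <= y + b + b' by lra.
rewrite e1 e2 add0r in hn *; rewrite -hn !zexpg0 !mulg1 -mulgA.
by rewrite (add _ _ _ _ (if01 _) (if01 _) hm).
Qed.

Definition evw al be (w : seq bool) : free2 :=
  foldr (fun (b : bool) g => ((if b then be else al) * g)%g) 1%g w.

Lemma evw_cat al be w1 w2 : evw al be (w1 ++ w2) = (evw al be w1 * evw al be w2)%g.
Proof. by elim: w1 => [|b w IH] /=; rewrite ?mul1g // IH mulgA. Qed.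

Lemma near_step (s u v e : R) : 0 < e ->
  exists2 r : R, 0 < r & forall s', `|s' - s| < r -> `|(s' - s) * u| < e /\ `|(s' - s) * v| < e.
Proof.
move=> e0; pose K := 1 + `|u| + `|v|.
have K0 : 0 < K by rewrite /K -addrA ltr_pwDl ?addr_ge0.
exists (e / K); first by rewrite divr_gt0.
have key x : x = u \/ x = v -> `|x| <= K.
  have := (normr_ge0 u, normr_ge0 v); rewrite /K => -[u0 v0] [] ->; lra.
move=> s'; rewrite ltr_pdivlMr // => h.
split; rewrite normrM; apply: le_lt_trans h; rewrite ler_wpM2l ?key //; [by left|by right].
Qed.

Lemma nearP_dist (s : R) (P : R -> Prop) : (\forall s' \near s, P s') <->
  exists2 r : R, 0 < r & forall s', `|s' - s| < r -> P s'.
Proof.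
split.
  move=> /nbhs_ballP[r /= r0 H]; exists r => // s' hs; apply: H.
  by rewrite -ball_normE /= distrC.
move=> [r r0 H]; apply/nbhs_ballP; exists r => //= s'.
by rewrite -ball_normE /= distrC => /H.
Qed.

End Orbits.

Section OrbitWords.
Variable R : realType.
Implicit Types (al be g : free2) (u v t s : R).

Lemma floor_back (z z' dd k : R) (n : nat) (b : bool) : z' = z + dd -> n%:Z = Num.floor z' ->
  (if b then k + dd else k + dd + 1) = frac z' -> 0 <= k < 1 ->
  (n + ~~ b)%:Z = Num.floor z /\ k = frac z.
Proof.
move=> zE nE fE k01.
have flE : Num.floor z = (n + ~~ b)%N.
  apply: floor_int_eq; move: fE; rewrite /frac -nE.
  have -> : ((n + ~~ b)%:Z)%:~R = n%:R + (~~ b)%:R :> R by rewrite -natrD.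
  have -> : (n%:Z)%:~R = n%:R :> R by [].
  by case: b => /= fE; apply/andP; split; lra.
split => //; move: fE; rewrite /frac -nE flE.
have -> : ((n + ~~ b)%:Z)%:~R = n%:R + (~~ b)%:R :> R by rewrite -natrD.
have -> : (n%:Z)%:~R = n%:R :> R by [].
by case: b {flE} => /= fE; lra.
Qed.

(** The letters of each kind count the sides crossed by the unfolded straight line, hence the
    floors. *)
Lemma orb_word al be u v t c : 0 <= u -> 0 <= v -> 0 <= t -> orb al be u v t c ->
  forall s, 0 <= s <= t -> exists w,
  [/\ (c s).1 = ((c 0).1 * evw al be w)%g,
      (count negb w)%:Z = Num.floor ((c 0).2.1 + s * u),
      (count id w)%:Z = Num.floor ((c 0).2.2 + s * v) &
      (c s).2 = (frac ((c 0).2.1 + s * u), frac ((c 0).2.2 + s * v))].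
Proof.
move=> u0 v0 t0 H.
have [|/cellP[x01 y01 _] _] := H 0; first by rewrite lexx t0.
set x := (c 0).2.1 in x01 *; set y := (c 0).2.2 in y01 *.
have fl0 (z : R) : 0 <= z < 1 -> Num.floor z = 0 :> int.
  by move=> h; apply: floor_int_eq; rewrite mulr0z add0r.
apply: real_ind.
  exists [::]; rewrite /= mulg1 !mul0r !addr0 !fl0 // !frac_id //; split => //.
  by rewrite /x /y; case: (c 0).2.
move=> s st; have [cs /nearP_dist[r1 r10 Hr1]] := H s st.
have [e re] := roomP cs; have [e0 e4 [h1 h2] h3 [h4 _]] := re.
have [r2 r20 Hr2] := near_step s u v e0.
exists (Num.min r1 r2); first by rewrite lt_min r10.
move=> s'; rewrite lt_min => /andP[hr1 hr2] st'.
have cE := Hr1 _ hr1 st'; have [d1 d2] := Hr2 _ hr2.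
set d := (_, _) in cE.
have cS := trl_small al be re (d := d) d1 d2; rewrite -cE in cS.
have [/andP[x0 x1] /andP[y0 y1] _] := (cellP _).1 cs.
split=> ss [w [w1 w2 w3 w4]].
  (* Just after time s the room on the right and above rules out a crossing: the word is
     unchanged. *)
  have du : 0 <= d.1 by rewrite mulr_ge0 // subr_ge0.
  have dv : 0 <= d.2 by rewrite mulr_ge0 // subr_ge0.
  have i1 : 0 <= (c s).2.1 + d.1 by rewrite addr_ge0.
  have i2 : 0 <= (c s).2.2 + d.2 by rewrite addr_ge0.
  rewrite i1 i2 !mulg1 w4 /= in cS; rewrite w4 /= in i1 i2.
  rewrite w4 /= in h1 h2.
  have hx : x + s' * u = x + s * u + d.1 by rewrite /d /=; ring.
  have hy : y + s' * v = y + s * v + d.2 by rewrite /d /=; ring.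
  rewrite ltr_norml in d1; rewrite ltr_norml in d2.
  have j1 : 0 <= frac (x + s * u) + d.1 < 1 by rewrite i1 /=; case/andP: d1 => _ d1; apply: lt_le_trans h1; rewrite ltrD2l.
  have j2 : 0 <= frac (y + s * v) + d.2 < 1 by rewrite i2 /=; case/andP: d2 => _ d2; apply: lt_le_trans h2; rewrite ltrD2l.
  exists w; rewrite cS hx hy (floor_shift (x + s * u)) (floor_shift (y + s * v)).
  rewrite -w2 -w3 (fl0 _ j1) (fl0 _ j2) !addr0; split => //=.
  by rewrite (frac_shift (x + s * u)) (frac_shift (y + s * v));
    move: (frac_id j1) (frac_id j2) => /= -> ->.
(* Arriving at time s: a coordinate of the earlier point is wrapped exactly when a side is crossed
   on arrival, and the letter of that side is appended. *)
rewrite cS in w1 w4.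
set b1 := 0 <= _ in w1 w4; set b2 := 0 <= (c s).2.2 + _ in w1 w4.
exists (w ++ (if b2 then [::] else [:: true]) ++ (if b1 then [::] else [:: false])).
have [a1 a2] : x + s' * u = x + s * u + d.1 /\ y + s' * v = y + s * v + d.2.
  by rewrite /d /=; split; ring.
case: w4 => w41 w42.
have [|p1 p2] := floor_back a1 w2 w41; first by rewrite x0 x1.
have [|q1 q2] := floor_back a2 w3 w42; first by rewrite y0 y1.
split.
- rewrite !evw_cat mulgA -w1 /=; case: (b1); case: (b2); rewrite /= ?mulg1 ?mul1g //.
  + by rewrite mulgVK.
  + by rewrite mulgVK.
  + by rewrite mulgA mulgVK mulgVK.
- by rewrite !count_cat -p1; congr Posz; congr (_ + _)%N; case: (b1); case: (b2).
- by rewrite !count_cat -q1; congr Posz; congr (_ + _)%N; case: (b1); case: (b2).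
- by rewrite -p2 -q2; case: (c s).2.
Qed.

End OrbitWords.

(** * Changes of fundamental parallelogram *)

Section Relabel.
Variable R : realType.
Implicit Types (al be g h : free2) (u v t s : R) (y : cover R).

(* A change of fundamental parallelogram: [Phi] renames the points of the cover,
   moving each of them by one of finitely many deck transformations [hs], so that
   the side pairings become [al'], [be'] and translations are read through [f]. *)
Definition relabel al be al' be' (f : R * R -> R * R) (hs : seq free2)
    (Phi : cover R -> cover R) : Prop :=
  [/\ forall y, cell y.2 -> cell (Phi y).2,
      forall y, exists2 h, h \in hs & (Phi y).1 = (y.1 * h)%g &
      forall y, cell y.2 -> exists2 e : R, 0 < e & forall d, `|d.1| < e -> `|d.2| < e ->
        Phi (trl al be y d) = trl al' be' (Phi y) (f d)].

Lemma relabel_orb al be al' be' f hs Phi u v u' v' t c :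
  relabel al be al' be' f hs Phi -> (forall k, f (k * u, k * v) = (k * u', k * v')) ->
  orb al be u v t c -> orb al' be' u' v' t (Phi \o c).
Proof.
move=> [r1 _ r3] fE H s st; have [cs /nearP_dist[r r0 Hr]] := H s st.
split; first exact: r1.
have [e e0 He] := r3 _ cs; have [r' r0' Hr'] := near_step s u v e0.
apply/nearP_dist; exists (Num.min r r'); first by rewrite lt_min r0.
move=> s'; rewrite lt_min => /andP[h1 h2] st' /=.
have [d1 d2] := Hr' _ h2.
by rewrite Hr // He //= fE.
Qed.

Definition wrap (z : R) : R := if 0 <= z then z else z + 1.

Lemma wrapE z : wrap z = z + (~~ (0 <= z))%:R.
Proof. by rewrite /wrap; case: (0 <= z); rewrite ?addr0. Qed.

Lemma wrap_itv z : -1 <= z < 1 -> 0 <= wrap z < 1.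
Proof. by move=> /andP[h1 h2]; rewrite /wrap; case: (leP 0 z) => h; apply/andP; split; lra. Qed.

Definition opt (b : bool) g : free2 := if b then 1%g else (g^-1)%g.

Lemma trl_wrap al be g (x y a b e : R) : room (x, y) e -> `|a| < e -> `|b| < e ->
  trl al be (g, (x, y)) (a, b) =
  ((g * opt (0 <= x + a) al * opt (0 <= y + b) be)%g, (wrap (x + a), wrap (y + b))).
Proof. by move=> re ha hb; rewrite (trl_small (y := (g, (x, y))) (d := (a, b)) al be re). Qed.

Lemma room_itv (x y a b e : R) : room (x, y) e -> `|a| < e -> `|b| < e ->
  [/\ -1 <= x + a < 1, -1 <= y + b < 1 & (0 <= x + a) || (0 <= y + b)].
Proof.
rewrite /room /= => -[e0 e4 [h1 h2] h3 [h4 h5]].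
rewrite !ltr_norml => /andP[a1 a2] /andP[b1 b2].
split; first by case: h3 => h3; apply/andP; split; lra.
  by case: h4 => h4; apply/andP; split; lra.
by apply/orP; case: h5 => h5; [left|right]; lra.
Qed.

Lemma unit_itv_eq (z1 z2 : R) (m n : nat) : 0 <= z1 < 1 -> 0 <= z2 < 1 ->
  z1 - z2 = m%:R - n%:R -> m = n.
Proof.
move=> /andP[a1 a2] /andP[b1 b2] h.
have h1 : (m < n.+1)%N by rewrite -(ltr_nat R) -natr1; lra.
have h2 : (n < m.+1)%N by rewrite -(ltr_nat R) -natr1; lra.
by apply/eqP; rewrite eqn_leq -ltnS h1 -ltnS h2.
Qed.

(** As u e + v f = (u - v) e + v (e + f), the parallelogram (e, f) is sheared to (e, e + f). The
    points with x < y fall in the copy to the left, labelled by the inverse of [al]. *)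
Definition phiL al y : cover R :=
  ((y.1 * opt (0 <= y.2.1 - y.2.2) al)%g, (wrap (y.2.1 - y.2.2), y.2.2)).

Lemma phiL_cell al y : cell y.2 -> cell (phiL al y).2.
Proof.
case: y => g [x y] /cellP[/= /andP[x0 x1] /andP[y0 y1] xy]; apply/cellP.
split => /=; rewrite ?y0 ?y1 //.
  by apply: wrap_itv; apply/andP; split; lra.
move=> [h1 h2]; apply: xy; move: h1; rewrite h2 subr0 /wrap x0 => ->.
by [].
Qed.

Lemma relabelL al be : relabel al be al (al * be)%g (fun d => (d.1 - d.2, d.2))
  [:: 1%g; (al^-1)%g] (phiL al).
Proof.
split; first exact: phiL_cell.
  move=> y; exists (opt (0 <= y.2.1 - y.2.2) al)%g => //.
  by rewrite /opt; case: (0 <= _); rewrite !inE eqxx ?orbT.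
case=> g [x y] cy; have [e re] := roomP cy; have [e' re'] := roomP (phiL_cell al cy).
exists (Num.min e e' / 2).
  by case: re re' => e0 _ _ _ _ [e0' _ _ _ _]; rewrite divr_gt0 // lt_min e0.
case=> a b /= ha hb; rewrite /= in re re'.
have [e1 e2 e3 e5] : [/\ `|a| < e, `|b| < e, `|a - b| < e' & `|b| < e'].
  have m1 : Num.min e e' <= e by rewrite ge_min lexx.
  have m2 : Num.min e e' <= e' by rewrite ge_min lexx orbT.
  move: (Num.min e e') m1 m2 ha hb => m m1 m2; rewrite !ltr_norml => /andP[a1 a2] /andP[b1 b2].
  by split; apply/andP; split; lra.
rewrite (trl_wrap al be g re e1 e2) (trl_wrap al (al * be)%g _ re' e3 e5) /phiL /=.
have [i1 i2 iab] := room_itv re e1 e2; have [i3 _ icd] := room_itv re' e3 e5.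
have j1 := wrap_itv i1; have j2 := wrap_itv i2; have j3 := wrap_itv i3.
have j4 : 0 <= wrap (wrap (x + a) - wrap (y + b)) < 1.
  by apply: wrap_itv; case/andP: j1 => ? ?; case/andP: j2 => ? ?; apply/andP; split; lra.
have := wrapE (wrap (x + a) - wrap (y + b)); have := wrapE (wrap (x - y) + (a - b)).
set z1 := wrap (wrap (x + a) - _) in j4 *; set z2 := wrap (wrap (x - y) + _) in j3 *.
have := wrapE (x + a); have := wrapE (y + b); have := wrapE (x - y).
set A := 0 <= x + a in iab *; set B := 0 <= y + b in iab *; set E := 0 <= x - y.
set C := 0 <= wrap (x + a) - _; set D := 0 <= wrap (x - y) + _.
move=> wE wB wA z2E z1E.
(* Both routes end in [0, 1) and differ by an integer, so they coincide and the numbers of wraps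
   balance; the group components then agree in each case left by [iab]. *)
have zE : z1 - z2 = (~~ A + ~~ C)%:R - (~~ B + ~~ E + ~~ D)%:R.
  by rewrite z1E z2E wA wB wE !natrD; ring.
have cnt := unit_itv_eq j4 j3 zE.
have -> : z1 = z2 by apply/eqP; rewrite -subr_eq0 zE cnt subrr.
congr pair; move: cnt iab; rewrite /opt.
by case: (A); case: (B) => //; case: (C); case: (D); case: (E) => //= _ _;
  rewrite ?mulg1 ?mul1g ?invgM ?mulgA.
Qed.

(** The reflection x -> 1 - x. It sends the left side to the right side, which belongs to the next
    copy, now labelled by the inverse of [al]. *)
Definition phiF al y : cover R :=
  ((y.1 * opt (y.2.1 != 0) al)%g, (if y.2.1 == 0 then 0 else 1 - y.2.1, y.2.2)).

Lemma phiF_cell al y : cell y.2 -> cell (phiF al y).2.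
Proof.
case: y => g [x y] /cellP[/= /andP[x0 x1] /andP[y0 y1] xy]; apply/cellP.
split => /=; rewrite ?y0 ?y1 //.
  by case: eqVneq => [_|xn]; [rewrite lexx ltr01|rewrite subr_ge0 ltW //= ltrBlDl ltrDr lt_neqAle eq_sym xn].
move=> [h1 h2]; apply: xy; move: h1; rewrite h2; case: eqVneq => [-> //|xn] h.
by exfalso; lra.
Qed.

Lemma relabelF al be : relabel al be (al^-1)%g be (fun d => (- d.1, d.2))
  [:: 1%g; (al^-1)%g] (phiF al).
Proof.
split; first exact: phiF_cell.
  move=> y; exists (opt (y.2.1 != 0) al)%g => //.
  by rewrite /opt; case: (_ != 0); rewrite !inE eqxx ?orbT.
case=> g [x y] cy; have [e re] := roomP cy; have [e' re'] := roomP (phiF_cell al cy).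
exists (Num.min e e').
  by case: re re' => e0 _ _ _ _ [e0' _ _ _ _]; rewrite lt_min e0.
case=> a b /=; rewrite !lt_min => /andP[a1 a2] /andP[b1 b2]; rewrite /= in re re'.
have a3 : `|- a| < e' by rewrite normrN.
rewrite (trl_wrap al be g re a1 b1) (trl_wrap (al^-1)%g be _ re' a3 b2) /phiF /=.
have [i1 i2 iab] := room_itv re a1 b1; have [i3 _ icd] := room_itv re' a3 b2.
move: re; rewrite /room /= => -[e0 e4 [h1 h2] h3 [h4 h5]].
move: a1 b1; rewrite !ltr_norml => /andP[a1 a1'] /andP[b1 b1'].
rewrite /= in re'; move: i3 {a2 a3 b2 re' icd cy i2}.
have [x0|x0] := eqVneq x 0.
  rewrite {}x0 in iab i1 h1 h3 h5 *; rewrite !add0r => i3; rewrite /opt /wrap.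
  have h6 : y != 0 by apply/eqP => y0; case: h5 => h5; lra.
  have h7 : 0 <= y + b by case: h5 => h5; lra.
  rewrite h7; case: (ltgtP a 0) => ha.
  - have -> : (0 <= - a) by lra.
    rewrite !mulg1 gt_eqF; last lra.
    by rewrite mulg1; congr (_, (_, _)); ring.
  - have -> : (0 <= - a) = false by lra.
    by rewrite !mulg1 ?gt_eqF // !mulg1 invgK mulgVK; congr (_, (_, _)); ring.
  - by rewrite ?ha oppr0 lexx ?eqxx !mulg1 ?eqxx.
have e1 : e <= x by case: h3 => // /eqP; rewrite (negbTE x0).
move=> i3; rewrite /opt /wrap /=.
have -> : 0 <= x + a by lra.
have -> : 0 <= 1 - x - a by lra.
rewrite gt_eqF; last lra.
by rewrite !mulg1; congr (_, (_, _)); ring.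
Qed.

Definition phiS (y : cover R) : cover R := (y.1, (y.2.2, y.2.1)).

Lemma relabelS al be : relabel al be be al (fun d => (d.2, d.1)) [:: 1%g] phiS.
Proof.
split.
- move=> [g [x y]] /cellP[/= h1 h2 h3]; apply/cellP; split => //= -[x0 y0].
  by apply: h3; rewrite x0 y0.
- by move=> y; exists 1%g; rewrite ?inE //= mulg1.
case=> g [x y] cy; have [e re] := roomP cy; rewrite /= in re.
exists e; first by case: re.
case=> a b /= ha hb.
have re' : room (y, x) e.
  by case: re => e0 e4 [/= h1 h2] h3 [h4 h5]; split => //=; split => //; case: h5; [right|left].
rewrite (trl_wrap al be g re ha hb) (trl_wrap be al g re' hb ha) /phiS /=.
have [_ _ iab] := room_itv re ha hb; congr pair; move: iab; rewrite /opt.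
by case: (0 <= x + a); case: (0 <= y + b) => //= _; rewrite ?mulg1.
Qed.

End Relabel.

(** * Bases obtained by Nielsen moves, and existence of orbits *)

Section Reach.
Variable R : realType.
Implicit Types (al be g h : free2) (u v t s : R).

(** Bases obtained from (a, b) by elementary Nielsen moves, one for each relabelling of the cover
    constructed above. *)
Inductive reach : free2 -> free2 -> Prop :=
| reach_root : reach gen_a gen_b
| reachL al be : reach al be -> reach al (al * be)%g
| reachF al be : reach al be -> reach (al^-1)%g be
| reachS al be : reach al be -> reach be al.

Lemma reachR al be : reach al be -> reach (al * be)%g be.
Proof.
move=> h; have h1 : reach (be^-1)%g (al^-1)%g by exact/reachF/reachS/reachF.
have h2 : reach (be^-1)%g (al * be)^-1%g by rewrite invgM; exact: reachL.
have h3 : reach be (al * be)^-1%g by rewrite -[X in reach X _]invgK; exact: reachF.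
by rewrite -[X in reach X _]invgK; exact/reachF/reachS.
Qed.

Lemma reach_cross al be : reach al be ->
  (abn R false al * abn R true be - abn R true al * abn R false be) ^+ 2 = 1.
Proof.
elim=> {al be} [|al be _ <-|al be _ <-|al be _ <-].
- by rewrite !abn_a !abn_b; ring.
- by rewrite !abnM; ring.
- by rewrite !abnV; ring.
- by ring.
Qed.

Lemma reach_tors al be n : reach al be -> (0 < n)%N -> (al ^+ n)%g <> 1%g.
Proof.
move=> /reach_cross h n0 e.
have z b : abn R b al = 0.
  have : n%:R * abn R b al = 0 by rewrite -abnX e abn1.
  by move/eqP; rewrite mulf_eq0 pnatr_eq0 eqn0Ngt n0 /= => /eqP.
by move: h; rewrite !z !mul0r subr0 expr0n => /eqP; rewrite eq_sym oner_eq0.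
Qed.

(** The list depends neither on the direction nor on the time nor on the orbit: another basis costs
    only bounded factors in the transport. *)
Lemma reach_orb al be : reach al be -> exists hs : seq free2,
  forall u v t c,
  orb gen_a gen_b (u * abn R false al + v * abn R false be)
    (u * abn R true al + v * abn R true be) t c ->
  exists2 c', orb al be u v t c' &
    forall s, exists2 h, h \in hs & (c' s).1 = ((c s).1 * h)%g.
Proof.
have comp hs1 hs2 (c c1 c2 : R -> cover R) :
  (forall s, exists2 h, h \in hs1 & (c1 s).1 = ((c s).1 * h)%g) ->
  (forall s, exists2 h, h \in hs2 & (c2 s).1 = ((c1 s).1 * h)%g) ->
  forall s, exists2 h, h \in [seq (h1 * h2)%g | h1 <- hs1, h2 <- hs2] & (c2 s).1 = ((c s).1 * h)%g.
  move=> H1 H2 s; have [h1 i1 e1] := H1 s; have [h2 i2 e2] := H2 s.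
  by exists (h1 * h2)%g; rewrite ?allpairs_f // e2 e1 mulgA.
elim=> {al be}.
- exists [:: 1%g] => u v t c H; exists c.
    by move: H; rewrite !abn_a !abn_b !mulr1 !mulr0 addr0 add0r.
  by move=> s; exists 1%g; rewrite ?inE // mulg1.
- move=> al be _ [hs IH]; have rel := relabelL R al be.
  eexists => u v t c H; have [|c1 o1 h1] := IH (u + v) v t c.
    move: H; rewrite !abnM; congr (orb _ _ _ _ t c); ring.
  exists (phiL al \o c1).
    by apply: relabel_orb rel _ o1 => k /=; congr pair; ring.
  apply: (comp _ _ _ _ _ h1) => s; case: rel => _ rel _; exact: rel.
- move=> al be _ [hs IH]; have rel := relabelF R al be.
  eexists => u v t c H; have [|c1 o1 h1] := IH (- u) v t c.
    move: H; rewrite !abnV; congr (orb _ _ _ _ t c); ring.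
  exists (phiF al \o c1).
    by apply: relabel_orb rel _ o1 => k /=; congr pair; ring.
  apply: (comp _ _ _ _ _ h1) => s; case: rel => _ rel _; exact: rel.
- move=> al be _ [hs IH]; have rel := relabelS R al be.
  eexists => u v t c H; have [|c1 o1 h1] := IH v u t c.
    by move: H; rewrite ![u * _ + _]addrC.
  exists (@phiS R \o c1).
    by apply: relabel_orb rel _ o1.
  apply: (comp _ _ _ _ _ h1) => s; case: rel => _ rel _; exact: rel.
Qed.

Lemma orb_extend al be u v p q s z e g0 c : 0 <= p -> p <= q -> room z e ->
  (forall r, p <= r <= q -> `|(r - s) * u| < e /\ `|(r - s) * v| < e) ->
  (forall r, p <= r <= q -> cell (frac (z.1 + (r - s) * u), frac (z.2 + (r - s) * v))) ->
  orb al be u v p c -> c p = trl al be (g0, z) ((p - s) * u, (p - s) * v) ->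
  orb al be u v q (fun r => if r <= p then c r else
    trl al be (g0, z) ((r - s) * u, (r - s) * v)).
Proof.
move=> p0 pq rz small cl oc cp r /andP[r0 rq].
pose W r := trl al be (g0, z) ((r - s) * u, (r - s) * v).
have WW r1 r2 : p <= r1 <= q -> p <= r2 <= q ->
    W r2 = trl al be (W r1) ((r2 - r1) * u, (r2 - r1) * v).
  move=> h1 h2; have [a1 b1] := small _ h1; have [a2 b2] := small _ h2.
  rewrite (@trl_comp _ _ _ (g0, z) _ _ e) //=.
  - by rewrite /W; congr (trl _ _ _ (_, _)); ring.
  - by rewrite -mulrDl addrC subrKA.
  - by rewrite -mulrDl addrC subrKA.
have [rp|pr] := ltP r p.
  have rp' := ltW rp; rewrite rp'.
  have [|c1 /nearP_dist[d d0 Hd]] := oc r; first by rewrite r0.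
  split=> //; apply/nearP_dist; exists (Num.min d (p - r)); first by rewrite lt_min d0 subr_gt0.
  move=> s'; rewrite lt_min => /andP[h1 h2] /andP[s0 sq].
  have sp : s' <= p by move: h2; rewrite ltr_norml => /andP[_ ?]; lra.
  by rewrite sp Hd // s0.
have cW : (if r <= p then c r else W r) = W r.
  case: leP => // rp; have -> : r = p by apply/eqP; rewrite eq_le rp pr.
  by rewrite cp.
rewrite cW; have rpq : p <= r <= q by rewrite pr.
split; first exact: cl.
have [rp|rp] := eqVneq r p; last first.
  have pr' : p < r by rewrite lt_neqAle eq_sym rp.
  apply/nearP_dist; exists (r - p); first by rewrite subr_gt0.
  move=> s'; rewrite ltr_norml => /andP[h1 h2] /andP[s0 sq].
  have ps : p < s' by lra.
  by rewrite leNgt ps /= -WW // ?(ltW ps).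
have [|c1 /nearP_dist[d d0 Hd]] := oc p; first by rewrite p0 lexx.
apply/nearP_dist; exists d => // s' hs /andP[s0 sq]; rewrite rp in hs *.
case: leP => sp; first by rewrite Hd ?s0 ?sp // cp.
by rewrite -/(W s') -WW ?lexx ?(ltW sp).
Qed.

(** The lift is continued one chart at a time by [real_ind]; only a passage through a lattice point
    could stop it. *)
Lemma orb_exists al be u v t (x : R * R) : cell x ->
  (forall s, 0 <= s <= t -> cell (frac (x.1 + s * u), frac (x.2 + s * v))) ->
  0 <= t -> exists2 c, orb al be u v t c & c 0 = (1%g, x).
Proof.
move=> cx cl t0.
pose P s := exists c, [/\ orb al be u v s c, c 0 = (1%g, x) &
  forall r, 0 <= r <= s -> (c r).2 = (frac (x.1 + r * u), frac (x.2 + r * v))].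
suff : P t by move=> [c [h1 h2 _]]; exists c.
move: (lexx t); suff H : forall s, 0 <= s <= t -> P s by move=> _; apply: H; rewrite t0 lexx.
have [/andP[x0 x1] /andP[y0 y1] _] := (cellP x).1 cx.
have x2E : x.2 = frac x.2 by rewrite frac_id // y0.
have x1E : x.1 = frac x.1 by rewrite frac_id // x0.
have fx : Num.floor x.1 = 0 by apply: floor_int_eq; rewrite mulr0z add0r x0.
have fy : Num.floor x.2 = 0 by apply: floor_int_eq; rewrite mulr0z add0r y0.
apply: real_ind.
  exists (fun r => (1%g, x)); split=> //.
    move=> s s0; have -> : s = 0 by lra.
    split => //; apply/nearP_dist; exists 1 => // s' _ s'0.
    have -> : s' = 0 by lra.
    by rewrite /trl /= subrr !mul0r !addr0 fx fy !zexpg0 !mulg1 -x1E -x2E; case: (x).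
  move=> r r0; have -> : r = 0 by lra.
  by rewrite /= !mul0r !addr0 -x1E -x2E; case: (x).
move=> s st; have cz := cl s st; set z := (_, _) in cz.
have [e re] := roomP cz; have e0 : 0 < e by case: re.
have [d d0 Hd] := near_step s u v e0.
exists d => // s' hs s't.
suff key p q : `|p - s| < d -> `|q - s| < d -> 0 <= p <= t -> 0 <= q <= t -> p <= q -> P p -> P q.
  have hss : `|s - s| < d by rewrite subrr normr0.
  by split=> ss; apply: key.
move=> hp hq /andP[p0 pt] /andP[q0 qt] pq [c [oc c0 cc]].
have win r : p <= r <= q -> `|r - s| < d.
  move: hp hq; rewrite !ltr_norml => /andP[? ?] /andP[? ?] /andP[? ?]; apply/andP; split; lra.
have zE r : (frac (z.1 + (r - s) * u), frac (z.2 + (r - s) * v)) = (frac (x.1 + r * u), frac (x.2 + r * v)).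
  by rewrite /z /= -!frac_shift; congr (frac _, frac _); ring.
(* [h] is the label picked up in the chart at time s; dividing by it makes the new piece start where
   the old one ends. *)
pose h := (zexpg al (Num.floor (z.1 + (p - s) * u)) * zexpg be (Num.floor (z.2 + (p - s) * v)))%g.
have cp : c p = trl al be (((c p).1 * h^-1)%g, z) ((p - s) * u, (p - s) * v).
  rewrite [LHS]surjective_pairing cc ?p0 ?lexx // -zE /trl /=; congr pair.
  by rewrite -mulgA -/h mulgVK.
have pp : 0 <= p <= p by rewrite p0 lexx.
exists (fun r => if r <= p then c r else trl al be (((c p).1 * h^-1)%g, z) ((r - s) * u, (r - s) * v)).
split.
- apply: (orb_extend p0 pq re) => //.
    by move=> r hr; apply: Hd; exact: win.
  by move=> r /andP[pr rq]; rewrite zE; apply: cl; apply/andP; split; lra.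
- by rewrite p0.
- move=> r /andP[r0 rq]; case: leP => rp; first by rewrite cc // r0.
  by rewrite -zE.
Qed.

End Reach.

(** * Exponents and transport matrices *)

Section IntegralBounds.
Variable R : realType.
Local Open Scope ereal_scope.

(** The integral of a nonnegative function is a supremum over simple functions below it, so
    monotonicity holds for functions not known to be measurable, such as the logarithm of the
    transport norm. *)
Lemma ge0_le_integral_nomeas d (T : measurableType d) (mu : {measure set T -> \bar R})
    (D : set T) (f g : T -> \bar R) :
  (forall x, D x -> 0 <= f x) -> (forall x, D x -> f x <= g x) ->
  \int[mu]_(x in D) f x <= \int[mu]_(x in D) g x.
Proof.
move=> f0 fg; have g0 x : D x -> 0 <= g x by move=> Dx; exact: le_trans (f0 _ Dx) (fg _ Dx).
rewrite !ge0_integralE //=; apply: le_ereal_sup => _ [h /= hf <-]; exists h => //= x.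
apply: (le_trans (hf x)); rewrite /patch; case: ifPn => // /set_mem xD; exact: fg.
Qed.

Local Notation RR := (measurableTypeR R * measurableTypeR R)%type.
Local Notation cellR := (@cell R : set RR).
Let mu : {measure set _ -> \bar R} := (@lebesgue_measure R \x @lebesgue_measure R)%E.

Lemma measurable_cell : measurable cellR.
Proof.
apply: measurableD; first exact: measurableX.
have -> : [set (0, 0)%R] = [set 0%R] `*` [set 0%R] :> set RR.
  by apply/seteqP; split => [x /= ->|[x y] /= [-> ->]].
exact: measurableX.
Qed.

Let muX (A B : set (measurableTypeR R)) : measurable A -> measurable B ->
  mu (A `*` B) = lebesgue_measure A * lebesgue_measure B.
Proof. by move=> mA mB; exact: product_measure1E. Qed.

Lemma mu_square : mu (`[0%R, 1%R[ `*` `[0%R, 1%R[) = 1.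
Proof.
rewrite muX //= lebesgue_measure_itv /= lte_fin ltr01.
by rewrite oppr0 adde0 mul1e.
Qed.

Lemma mu_cell_le : mu (cellR) <= 1.
Proof.
rewrite -mu_square; apply: le_measure; rewrite ?inE.
- exact: measurable_cell.
- exact: measurableX.
- by move=> x [].
Qed.

Lemma mu_cellD (N : set RR) : measurable N -> mu N = 0 -> mu (cellR `\` N) = 1.
Proof.
move=> mN N0; apply/eqP; rewrite eq_le; apply/andP; split.
  apply: le_trans mu_cell_le; apply: le_measure; rewrite ?inE.
  - by apply: measurableD => //; exact: measurable_cell.
  - exact: measurable_cell.
  - by move=> x [].
pose P := [set 0%R] `*` [set 0%R] : set RR.
have mP : measurable P by exact: measurableX.
have P0 : mu P = 0 by rewrite muX //= lebesgue_measure_set1 mul0e.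
have mc : measurable (cellR `\` N) by apply: measurableD => //; exact: measurable_cell.
rewrite -(measureU0 mc mN N0) -(measureU0 _ mP P0); last exact: measurableU.
rewrite -mu_square; apply: le_measure; rewrite ?inE.
- exact: measurableX.
- by apply: measurableU => //; exact: measurableU.
move=> x xs; have [->|xn] := pselect (x = (0, 0)%R); first by right.
by left; have [xN|xN] := pselect (N x); [right|left; split].
Qed.

Lemma int_bounds (f : R * R -> R) (a b : R) : (0 <= a)%R -> (0 <= b)%R ->
  (forall x, cell x -> (- a <= f x <= b)%R) ->
  (- a)%:E <= \int[mu]_(x in cellR) (f x)%:E <= b%:E.
Proof.
move=> a0 b0 H.
have mc := measurable_cell.
have bnd (g : RR -> \bar R) (k : R) : (0 <= k)%R -> (forall x, cell x -> 0 <= g x) ->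
  (forall x, cell x -> g x <= k%:E) -> 0 <= \int[mu]_(x in cellR) g x <= k%:E.
  move=> k0 g0 gk; rewrite integral_ge0 //=.
  apply: (@le_trans _ _ (\int[mu]_(x in cellR) (cst k%:E) x)).
    exact: ge0_le_integral_nomeas.
  rewrite integral_cst //; rewrite -[leRHS]mule1.
  by apply: lee_wpmul2l; [rewrite lee_fin|exact: mu_cell_le].
rewrite integralE; set p := integral _ _ _; set n := integral _ _ _.
have /andP[p0 pb] : 0 <= p <= b%:E.
  apply: bnd => // x cx; rewrite ?funepos_ge0 // funeposE ge_max !lee_fin b0 andbT.
  by case/andP: (H x cx).
have /andP[n0 na] : 0 <= n <= a%:E.
  apply: bnd => // x cx; rewrite ?funeneg_ge0 // funenegE ge_max -EFinN !lee_fin a0 andbT.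
  by case/andP: (H x cx) => h _; rewrite lerNl.
have fp : p \is a fin_num by rewrite ge0_fin_numE //; apply: le_lt_trans pb (ltry _).
have fn : n \is a fin_num by rewrite ge0_fin_numE //; apply: le_lt_trans na (ltry _).
move: p0 pb n0 na; rewrite -(fineK fp) -(fineK fn) -EFinB !lee_fin => *.
by apply/andP; split; lra.
Qed.

(** Off the null set the positive part dominates b times an indicator, which is measurable; the
    negative part is at most a everywhere. *)
Lemma int_lower (f : R * R -> R) (a b : R) (N : set RR) : (0 <= a)%R -> (0 <= b)%R ->
  measurable N -> mu N = 0 ->
  (forall x, cell x -> (- a <= f x)%R) ->
  (forall x, cell x -> ~ N x -> (b <= f x)%R) ->
  (b - a)%:E <= \int[mu]_(x in cellR) (f x)%:E.
Proof.
move=> a0 b0 mN N0 Ha Hb; have mc := measurable_cell.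
have mcN : measurable (cellR `\` N) by exact: measurableD.
rewrite integralE; set p := integral _ _ _; set n := integral _ _ _.
have pb : b%:E <= p.
  apply: (@le_trans _ _ (\int[mu]_(x in cellR) (b%:E * (\1_(cellR `\` N) x)%:E))).
    rewrite ge0_integralZl //; last by apply/measurable_EFinP; exact: measurable_indic.
    rewrite integral_indic // setIidl; last by move=> x [].
    by rewrite mu_cellD // mule1.
  apply: ge0_le_integral_nomeas => x cx.
    by rewrite -EFinM lee_fin mulr_ge0.
  rewrite indicE -EFinM; case: (boolP (x \in _)) => [/set_mem[_ xN]|_].
    by rewrite mulr1 funeposE le_max lee_fin Hb.
  by rewrite mulr0 funepos_ge0.
have /andP[n0 na] : 0 <= n <= a%:E.
  apply/andP; split; first by apply: integral_ge0 => x _; exact: funeneg_ge0.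
  apply: (@le_trans _ _ (\int[mu]_(x in cellR) (cst a%:E) x)).
    apply: ge0_le_integral_nomeas => x cx; first exact: funeneg_ge0.
    by rewrite funenegE ge_max -EFinN !lee_fin a0 andbT lerNl Ha.
  rewrite integral_cst //; rewrite -[leRHS]mule1.
  by apply: lee_wpmul2l; [rewrite lee_fin|exact: mu_cell_le].
have fn : n \is a fin_num by rewrite ge0_fin_numE //; apply: le_lt_trans na (ltry _).
rewrite EFinB; apply: leeB => //.
Qed.

Lemma line_null (p q c : R) : (p, q) <> (0, 0)%R ->
  measurable [set x : RR | (x.1 * p + x.2 * q = c)%R] /\
  mu [set x : RR | (x.1 * p + x.2 * q = c)%R] = 0.
Proof.
move=> pq; set L := [set x | _].
have mL : measurable L.
  have mf : measurable_fun setT (fun x : RR => (x.1 * p + x.2 * q)%R).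
    by apply: measurable_funD; apply: measurable_funM => //.
  have -> : L = setT `&` (fun x : RR => (x.1 * p + x.2 * q)%R) @^-1` [set c] by rewrite setTI.
  exact: mf.
split => //; have [q0|q0] := eqVneq q 0%R.
  have p0 : p != 0%R by apply/eqP => p0; apply: pq; rewrite p0 q0.
  have -> : L = [set (c / p)%R] `*` setT.
    apply/seteqP; split => [[x y] /=|[x y] /= [-> _]]; rewrite /L /= q0 mulr0 addr0.
      by move=> <-; rewrite mulfK.
    by rewrite divfK.
  by rewrite muX //= lebesgue_measure_set1 mul0e.
rewrite /mu /= /product_measure1 /=; apply: integral0_eq => x _ /=.
have -> : xsection L x = [set ((c - x * p) / q)%R].
  apply/seteqP; split => y; rewrite /xsection /= inE /L /=.
    by move=> <-; rewrite addrC addKr mulfK.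
  by move=> ->; rewrite divfK // addrC subrK.
exact: lebesgue_measure_set1.
Qed.

(** With (p, q) normal to the flow, these points are those whose line meets the lattice: countably
    many lines, enumerated by [unpickle]. *)
Lemma lattice_lines_null (p q : R) : (p, q) <> (0, 0)%R ->
  exists N : set RR, [/\ measurable N, mu N = 0 &
    forall (x : R * R) (k l : int), (((x.1 - k%:~R) * p + (x.2 - l%:~R) * q) = 0)%R -> N x].
Proof.
move=> pq.
pose F (n : nat) : set RR := if @unpickle (int * int)%type n is Some kl then
  [set x : RR | (x.1 * p + x.2 * q = kl.1%:~R * p + kl.2%:~R * q)%R] else set0.
have mF n : measurable (F n).
  by rewrite /F; case: unpickle => // kl; case: (line_null (kl.1%:~R * p + kl.2%:~R * q)%R pq).
have F0 n : mu (F n) = 0.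
  rewrite /F; case: unpickle => [kl|]; last exact: measure0.
  by case: (line_null (kl.1%:~R * p + kl.2%:~R * q)%R pq).
exists (\bigcup_n F n); split.
- exact: bigcup_measurable.
- apply/eqP; rewrite eq_le measure_ge0 andbT.
  apply: (le_trans (@measure_sigma_subadditive _ _ _ mu _ _ mF (bigcup_measurable (fun n _ => mF n)) (@subset_refl _ _))).
  by rewrite eseries0 // => n _ _; exact: F0.
move=> x k l h; exists (pickle (k, l)); first exact: I.
rewrite /F pickleK /=.
apply/eqP; rewrite -subr_eq0; apply/eqP; rewrite -h; ring.
Qed.

End IntegralBounds.

(** * Comparison of the metric with the Euclidean norm *)

Section Gram.
Variable R : realType.
Implicit Types (G A : 'M[R]_2) (w v : 'cV[R]_2).

Definition sq w : R := w 0 0 ^+ 2 + w 1 0 ^+ 2.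

Lemma sq_ge0 w : 0 <= sq w.
Proof. by rewrite addr_ge0 ?sqr_ge0. Qed.

Lemma qformE G w : qform G w =
  G 0 0 * w 0 0 ^+ 2 + (G 0 1 + G 1 0) * (w 0 0 * w 1 0) + G 1 1 * w 1 0 ^+ 2.
Proof. by rewrite /qform !mxE sum2 !mxE !sum2 !mxE; ring. Qed.

Lemma sq_mul A w : sq (A *m w) <= nm A ^+ 2 * sq w.
Proof.
rewrite /sq !mul2E; set x := w 0 0; set y := w 1 0.
have H (a b : R) : (a * x + b * y) ^+ 2 <= (a ^+ 2 + b ^+ 2) * (x ^+ 2 + y ^+ 2).
  have := sqr_ge0 (a * y - b * x); lra.
apply: (le_trans (lerD (H _ _) (H _ _))); rewrite -mulrDl.
apply: ler_wpM2r; first by rewrite addr_ge0 ?sqr_ge0.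
rewrite /nm -(real_normK (num_real (A 0 0))) -(real_normK (num_real (A 0 1))).
rewrite -(real_normK (num_real (A 1 0))) -(real_normK (num_real (A 1 1))).
have := (normr_ge0 (A 0 0), normr_ge0 (A 0 1), normr_ge0 (A 1 0), normr_ge0 (A 1 1)).
move: `|A 0 0| `|A 0 1| `|A 1 0| `|A 1 1| => a b c d [[[a0 b0] c0] d0].
have := (mulr_ge0 a0 b0, mulr_ge0 a0 c0, mulr_ge0 a0 d0, mulr_ge0 b0 c0, mulr_ge0 b0 d0, mulr_ge0 c0 d0).
by move=> [[[[[]]]]]; lra.
Qed.

Definition qbound (C : R) G : Prop := forall w, sq w <= C * qform G w /\ qform G w <= C * sq w.

Lemma qbound_le C C' G : 0 < C -> C <= C' -> qbound C G -> qbound C' G.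
Proof.
move=> C0 CC H w; have [h1 h2] := H w; have s0 := sq_ge0 w.
have q0 : 0 <= qform G w by rewrite -(pmulr_rge0 _ C0); apply: le_trans h1.
by split; [apply: (le_trans h1)|apply: (le_trans h2)]; apply: ler_wpM2r.
Qed.

Lemma posdef_near G0 : posdef G0 -> exists C eps : R, [/\ 0 < C, 0 < eps &
  forall G, (forall i j, `|G i j - G0 i j| < eps) -> qbound C G].
Proof.
move=> [sG pG].
set a := G0 0 0; set b := G0 0 1; set d := G0 1 1.
have G10 : G0 1 0 = b by rewrite /b -{2}sG mxE.
have colE (x y : R) : exists w, [/\ w 0 0 = x, w 1 0 = y & (w != 0) = ((x != 0) || (y != 0))].
  exists (\col_i (if i == 0 then x else y)); rewrite !mxE /=; split => //.
  apply/idP/idP.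
    apply: contraNT; rewrite negb_or !negbK => /andP[/eqP-> /eqP->].
    by apply/eqP/matrixP => i j; rewrite !mxE; case: ifP.
  move=> /orP[|] n0; apply: contraNneq n0 => /matrixP h.
    by have := h 0 0; rewrite !mxE /= => ->.
  by have := h 1 0; rewrite !mxE /= => ->.
have a0 : 0 < a.
  have [w [w0 w1 wn]] := colE 1 0; have := pG w; rewrite wn oner_neq0 => /(_ isT).
  by rewrite qformE w0 w1 -/a; lra.
have D0 : 0 < a * d - b ^+ 2.
  have [w [w0 w1 wn]] := colE (- b) a; have := pG w; rewrite wn (gt_eqF a0) orbT => /(_ isT).
  rewrite qformE w0 w1 G10 -/a -/b -/d.
  have -> : a * (- b) ^+ 2 + (b + b) * (- b * a) + d * a ^+ 2 = a * (a * d - b ^+ 2) by ring.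
  by rewrite pmulr_rgt0.
have d0 : 0 < d by nra.
(* Determinant over trace bounds both eigenvalues of a positive definite matrix from below. *)
pose lam := (a * d - b ^+ 2) / (a + d).
have lam0 : 0 < lam by rewrite divr_gt0 // addr_gt0.
have lamE : lam * (a + d) = a * d - b ^+ 2 by rewrite divfK // gt_eqF // addr_gt0.
have low w : lam * sq w <= qform G0 w.
  rewrite qformE G10 -/a -/b -/d /sq; set x := w 0 0; set y := w 1 0.
  have al : 0 < a - lam.
    have : 0 < (a - lam) * (a + d) by rewrite mulrBl lamE; have := sqr_ge0 b; nra.
    by rewrite pmulr_lgt0 // addr_gt0.
  rewrite -subr_ge0 -(pmulr_rge0 _ al).
  have -> : (a - lam) * (a * x ^+ 2 + (b + b) * (x * y) + d * y ^+ 2 - lam * (x ^+ 2 + y ^+ 2)) =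
    ((a - lam) * x + b * y) ^+ 2 + (lam ^+ 2 + (a * d - b ^+ 2 - lam * (a + d))) * y ^+ 2 by ring.
  by rewrite lamE subrr addr0 addr_ge0 ?sqr_ge0 // mulr_ge0 ?sqr_ge0.
have up w : qform G0 w <= nm G0 * sq w.
  rewrite qformE /sq /nm; set x := w 0 0; set y := w 1 0.
  have h1 (p z : R) : 0 <= z -> p * z <= `|p| * z by move=> z0; rewrite ler_wpM2r // ler_norm.
  have h2 (p : R) : p * (x * y) <= `|p| * (x ^+ 2 + y ^+ 2).
    apply: (le_trans (ler_norm _)); rewrite normrM ler_wpM2l //.
    rewrite ler_norml; have := (sqr_ge0 (x + y), sqr_ge0 (x - y), sqr_ge0 x, sqr_ge0 y).
    by move=> [[[]]] *; apply/andP; split; lra.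
  have := (h1 (G0 0 0) _ (sqr_ge0 x), h1 (G0 1 1) _ (sqr_ge0 y), h2 (G0 0 1), h2 (G0 1 0)).
  have := (mulr_ge0 (normr_ge0 (G0 0 0)) (sqr_ge0 y), mulr_ge0 (normr_ge0 (G0 1 1)) (sqr_ge0 x)).
  by move=> [? ?] [[[]]]; lra.
have diff G w eps : (forall i j, `|G i j - G0 i j| < eps) -> `|qform G w - qform G0 w| <= 2 * eps * sq w.
  move=> H; rewrite !qformE /sq; set x := w 0 0; set y := w 1 0.
  have -> : G 0 0 * x ^+ 2 + (G 0 1 + G 1 0) * (x * y) + G 1 1 * y ^+ 2 -
    (G0 0 0 * x ^+ 2 + (G0 0 1 + G0 1 0) * (x * y) + G0 1 1 * y ^+ 2) =
    (G 0 0 - G0 0 0) * x ^+ 2 + ((G 0 1 - G0 0 1) + (G 1 0 - G0 1 0)) * (x * y)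
    + (G 1 1 - G0 1 1) * y ^+ 2 by ring.
  have e0 : 0 <= eps by apply: le_trans (ltW (H 0 0)); exact: normr_ge0.
  have h1 : `|G 0 1 - G0 0 1 + (G 1 0 - G0 1 0)| <= 2 * eps.
    by apply: (le_trans (ler_normD _ _)); have := (H 0 1, H 1 0); move=> []; lra.
  have h2 (p k z z' : R) : `|p| <= k -> `|z| <= z' -> `|p * z| <= k * z'.
    by move=> *; rewrite normrM ler_pM.
  have h3 : `|x * y| <= (x ^+ 2 + y ^+ 2) / 2.
    rewrite ler_norml; have := (sqr_ge0 (x + y), sqr_ge0 (x - y)).
    by move=> [] *; apply/andP; split; lra.
  have h4 (z : R) : `|z ^+ 2| <= z ^+ 2 by rewrite ger0_norm ?sqr_ge0.
  apply: (le_trans (ler_normD _ _)); apply: (le_trans (lerD (ler_normD _ _) (lexx _))).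
  have := (h2 _ _ _ _ (ltW (H 0 0)) (h4 x), h2 _ _ _ _ h1 h3, h2 _ _ _ _ (ltW (H 1 1)) (h4 y)).
  by move=> [[]]; lra.
pose C := 2 / lam + nm G0 + lam.
have C0 : 0 < C.
  have : 0 < 2 / lam by rewrite divr_gt0.
  by have := nm_ge0 G0; rewrite /C; lra.
exists C, (lam / 4); split; [exact: C0|lra|move=> G H w].
have s0 := sq_ge0 w; have := diff G w _ H; rewrite ler_norml => /andP[k1 k2].
have l1 := low w; have u1 := up w.
have n0 := nm_ge0 G0.
split.
  have h : lam / 2 * sq w <= qform G w by lra.
  have q0 : 0 <= qform G w by apply: le_trans h; rewrite mulr_ge0 // divr_ge0 // ltW.
  have : (2 / lam) * (lam / 2 * sq w) <= (2 / lam) * qform G w.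
    by apply: ler_wpM2l => //; apply: divr_ge0 => //; exact: ltW.
  have -> : (2 / lam) * (lam / 2 * sq w) = sq w by field; rewrite gt_eqF.
  rewrite /C => h'; apply: (le_trans h'); apply: ler_wpM2r => //; lra.
have h : qform G w <= (nm G0 + lam) * sq w.
  by have := mulr_ge0 (ltW lam0) s0; lra.
apply: (le_trans h); apply: ler_wpM2r => //; rewrite /C.
have : 0 <= 2 / lam by apply: divr_ge0 => //; exact: ltW.
lra.
Qed.

Lemma smooth_near (f : R * R -> 'M[R]_2) (x : R * R) : smooth_at f x ->
  forall eps, 0 < eps -> exists2 d : R, 0 < d & forall u : R * R,
    `|u.1 - x.1| < d -> `|u.2 - x.2| < d -> forall i j, `|f u i j - f x i j| < eps.
Proof.
move=> [U [oU Ux /(_ 0%N) [cf _]]] eps e0; have fx := cf _ Ux.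
have : \forall u \near x, forall i j, `|f u i j - f x i j| < eps.
  have [n00 n01 n10 n11] : [/\ \forall u \near x, `|f u 0 0 - f x 0 0| < eps,
    \forall u \near x, `|f u 0 1 - f x 0 1| < eps, \forall u \near x, `|f u 1 0 - f x 1 0| < eps &
    \forall u \near x, `|f u 1 1 - f x 1 1| < eps].
    have H i j : \forall u \near x, `|f u i j - f x i j| < eps.
      have : (fun u => f u i j) @ x --> f x i j.
        by apply: (@continuous_comp _ _ _ f (fun M : 'M[R]_2 => M i j) x fx); exact: coord_continuous.
      by move=> /cvgrPdist_lt /(_ _ e0); apply: filterS => u; rewrite distrC.
    by split.
  near=> u => i j; case: (ord2P i) => ->; case: (ord2P j) => ->; by near: u.
move=> /nbhs_ballP[d /= d0 Hd]; exists d => // u h1 h2 i j; apply: Hd.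
by split; rewrite /ball /= distrC.
Unshelve. all: by end_near. Qed.

End Gram.

Section GramBound.
Variables (R : realType) (rho : free2 -> 'M[R]_2) (m : bundle_metric rho).

Definition box (z x : R * R) (d : R) : Prop := `|x.1 - z.1| < d /\ `|x.2 - z.2| < d.

(** No continuity of the best constant is assumed: if no constant worked, the sets of points where n
    + 1 fails would form a filter base with a cluster point in K. *)
Lemma compact_bound (K : set (R * R)) (Q : R -> R * R -> Prop) : compact K ->
  (forall C C' x, 0 < C -> C <= C' -> Q C x -> Q C' x) ->
  (forall z, K z -> exists C d : R, [/\ 0 < C, 0 < d & forall x, K x -> box z x d -> Q C x]) ->
  exists2 C : R, 0 < C & forall x, K x -> Q C x.
Proof.
move=> cK Qle loc; apply: contrapT => H.
pose B (n : nat) := [set x | K x /\ ~ Q n.+1%:R x].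
have Bn n : B n !=set0.
  apply: contrapT => nB; apply: H; exists n.+1%:R => // x Kx.
  by apply: contrapT => nQ; apply: nB; exists x.
have Bsub n n' : (n <= n')%N -> B n' `<=` B n.
  move=> nn x [Kx nQ]; split => // q; apply: nQ; apply: Qle q; rewrite ?ltr0n //.
  by rewrite ler_nat ltnS.
pose F : set_system (R * R) := [set A | exists n, B n `<=` A].
have FF : ProperFilter F.
  split; first by move=> [n h]; have [x /h] := Bn n.
  split; first by exists 0%N.
    move=> P Q' [n1 h1] [n2 h2]; exists (maxn n1 n2) => x bx; split.
      by apply: h1; apply: Bsub bx; rewrite leq_maxl.
    by apply: h2; apply: Bsub bx; rewrite leq_maxr.
  by move=> P Q' PQ [n h]; exists n => x /h /PQ.
have [|z [Kz cz]] := cK F FF; first by exists 0%N => x [].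
have [C [d [C0 d0 Hd]]] := loc z Kz.
pose n := Num.truncn C.
have [||x [[Kx nQ] bx]] := cz (B n) [set x | box z x d].
- by exists n.
- apply/nbhs_ballP; exists d => //= x [h1 h2]; split; rewrite distrC; [exact: h1|exact: h2].
apply: nQ; apply: Qle (Hd x Kx bx) => //; apply: ltW; exact: truncnS_gt.
Qed.


Lemma mx_norm_entry (A : 'M[R]_2) (C : R) i j : `|A| <= C -> `|A i j| <= C.
Proof.
apply: le_trans; rewrite /Num.Def.normr /= mx_normrE.
exact: (le_bigmax _ (fun ij : 'I_2 * 'I_2 => `|A ij.1 ij.2|) (i, j)).
Qed.

Lemma nm_le4 (A : 'M[R]_2) (C : R) : `|A| <= C -> nm A <= 4 * C.
Proof.
move=> h; rewrite /nm.
have := (mx_norm_entry 0 0 h, mx_norm_entry 0 1 h, mx_norm_entry 1 0 h, mx_norm_entry 1 1 h).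
by move=> [[[]]]; lra.
Qed.

Lemma gram_near_regular (z : R * R) : 0 <= z.1 <= 1 -> 0 <= z.2 <= 1 ->
  cell (frac z.1, frac z.2) ->
  exists C d : R, [/\ 0 < C, 0 < d & forall x, cell x -> box z x d -> qbound C (gram m (1%g, x))].
Proof.
move=> z1 z2 cz.
(* A point of the right or top side is not in the cell but in a neighbouring copy, whose chart also
   covers the nearby points of the cell. *)
pose y : cover R := ((zexpg gen_a (Num.floor z.1) * zexpg gen_b (Num.floor z.2))%g, (frac z.1, frac z.2)).
have [C [e [C0 e0 H]]] := posdef_near (gram_posdef m (y := y) cz).
have [d d0 Hd] := smooth_near (gram_smooth m (y := y) cz) e0.
have tr0 : translate y (0, 0) = y.
  rewrite /translate /y /= !addr0 !(frac_id (frac_itv _)).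
  have fl0 (s : R) : Num.floor (frac s) = 0.
    by apply: floor_int_eq; rewrite mulr0z add0r; exact: frac_itv.
  by rewrite !fl0 !zexpg0 !mulg1.
exists C, d; split => // x cx [b1 b2].
have fl (s : R) : 0 <= s <= 1 -> Num.floor s = 0 \/ (Num.floor s = 1 /\ frac s = 0).
  move=> /andP[s0 s1]; have [->|s1'] := eqVneq s 1.
    have f1 : Num.floor (1 : R) = 1 :> int by apply: floor_int_eq; rewrite mulr1z; apply/andP; split; lra.
    by right; rewrite /frac f1 mulr1z subrr.
  left; apply: floor_int_eq; rewrite mulr0z add0r s0 lt_neqAle s1' //.
have [/andP[x10 x11] /andP[x20 x21] _] := (cellP x).1 cx.
have flx (s x0 : R) : 0 <= x0 < 1 -> Num.floor (frac s + (x0 - s)) = - Num.floor s /\ frac (frac s + (x0 - s)) = x0.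
  move=> x0b; have -> : frac s + (x0 - s) = x0 + (- Num.floor s)%:~R.
    by rewrite /frac mulrNz; ring.
  rewrite frac_int frac_id //; split => //.
  by apply: floor_int_eq; case/andP: x0b => *; apply/andP; split; lra.
have trx : translate y (x.1 - z.1, x.2 - z.2) = (1%g, x).
  rewrite /translate /y /=; have [|-> ->] := flx z.1 x.1; first by rewrite x10.
  have [|-> ->] := flx z.2 x.2; first by rewrite x20.
  rewrite -surjective_pairing; congr pair.
  case: (fl _ z1) => [->|[-> f1]]; case: (fl _ z2) => [->|[-> f2]];
    rewrite ?oppr0 ?zexpg0 ?zexpg1 ?zexpgN1 ?mulg1 ?mul1g ?mulgV //.
  by case: ((cellP _).1 cz) => _ _; rewrite f1 f2.
apply: H => i j; have := Hd (x.1 - z.1, x.2 - z.2); rewrite /= !subr0 => /(_ b1 b2 i j).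
by rewrite trx tr0.
Qed.

(** Here tameness enters: near p the metric in the flat frame is [gram0], continuous at p,
    transported by a frame that is bounded together with its inverse. *)
Lemma gram_near_corner (k l : int) : exists C d : R, [/\ 0 < C, 0 < d &
  forall x, cell x -> box (k%:~R, l%:~R) x d -> qbound C (gram m (1%g, x))].
Proof.
have [C [e [C0 e0 H]]] := posdef_near (gram0_posdef m).
have [d d0 Hd] := smooth_near (@gram0_smooth _ _ m 0 (or_introl (erefl 0))) e0.
have /andP[r0 r1] := radius_gt0 m.
have [K HK] := frame_tame m.
have K0 : 0 <= K.
  have [|h _] := HK (radius m / 2, 0).
    rewrite /punctured_disc /= expr0n addr0; apply/andP; split; nra.
  by apply: le_trans h; exact: normr_ge0.
pose N := (4 * K) ^+ 2 + 1.
have N0 : 0 < N by rewrite ltr_wpDl ?sqr_ge0.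
exists (C * N), (Num.min d (radius m / 2)); split.
- by rewrite mulr_gt0.
- by rewrite lt_min d0 divr_gt0.
move=> x cx [/=]; rewrite !lt_min => /andP[b1 b1'] /andP[b2 b2'].
pose u : R * R := (x.1 - k%:~R, x.2 - l%:~R).
have [/andP[x10 x11] /andP[x20 x21] xn] := (cellP x).1 cx.
have fr (s : R) (i : int) : 0 <= s < 1 -> frac (s - i%:~R) = s.
  by move=> hs; rewrite -mulrNz frac_int frac_id.
have fu : (frac u.1, frac u.2) = x.
  by rewrite /u /= !fr ?x10 ?x20 //; case: (x).
have un : u.1 <> 0 \/ u.2 <> 0.
  have [u1|u1] := eqVneq u.1 0; last by left; apply/eqP.
  right => u2; apply: xn; rewrite -fu u1 u2 (_ : frac 0 = 0) // frac_id // lexx ltr01 //.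
have pu : punctured_disc (radius m) u.
  apply/andP; split.
    by rewrite lt_neqAle addr_ge0 ?sqr_ge0 // andbT eq_sym paddr_eq0 ?sqr_ge0 // !sqrf_eq0;
      case: un => /eqP /negbTE ->; rewrite ?andbF.
  have h (a : R) : `|a| < radius m / 2 -> a ^+ 2 < radius m ^+ 2 / 4.
    rewrite -real_normK ?num_real //; have := normr_ge0 a; move: `|a| => b *; nra.
  by have := (h u.1 b1', h u.2 b2'); move=> []; have := r0; nra.
have ab : above u (1%g, x) by rewrite /above /= fu.
have gE := gram0E pu ab; have fU := frame_unit pu ab.
have [] := HK u pu; rewrite fu => /nm_le4 f1 /nm_le4 f2.
have qb : qbound C (gram0 m u).
  apply: H => i j; apply: (Hd u); rewrite /= subr0; [exact: b1|exact: b2].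
set F := frame m (1%g, x) in gE fU f1 f2 *.
have sqN A (w : 'cV[R]_2) : nm A <= 4 * K -> sq (A *m w) <= N * sq w.
  move=> h; apply: (le_trans (sq_mul _ _)); apply: ler_wpM2r; first exact: sq_ge0.
  have : nm A ^+ 2 <= (4 * K) ^+ 2 by rewrite ler_pXn2r ?nnegrE ?nm_ge0 ?mulr_ge0.
  by rewrite /N; lra.
move=> w; pose w' := invmx F *m w.
have wE : w = F *m w' by rewrite /w' mulKVmx.
have qE : qform (gram m (1%g, x)) w = qform (gram0 m u) w'.
  by rewrite -gE wE /qform trmx_mul !mulmxA.
have [h1 h2] := qb w'; rewrite qE.
have s1 : sq w <= N * sq w' by rewrite {1}wE; exact: sqN.
have s2 : sq w' <= N * sq w by exact: sqN.
split.
  apply: (le_trans s1); rewrite [C * N]mulrC -mulrA ler_wpM2l // ltW //.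
apply: (le_trans h2); rewrite -mulrA ler_wpM2l // ltW //.
Qed.

Lemma gram_bound : exists2 C : R, 0 < C & forall x, cell x -> qbound C (gram m (1%g, x)).
Proof.
pose K : set (R * R) := `[0, 1]%classic `*` `[0, 1]%classic.
have cK : compact K by apply: compact_setX; exact: segment_compact.
have [||C C0 H] :=
  @compact_bound K (fun C x => cell x -> qbound C (gram m (1%g, x))) cK.
- by move=> C1 C2 x C10 C12 q cx; exact: qbound_le (q cx).
- move=> z [/=]; rewrite !in_itv /= => z1 z2.
  have [cz|ncz] := pselect (cell (frac z.1, frac z.2)).
    have [C [d [C0 d0 H]]] := gram_near_regular z1 z2 cz.
    by exists C, d; split => // x _ bx cx; exact: H.
  have [fz1 fz2] : frac z.1 = 0 /\ frac z.2 = 0.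
    by apply: contrapT => h; apply: ncz; apply/cell_frac => -[f1 f2]; apply: h.
  have [C [d [C0 d0 H]]] := gram_near_corner (Num.floor z.1) (Num.floor z.2).
  exists C, d; split => // x _ bx cx; apply: H => //.
  have e1 : (Num.floor z.1)%:~R = z.1 by move: fz1; rewrite /frac; lra.
  have e2 : (Num.floor z.2)%:~R = z.2 by move: fz2; rewrite /frac; lra.
  by rewrite e1 e2.
exists C => // x cx; apply: H => //.
have [/andP[x10 x11] /andP[x20 x21] _] := (cellP x).1 cx.
by split; rewrite /= in_itv /= ?x10 ?x20 ?(ltW x11) ?(ltW x21).
Qed.

End GramBound.

(** * From transport matrices to the exponent *)

Section Exponent.
Variables (R : realType) (rho : free2 -> 'M[R]_2).
Hypothesis rho_rep : sl2_representation rho.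
Variable m : bundle_metric rho.

Lemma rep_det g : \det (rho g) = 1. Proof. by case: rho_rep. Qed.
Lemma qform_conj (A G : 'M[R]_2) w : qform (A^T *m G *m A) w = qform G (A *m w).
Proof. by rewrite /qform trmx_mul !mulmxA. Qed.

(** Transport is the identity in the flat frame, and by equivariance the norm of v at (g, x') is
    that of rho(g)^-1 v at (1, x'). Both metrics being comparable to the Euclidean one, the operator
    norm is comparable to that of rho(g)^-1, hence of rho(g). *)
Lemma transport_bound : exists2 K : R, 1 <= K & forall x x' g, cell x -> cell x' ->
  nm (rho g) <= K * transport_opnorm m (1%g, x) (g, x') /\
  transport_opnorm m (1%g, x) (g, x') <= K * nm (rho g).
Proof.
have [C0 C00 HC0] := gram_bound m.
pose C := C0 + 1; have C1 : 1 <= C by rewrite /C; lra.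
have Cp : 0 < C by lra.
have HC x : cell x -> qbound C (gram m (1%g, x)).
  by move=> cx; apply: (qbound_le C00) (HC0 x cx); rewrite /C; lra.
exists (4 * C); first lra.
move=> x x' g cx cx'.
have vE v : vnorm m (g, x') v = Num.sqrt (qform (gram m (1%g, x')) (inv2 (rho g) *m v)).
  rewrite /vnorm -(gram_equivariant m g (y := (1%g, x'))) // /deck /= mulg1.
  by rewrite qform_conj mulmxA mul2V ?rep_det // mul1mx.
pose N := nm (rho g); have N0 : 0 <= N by exact: nm_ge0.
pose S := [set vnorm m (g, x') v | v in [set v | vnorm m (1%g, x) v <= 1]].
have q0 y (w : 'cV[R]_2) : cell y -> 0 <= qform (gram m (1%g, y)) w.
  by move=> cy; rewrite -(pmulr_rge0 _ Cp); apply: le_trans (HC y cy w).1; exact: sq_ge0.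
have sqrt_le (a b : R) : 0 <= b -> a <= b ^+ 2 -> Num.sqrt a <= b.
  by move=> b0 h; rewrite -(ger0_norm b0) -sqrtr_sqr ler_wsqrtr.
have ub : ubound S (C * N).
  move=> _ [v /= hv <-]; rewrite vE; apply: sqrt_le; first by rewrite mulr_ge0 // ltW.
  have hv2 : qform (gram m (1%g, x)) v <= 1.
    have := q0 x v cx => qv; rewrite /vnorm in hv.
    by rewrite -(sqr_sqrtr qv) expr_le1 ?sqrtr_ge0.
  have s1 : sq v <= C.
    by apply: (le_trans (HC x cx v).1); rewrite -[leRHS]mulr1 ler_wpM2l // ltW.
  apply: (le_trans (HC x' cx' _).2).
  apply: (@le_trans _ _ (C * (N ^+ 2 * sq v))).
    by rewrite ler_wpM2l ?(ltW Cp) // /N -nm_inv2; exact: sq_mul.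
  have -> : (C * N) ^+ 2 = C * (N ^+ 2 * C) by ring.
  by apply: ler_wpM2l; [exact: ltW|apply: ler_wpM2l => //; exact: sqr_ge0].
have S0 : S !=set0.
  exists (vnorm m (g, x') 0), 0 => //=.
  rewrite /vnorm qformE !mxE !expr0n !mulr0 !addr0 sqrtr0 //.
have hS : has_sup S by split => //; exists (C * N).
have topE : transport_opnorm m (1%g, x) (g, x') = sup S by [].
rewrite topE; split; last first.
  by apply: (le_trans (ge_sup S0 ub)); rewrite -/N; have := mulr_ge0 (ltW Cp) N0; lra.
(* [k] brings the basis vectors into the unit ball of the metric at x. *)
pose k := (Num.sqrt C)^-1.
have sC : 0 < Num.sqrt C by rewrite sqrtr_gt0.
have k0 : 0 < k by rewrite invr_gt0.
have k2 : k ^+ 2 * C = 1 by rewrite exprVn sqr_sqrtr ?(ltW Cp) // mulVf // gt_eqF.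
have entry i j : `|inv2 (rho g) i j| <= C * sup S.
  pose v : 'cV[R]_2 := k *: delta_mx j 0.
  have sv : sq v = k ^+ 2.
    by rewrite /sq !mxE; case: (ord2P j) => -> /=; ring.
  have Sv : S (vnorm m (g, x') v).
    exists v => //=; rewrite /vnorm; apply: sqrt_le => //.
    rewrite expr1n; apply: (le_trans (HC x cx v).2).
    by rewrite sv mulrC k2.
  have := ub_le_sup hS.2 Sv; rewrite vE => hv.
  have wE : (inv2 (rho g) *m v) i 0 = k * inv2 (rho g) i j.
    rewrite mul2E !mxE; case: (ord2P j) => -> /=; ring.
  have h1 : k ^+ 2 * inv2 (rho g) i j ^+ 2 <= C * qform (gram m (1%g, x')) (inv2 (rho g) *m v).
    rewrite -exprMn -wE; apply: le_trans (HC x' cx' _).1.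
    by rewrite /sq; case: (ord2P i) => ->; rewrite ?lerDl ?lerDr sqr_ge0.
  have h2 : inv2 (rho g) i j ^+ 2 <= (C * sup S) ^+ 2.
    have sS : 0 <= sup S by apply: le_trans hv; exact: sqrtr_ge0.
    have : qform (gram m (1%g, x')) (inv2 (rho g) *m v) <= (sup S) ^+ 2.
      rewrite -[leLHS]sqr_sqrtr ?q0 // ler_pXn2r ?nnegrE ?sqrtr_ge0 //.
    move=> h3; have h4 := le_trans h1 (ler_wpM2l (ltW Cp) h3).
    have -> : (C * sup S) ^+ 2 = C * (C * sup S ^+ 2) by ring.
    have -> : inv2 (rho g) i j ^+ 2 = C * (k ^+ 2 * inv2 (rho g) i j ^+ 2).
      by rewrite mulrA (mulrC C) k2 mul1r.
    by apply: ler_wpM2l => //; exact: ltW.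
  have sS : 0 <= sup S by apply: le_trans hv; exact: sqrtr_ge0.
  rewrite -(ler_pXn2r (n := 2)) ?nnegrE ?mulr_ge0 ?(ltW Cp) // real_normK ?num_real //.
rewrite -nm_inv2 /nm; have := (entry 0 0, entry 0 1, entry 1 0, entry 1 1).
by move=> [[[]]]; lra.
Qed.

(** The bounds range over all lifted orbits from x, so the choice made by [xget] does not matter.
    The default value 1 has logarithm 0, whence 0 <= N in the upper bound and the existence of an
    orbit in the lower one. *)
Lemma phi_log_bound : exists2 a : R, 0 <= a &
  forall theta t x, 0 <= t -> cell x ->
  [/\ - a <= ln (phi_norm m theta t x),
      forall N, 0 <= N -> (forall c, c 0 = (1%g, x) -> orb gen_a gen_b theta.1 theta.2 t c ->
         ln (nm (rho (c t).1)) <= N) -> ln (phi_norm m theta t x) <= N + a &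
      forall N, (exists2 c, orb gen_a gen_b theta.1 theta.2 t c & c 0 = (1%g, x)) ->
        (forall c, c 0 = (1%g, x) -> orb gen_a gen_b theta.1 theta.2 t c ->
         N <= ln (nm (rho (c t).1))) -> N - a <= ln (phi_norm m theta t x)].
Proof.
have [K K1 HK] := transport_bound.
have lK : 0 <= ln K by exact: ln_ge0.
have K0 : 0 < K by lra.
exists (ln K) => // theta t x t0 cx.
have key c : lifted_orbit theta t (1%g, x) c ->
  ln (nm (rho (c t).1)) - ln K <= ln (transport_opnorm m (c 0) (c t)) /\
  ln (transport_opnorm m (c 0) (c t)) <= ln (nm (rho (c t).1)) + ln K.
  move=> [c0 oc]; have [|ct _] := oc t; first by rewrite t0 lexx.
  rewrite c0 [c t]surjective_pairing /=; have [h1 h2] := HK x (c t).2 (c t).1 cx ct.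
  have n1 : 1 <= nm (rho (c t).1) by apply: nm_sl2; exact: rep_det.
  set T := transport_opnorm _ _ _ in h1 h2 *.
  have T0 : 0 < T.
    by rewrite -(pmulr_rgt0 _ K0); apply: lt_le_trans h1; lra.
  have n0 : 0 < nm (rho (c t).1) by lra.
  split.
    rewrite lerBlDl -lnM ?posrE //; rewrite ler_ln ?posrE ?mulr_gt0 //.
  rewrite addrC -lnM ?posrE //; rewrite ler_ln ?posrE ?mulr_gt0 //.
rewrite /phi_norm; case: xgetP => [_ -> [c lc ->]|none].
  have [k1 k2] := key c lc; have [c0 oc] := lc.
  have n1 : 0 <= ln (nm (rho (c t).1)) by apply/ln_ge0/nm_sl2; exact: rep_det.
  split; first lra.
    by move=> N N0 H; have := H c c0 oc; lra.
  by move=> N _ H; have := H c c0 oc; lra.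
rewrite ln1; split; first lra.
  by move=> N N0 _; lra.
move=> N [c oc c0] _; exfalso; apply: (none (transport_opnorm m (c 0) (c t))).
by exists c.
Qed.

(** An upper bound suffices: matrices of determinant 1 have norm at least 1, so the mean is bounded
    below by a constant over t. *)
Lemma zero_exponent theta :
  (forall e : R, 0 < e -> exists C : R, forall t x c, 0 <= t -> cell x -> c 0 = (1%g, x) ->
     orb gen_a gen_b theta.1 theta.2 t c -> ln (nm (rho (c t).1)) <= e * t + C) ->
  lyapunov_exponent m theta 0%E.
Proof.
move=> H; have [a a0 Ha] := phi_log_bound.
have bnd e : 0 < e -> exists2 C : R, 0 <= C & forall t, 0 < t ->
  mean_log_norm m theta t \is a fin_num /\ `|fine (mean_log_norm m theta t)| <= e + C / t.
  move=> e0; have [C HC] := H e e0.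
  pose C' := `|C| + a; have C'0 : 0 <= C' by rewrite addr_ge0.
  exists C' => // t t0.
  have b0 : 0 <= e * t + C' by rewrite addr_ge0 // mulr_ge0 // ltW.
  have hb x : cell x -> - a <= ln (phi_norm m theta t x) <= e * t + C'.
    move=> cx; have [h1 h2 _] := Ha theta t x (ltW t0) cx; rewrite h1 /=.
    have := h2 (e * t + `|C|); rewrite addrA; apply; first by rewrite addr_ge0 // mulr_ge0 // ltW.
    move=> c c0 oc; apply: (le_trans (HC t x c (ltW t0) cx c0 oc)).
    by rewrite lerD2l ler_norm.
  have /andP[] := int_bounds a0 b0 hb.
  set I := integral _ _ _ => I1 I2.
  have fI : I \is a fin_num.
    by rewrite fin_numElt (lt_le_trans _ I1) ?ltNyr // (le_lt_trans I2) // ltry.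
  have mE : mean_log_norm m theta t = (t^-1 * fine I)%:E.
    by rewrite EFinM fineK.
  rewrite mE; split => //=.
  rewrite -(fineK fI) !lee_fin in I1 I2.
  have ti : 0 < t^-1 by rewrite invr_gt0.
  rewrite normrM (gtr0_norm ti) mulrC ler_pdivrMr // mulrDl divfK ?gt_eqF //.
  have et : 0 <= e * t by rewrite mulr_ge0 // ltW.
  rewrite ler_norml I2 andbT; apply: le_trans I1; rewrite lerN2 /C'.
  by have := normr_ge0 C; lra.
apply/fine_cvgP; split.
  have [C _ HC] := bnd 1 ltr01.
  apply: filterS (nbhs_pinfty_gt (num_real (0 : R))) => t t0; exact: (HC t t0).1.
apply/cvgrPdist_le => e e0; have e2 : 0 < e / 2 by rewrite divr_gt0.
have [C C0 HC] := bnd _ e2.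
apply: filterS (nbhs_pinfty_gt (num_real (2 * C / e + 1))) => t ht.
have p0 : 0 <= 2 * C / e by rewrite divr_ge0 ?mulr_ge0 // ltW.
have t0 : 0 < t by lra.
rewrite /= sub0r normrN; apply: (le_trans (HC t t0).2).
suff : C / t <= e / 2 by lra.
rewrite ler_pdivrMr //.
have : 2 * C / e * e <= t * e by rewrite ler_wpM2r ?(ltW e0) //; lra.
by rewrite divfK ?gt_eqF //; lra.
Qed.

(** Almost every starting point has an orbit, and the linear lower bound there contradicts
    convergence to 0 at a single large time. *)
Lemma nonzero_exponent theta : theta <> (0, 0) ->
  (exists2 e : R, 0 < e & exists C : R, forall t x c, 0 <= t -> cell x -> c 0 = (1%g, x) ->
     orb gen_a gen_b theta.1 theta.2 t c -> e * t - C <= ln (nm (rho (c t).1))) ->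
  ~ lyapunov_exponent m theta 0%E.
Proof.
move=> th0 [e e0 [C HC]] /fine_cvgP[fin cv]; have [a a0 Ha] := phi_log_bound.
have pq : (theta.2, - theta.1) <> (0, 0).
  by move=> [h1 /eqP]; rewrite oppr_eq0 => /eqP h2; apply: th0; rewrite [theta]surjective_pairing h1 h2.
have [N [mN N0 HN]] := lattice_lines_null pq.
have e2 : 0 < e / 2 by rewrite divr_gt0.
have [T HT] : exists T : R, forall t, T < t -> `|fine (mean_log_norm m theta t)| < e / 2 /\
    mean_log_norm m theta t \is a fin_num.
  move/cvgrPdist_lt: cv => /(_ _ e2) cv.
  have [M [_ HM]] : \forall t \near +oo, `|0 - fine (mean_log_norm m theta t)| < e / 2 /\
    mean_log_norm m theta t \is a fin_num by apply: filterI.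
  by exists M => t /HM; rewrite sub0r normrN.
pose D := `|C| + 2 * a + 1.
have D0 : 0 < D by rewrite ltr_wpDl // addr_ge0 // mulr_ge0.
(* Beyond [T], and so large that half of e t absorbs the constants. *)
pose t := Num.max 0 T + 2 * D / e + 1.
have m1 : 0 <= Num.max 0 T by rewrite le_max lexx.
have m2 : T <= Num.max 0 T by rewrite le_max lexx orbT.
have p0 : 0 < 2 * D / e by rewrite divr_gt0 // mulr_gt0.
have t0 : 0 < t by rewrite /t; lra.
have tT : T < t by rewrite /t; lra.
have tD : 2 * D <= t * e.
  have : 2 * D / e * e <= t * e by rewrite ler_wpM2r ?(ltW e0) // /t; lra.
  by rewrite divfK // gt_eqF.
have b0 : 0 <= e * t - `|C| - a by rewrite /D in tD; have := normr_ge0 C; lra.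
have hl x : cell x -> - a <= ln (phi_norm m theta t x).
  by move=> cx; case: (Ha theta t x (ltW t0) cx).
have hb x : cell x -> ~ N x -> e * t - `|C| - a <= ln (phi_norm m theta t x).
  move=> cx nN.
  have [_ _ h] := Ha theta t x (ltW t0) cx.
  apply: h; last first.
    move=> c c0 oc; apply: le_trans (HC t x c (ltW t0) cx c0 oc).
    by rewrite lerD2l lerN2 ler_norm.
  apply: orb_exists (ltW t0) => // s st; apply/cell_frac => -[f1 f2]; apply: nN.
  apply: (HN x (Num.floor (x.1 + s * theta.1)) (Num.floor (x.2 + s * theta.2))).
  have -> : (Num.floor (x.1 + s * theta.1))%:~R = x.1 + s * theta.1 by move: f1; rewrite /frac; lra.
  have -> : (Num.floor (x.2 + s * theta.2))%:~R = x.2 + s * theta.2 by move: f2; rewrite /frac; lra.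
  ring.
have I1 := int_lower a0 b0 mN N0 hl hb.
have [h1 h2] := HT t tT; move: h1.
rewrite ltNge => /negP; apply; apply: le_trans (ler_norm _).
have ti : 0 < t^-1 by rewrite invr_gt0.
rewrite -lee_fin fineK //.
apply: (@le_trans _ _ (t^-1%:E * (e * t - `|C| - a - a)%:E)%E); last first.
  by apply: lee_wpmul2l => //; rewrite lee_fin ltW.
rewrite -EFinM lee_fin ler_pdivlMl //.
by rewrite /D in tD; have := normr_ge0 C; lra.
Qed.

End Exponent.

(** * Reflections in three disjoint circles *)

Inductive idx := I1 | I2 | I3.

Section HexagonMap.
Variable R : realType.
Variables c r : idx -> R.
Hypothesis r_gt0 : forall k, 0 < r k.
Hypothesis sorted12 : c I1 + r I1 < c I2 - r I2.
Hypothesis sorted23 : c I2 + r I2 < c I3 - r I3.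

(* The fraction of the interval of center [c k] and radius [r k] to the left of
   [x]. *)
Definition clamp k (x : R) : R :=
  (`|x - c k + r k| - `|x - c k - r k| + 2 * r k) / (4 * r k).

Definition height k (x : R) : R := Num.sqrt (r k ^+ 2 - (x - c k) ^+ 2).
(** The discs are disjoint, so at most one term is nonzero; the graph bounds from below the region
    above the half-discs. *)
Definition ht (x : R) : R := height I1 x + height I2 x + height I3 x.

Lemma clampE k (x : R) : [/\ x <= c k - r k -> clamp k x = 0, c k + r k <= x -> clamp k x = 1 &
  c k - r k <= x <= c k + r k -> clamp k x = (x - c k + r k) / (2 * r k)].
Proof.
have r0 := r_gt0 k; have rn : r k != 0 by rewrite gt_eqF.
rewrite /clamp; split.
- by move=> h; rewrite !ler0_norm; lra.
- by move=> h; rewrite !ger0_norm; try lra; field.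
- by move=> /andP[h1 h2]; rewrite ger0_norm ?ler0_norm; try lra; field.
Qed.

Lemma clamp01 k (x : R) : 0 <= clamp k x <= 1.
Proof.
have r0 := r_gt0 k; have [h1 h2 h3] := clampE k x.
have [/h1 ->|x1] := leP x (c k - r k); first by rewrite lexx ler01.
have [/h2 ->|x2] := leP (c k + r k) x; first by rewrite lexx ler01.
have r2 : 0 < 2 * r k by lra.
rewrite h3; last by apply/andP; split; lra.
by apply/andP; split; [apply: divr_ge0|rewrite ler_pdivrMr //]; lra.
Qed.

Lemma clamp_in k (x : R) : c k - r k < x < c k + r k -> 0 < clamp k x < 1.
Proof.
move=> /andP[x1 x2]; have r0 := r_gt0 k; have [_ _ h3] := clampE k x.
have r2 : 0 < 2 * r k by lra.
rewrite h3; last by apply/andP; split; lra.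
by apply/andP; split; [apply: divr_gt0|rewrite ltr_pdivrMr //]; lra.
Qed.

Lemma clamp_le k (x y : R) : x <= y -> clamp k x <= clamp k y.
Proof.
move=> xy; have r0 := r_gt0 k; have [h1 h2 h3] := clampE k x; have [g1 g2 g3] := clampE k y.
have /andP[y0 y1] := clamp01 k y; have /andP[x0' x1'] := clamp01 k x.
have [/h1 ->|x1] := leP x (c k - r k); first by [].
have [/g2 ->|y2] := leP (c k + r k) y; first by [].
rewrite h3; last by apply/andP; split; lra.
rewrite g3; last by apply/andP; split; lra.
by rewrite ler_pM2r ?invr_gt0 ?mulr_gt0 //; lra.
Qed.

Lemma clamp_lt k (x y : R) : x < y -> c k - r k < x < c k + r k -> clamp k x < clamp k y.
Proof.
move=> xy /andP[x1 x2]; have r0 := r_gt0 k; have [h1 h2 h3] := clampE k x; have [g1 g2 g3] := clampE k y.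
have [/g2 ->|y2] := leP (c k + r k) y.
  by have /andP[] := clamp_in (k := k) (x := x) ltac:(by rewrite x1 x2).
rewrite h3; last by apply/andP; split; lra.
rewrite g3; last by apply/andP; split; lra.
by rewrite ltr_pM2r ?invr_gt0 ?mulr_gt0 //; lra.
Qed.

(** At s = 0 this climbs from -3/2 to 3/2 across the three arcs only, with values -1/2 and 1/2 on
    the two gaps between them. The term s * x makes it strictly increasing at every height s > 0. *)
Definition phi (x s : R) : R := clamp I1 x + clamp I2 x + clamp I3 x - 3 / 2 + s * x.

Definition hexdom (x s : R) : Prop := 0 < s \/ (s = 0 /\ exists k, c k - r k < x < c k + r k).

Lemma phi_lt (x y s : R) : x < y -> hexdom x s -> phi x s < phi y s.
Proof.
move=> xy; rewrite /phi => hE.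
have := (clamp_le I1 (ltW xy), clamp_le I2 (ltW xy), clamp_le I3 (ltW xy)).
move=> [[h1 h2] h3]; case: hE => [s0|[-> [k hk]]].
  by have : s * x < s * y by [rewrite ltr_pM2l]; lra.
by rewrite !mul0r; case: k hk => hk; have := clamp_lt xy hk; lra.
Qed.

(** At s = 0, p / (3/2 - |p|) stretches ]-3/2, 3/2[ onto the line and fixes -1/2 and 1/2; after the
    shift by 1/2 in [psi] the two gaps become the missing points 0 and 1. The maximum with s keeps
    the denominator positive at positive heights. *)
Definition den (p s : R) : R := Num.max (3 / 2 - `|p|) s.
Definition bend (p s : R) : R := p / den p s.

Lemma bend_lt (p q s : R) : 0 <= s -> 0 < den p s -> 0 < den q s -> p < q -> bend p s < bend q s.
Proof.
move=> s0 dp dq pq; rewrite /bend.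
have mono (u v : R) : 0 <= u -> u < v -> 0 < den u s -> 0 < den v s -> u / den u s < v / den v s.
  move=> u0 uv du dv.
  have h : den v s <= den u s.
    rewrite /den !ger0_norm; try lra.
    by rewrite ge_max !le_max lexx orbT andbT; apply/orP; left; lra.
  apply: (@le_lt_trans _ _ (u / den v s)); last by rewrite ltr_pM2r ?invr_gt0.
  by apply: ler_wpM2l => //; rewrite lef_pV2 ?posrE.
have denN u : den (- u) s = den u s by rewrite /den normrN.
have [p0|p0] := leP 0 p; first exact: mono.
have [q0|q0] := leP q 0; last first.
  apply: (@lt_trans _ _ 0); last by rewrite divr_gt0.
  by rewrite ltr_pdivrMr // mul0r.
have : (- q) / den (- q) s < (- p) / den (- p) s.
  by apply: mono; rewrite ?denN //; lra.
by rewrite !denN !mulNr ltrN2.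
Qed.

Lemma den_gt0 (x s : R) : hexdom x s -> 0 < den (phi x s) s.
Proof.
move=> [s0|[-> [k hk]]]; rewrite /den lt_max; first by rewrite s0 orbT.
apply/orP; left; rewrite subr_gt0 /phi mul0r addr0.
have := (clamp01 I1 x, clamp01 I2 x, clamp01 I3 x) => -[[/andP[? ?] /andP[? ?]] /andP[? ?]].
rewrite ltr_norml; have := clamp_in hk.
by case: k hk => hk /andP[? ?]; apply/andP; split; lra.
Qed.

Definition psi (x s : R) : R := 1 / 2 + bend (phi x s) s.

Lemma psi_lt (x y s : R) : x < y -> hexdom x s -> hexdom y s -> psi x s < psi y s.
Proof.
move=> xy ex ey; rewrite /psi ltrD2l; apply: bend_lt; try exact: den_gt0.
  by case: ex => [/ltW|[->]].
exact: phi_lt.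
Qed.

Lemma psi_inj (x y s : R) : hexdom x s -> hexdom y s -> psi x s = psi y s -> x = y.
Proof.
move=> ex ey h; case: (ltgtP x y) => // xy; exfalso.
  by have := psi_lt xy ex ey; rewrite h ltxx.
by have := psi_lt xy ey ex; rewrite h ltxx.
Qed.

Lemma phi_level0 k (x : R) : c k - r k < x < c k + r k ->
  match k with I1 => phi x 0 < - (1 / 2) | I2 => - (1 / 2) < phi x 0 < 1 / 2
  | I3 => 1 / 2 < phi x 0 end.
Proof.
move=> hk; have /andP[k0 k1] := clamp_in hk; rewrite /phi mul0r addr0.
have r1 := r_gt0 I1; have r2 := r_gt0 I2; have r3 := r_gt0 I3.
have s12 := sorted12; have s23 := sorted23.
have [a1 b1 _] := clampE I1 x; have [a2 b2 _] := clampE I2 x; have [a3 b3 _] := clampE I3 x.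
case: k hk k0 k1 => /andP[x1 x2] k0 k1.
- have e2 : clamp I2 x = 0 by apply: a2; lra.
  have e3 : clamp I3 x = 0 by apply: a3; lra.
  by lra.
- have e1 : clamp I1 x = 1 by apply: b1; lra.
  have e3 : clamp I3 x = 0 by apply: a3; lra.
  by apply/andP; split; lra.
- have e1 : clamp I1 x = 1 by apply: b1; lra.
  have e2 : clamp I2 x = 1 by apply: b2; lra.
  by lra.
Qed.

Lemma psi_level0 k (x : R) : c k - r k < x < c k + r k ->
  match k with I1 => psi x 0 < 0 | I2 => 0 < psi x 0 < 1 | I3 => 1 < psi x 0 end.
Proof.
move=> hk; have ex : hexdom x 0 by right; split => //; exists k.
have := den_gt0 ex; have := phi_level0 hk; rewrite /psi /bend; move: (phi x 0) => p lev.
have -> : den p 0 = Num.max (3 / 2 - `|p|) 0 by [].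
case: (leP (3 / 2 - `|p|) 0) => [_|d0 _]; first by rewrite ltxx.
have key (a b : R) : a < b * (3 / 2 - `|p|) -> a / (3 / 2 - `|p|) < b by rewrite ltr_pdivrMr.
have key' (a b : R) : b * (3 / 2 - `|p|) < a -> b < a / (3 / 2 - `|p|) by rewrite ltr_pdivlMr.
case: k lev {hk} => [p0|/andP[p1 p2]|p0].
- suff : p / (3 / 2 - `|p|) < - (1 / 2) by lra.
  by apply: key; rewrite ltr0_norm; lra.
- suff [? ?] : - (1 / 2) < p / (3 / 2 - `|p|) /\ p / (3 / 2 - `|p|) < 1 / 2.
    by apply/andP; split; lra.
  have [h|h] := leP 0 p; [rewrite ger0_norm // in key key' *|rewrite ltr0_norm // in key key' *].
    by split; [apply: key'|apply: key]; lra.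
  by split; [apply: key'|apply: key]; lra.
- suff : 1 / 2 < p / (3 / 2 - `|p|) by lra.
  by apply: key'; rewrite gtr0_norm; lra.
Qed.

Lemma phi_cont (z : R * R) : {for z, continuous (fun z : R * R => phi z.1 z.2)}.
Proof.
have cl k : (fun z : R * R => clamp k z.1) @ z --> clamp k z.1.
  apply: cvgMl; apply: cvgD; last exact: cvg_cst.
  have c1 : (fun z : R * R => z.1 - c k) @ z --> z.1 - c k by apply: cvgB; [exact: cvg_fst|exact: cvg_cst].
  apply: cvgB; apply: cvg_norm; [apply: cvgD|apply: cvgB] => //; exact: cvg_cst.
apply: cvgD.
  by apply: cvgB; [apply: cvgD; [apply: cvgD|]; exact: cl|exact: cvg_cst].
by apply: cvgM; [exact: cvg_snd|exact: cvg_fst].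
Qed.

Lemma psi_cont (z : R * R) : hexdom z.1 z.2 -> {for z, continuous (fun z : R * R => psi z.1 z.2)}.
Proof.
move=> ez; have d0 := den_gt0 ez; apply: cvgD; first exact: cvg_cst.
apply: cvgM; first exact: phi_cont.
apply: cvgV; first by rewrite gt_eqF.
have maxE (a b : R) : Num.max a b = (a + b + `|a - b|) / 2.
  by case: (leP a b) => h; [rewrite ler0_norm|rewrite gtr0_norm]; lra.
rewrite /den maxE.
under eq_fun do rewrite maxE.
have h1 : (fun z : R * R => 3 / 2 - `|phi z.1 z.2|) @ z --> 3 / 2 - `|phi z.1 z.2|.
  by apply: cvgB; [exact: cvg_cst|apply: cvg_norm; exact: phi_cont].
have h2 : (fun z : R * R => z.2) @ z --> z.2 by exact: cvg_snd.
apply: cvgMl; apply: cvgD; first exact: cvgD.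
by apply: cvg_norm; exact: cvgB.
Qed.

Lemma ht_cont (x : R) : {for x, continuous ht}.
Proof.
have h k : height k @ x --> height k x.
  apply: (@continuous_comp _ _ _ (fun x => r k ^+ 2 - (x - c k) ^+ 2) Num.sqrt x).
    apply: cvgB; first exact: cvg_cst.
    have h : (fun x => x - c k) @ x --> x - c k by apply: cvgB; [exact: cvg_id|exact: cvg_cst].
    by under eq_fun do rewrite expr2; rewrite expr2; exact: cvgM.
  exact: sqrt_continuous.
by apply: cvgD; [apply: cvgD|]; exact: h.
Qed.

End HexagonMap.

Section HexagonHomeo.
Variable R : realType.
Variables c r : idx -> R.
Hypothesis r_gt0 : forall k, 0 < r k.
Hypothesis sorted12 : c I1 + r I1 < c I2 - r I2.
Hypothesis sorted23 : c I2 + r I2 < c I3 - r I3.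

Definition above_height (z : R * R) : R := z.2 - ht c r z.1.

Definition outside (z : R * R) : Prop :=
  0 < z.2 /\ forall k, r k ^+ 2 <= (z.1 - c k) ^+ 2 + z.2 ^+ 2.

(* The region outside three disjoint half-discs is a disc with three open arcs on
   its boundary; [hmap] straightens it to the closed upper half-plane minus the
   points 0 and 1. *)
Definition hmap (z : R * R) : R * R :=
  (psi c r z.1 (above_height z), above_height z).

Lemma cont_pair (T : topologicalType) (f g : T -> R) x : {for x, continuous f} ->
  {for x, continuous g} -> {for x, continuous (fun x => (f x, g x))}.
Proof. by move=> hf hg; exact: (cvg_pair hf hg). Qed.

Lemma height_ge0 k (x : R) : 0 <= height c r k x. Proof. exact: sqrtr_ge0. Qed.

Lemma height_in k (x : R) : c k - r k < x < c k + r k ->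
  0 < height c r k x /\ height c r k x ^+ 2 = r k ^+ 2 - (x - c k) ^+ 2.
Proof.
move=> /andP[x1 x2]; have r0 := r_gt0 k.
have p : 0 < r k ^+ 2 - (x - c k) ^+ 2 by nra.
by rewrite /height sqrtr_gt0 p sqr_sqrtr // ltW.
Qed.

Lemma height_out k (x : R) : x <= c k - r k \/ c k + r k <= x -> height c r k x = 0.
Proof.
by move=> h; have r0 := r_gt0 k; apply/eqP; rewrite sqrtr_eq0; case: h => h; nra.
Qed.

Lemma height_sqr k (x : R) : r k ^+ 2 - (x - c k) ^+ 2 <= height c r k x ^+ 2.
Proof.
have [p|p] := leP 0 (r k ^+ 2 - (x - c k) ^+ 2); first by rewrite sqr_sqrtr.
by apply: (le_trans (ltW p)); exact: sqr_ge0.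
Qed.

Lemma htP (x : R) : (exists k, [/\ c k - r k < x < c k + r k, 0 < ht c r x &
    ht c r x = height c r k x]) \/
  ((forall k, ~ (c k - r k < x < c k + r k)) /\ ht c r x = 0).
Proof.
have r1 := r_gt0 I1; have r2 := r_gt0 I2; have r3 := r_gt0 I3.
have s12 := sorted12; have s23 := sorted23.
have [[k hk]|nk] := pselect (exists k, c k - r k < x < c k + r k).
  left; exists k; have [h0 _] := height_in hk.
  suff -> : ht c r x = height c r k x by split.
  rewrite /ht; case: k hk {h0} => /andP[x1 x2].
  - by rewrite (@height_out I2) ?(@height_out I3) ?addr0 //; left; lra.
  - by rewrite (@height_out I1) ?(@height_out I3) ?addr0 ?add0r //; [left|right]; lra.
  - by rewrite (@height_out I1) ?(@height_out I2) ?addr0 ?add0r //; right; lra.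
right; split; first by move=> k hk; apply: nk; exists k.
have ho k : height c r k x = 0.
  apply: height_out; have [h|h] := leP x (c k - r k); first by left.
  by right; rewrite leNgt; apply/negP => h'; apply: nk; exists k; rewrite h h'.
by rewrite /ht !ho !addr0.
Qed.

Lemma height_le k (x : R) : height c r k x <= ht c r x.
Proof.
have := (height_ge0 I1 x, height_ge0 I2 x, height_ge0 I3 x); move=> [[? ?] ?].
by rewrite /ht; case: k; lra.
Qed.

Lemma outside_hexdom z : outside z -> hexdom c r z.1 (above_height z).
Proof.
move=> [y0 hz]; rewrite /above_height /hexdom.
have [[k [hk h0 hE]]|[nk ->]] := htP z.1; last by left; rewrite subr0.
have [_ hsq] := height_in hk; rewrite -hE in hsq.
have : ht c r z.1 <= z.2.
  rewrite -(ler_pXn2r (n := 2)) ?nnegrE ?(ltW h0) ?(ltW y0) // hsq.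
  have := hz k; lra.
rewrite le_eqVlt => /orP[/eqP e|h]; last by left; lra.
by right; split; [lra|exists k].
Qed.

Lemma hexdom_outside (x s : R) : hexdom c r x s -> outside (x, s + ht c r x).
Proof.
move=> ex; have s0 : 0 <= s by case: ex => [/ltW|[->]].
have h0 : 0 <= ht c r x by apply: le_trans (height_le I1 x); exact: height_ge0.
split=> /=.
  case: ex => [s1|[_ [k hk]]]; first lra.
  by have [h1 _] := height_in hk; have := height_le k x; lra.
move=> k; have h1 := height_sqr k x; have h2 := height_le k x; have h3 := height_ge0 k x.
have : height c r k x ^+ 2 <= (s + ht c r x) ^+ 2 by rewrite ler_pXn2r ?nnegrE //; lra.
lra.
Qed.

Lemma hmap_eq (x s : R) : hmap (x, s + ht c r x) = (psi c r x s, s).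
Proof. by rewrite /hmap /above_height /= addrK. Qed.

Lemma hmap_cont z : outside z -> {for z, continuous hmap}.
Proof.
move=> /outside_hexdom ez.
have c1 : (fun z : R * R => z.1) @ z --> z.1 by exact: cvg_fst.
have c2 : above_height @ z --> above_height z.
  apply: cvgB; first exact: cvg_snd.
  exact: (@continuous_comp _ _ _ (fun z : R * R => z.1) (ht c r) z c1 (@ht_cont _ c r z.1)).
have c3 : {for z, continuous (fun z : R * R => (z.1, above_height z))} by exact: cont_pair.
have c4 : {for z, continuous (fun z : R * R => psi c r z.1 (above_height z))}.
  apply: (@continuous_comp _ _ _ (fun z : R * R => (z.1, above_height z))
    (fun w : R * R => psi c r w.1 w.2) z c3).
  exact: (psi_cont r_gt0 (z := (z.1, above_height z))).
exact: (cont_pair c4 c2).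
Qed.

Lemma psi_ivt (a b s X : R) : a <= b -> (forall x, a <= x <= b -> hexdom c r x s) ->
  psi c r a s <= X <= psi c r b s -> exists2 x, a <= x <= b & psi c r x s = X.
Proof.
move=> ab hE /andP[h1 h2].
have [||x xab <-] := @IVT R (fun x => psi c r x s) a b X ab.
- apply: continuous_in_subspaceT => x; rewrite inE /= in_itv /= => xab.
  have c1 : {for x, continuous (fun x : R => (x, s))}.
    by apply: cont_pair; [exact: cvg_id|exact: cvg_cst].
  apply: (@continuous_comp _ _ _ (fun x : R => (x, s)) (fun w : R * R => psi c r w.1 w.2) x c1).
  by apply: (psi_cont r_gt0 (z := (x, s))); exact: hE.
- by rewrite ge_min h1 le_max h2 orbT.
by exists x => //; move: xab; rewrite in_itv.
Qed.

Lemma hmap_inj z w : outside z -> outside w -> hmap z = hmap w -> z = w.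
Proof.
move=> /outside_hexdom ez /outside_hexdom ew; rewrite /hmap => -[h1 h2].
move: ez h1; rewrite h2 => ez h1; have x := psi_inj r_gt0 ez ew h1.
move: h2; rewrite /above_height x => /addIr y.
by rewrite [z]surjective_pairing [w]surjective_pairing x y.
Qed.

Lemma hmap_range z : outside z -> 0 <= (hmap z).2 /\ hmap z <> (0, 0) /\ hmap z <> (1, 0).
Proof.
move=> /outside_hexdom ez; split; first by rewrite /hmap /=; case: ez => [/ltW|[->]].
rewrite /hmap; case: ez => [s0|[-> [k hk]]].
  by split=> -[_ h]; rewrite h ltxx in s0.
have := psi_level0 r_gt0 sorted12 sorted23 hk.
by case: k hk => hk h; split=> -[h']; rewrite h' in h; lra.
Qed.

Lemma hmap_boundary z : outside z -> (hmap z).2 = 0 ->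
  exists k, (z.1 - c k) ^+ 2 + z.2 ^+ 2 = r k ^+ 2.
Proof.
move=> [y0 _] /=; rewrite /above_height => hz.
have [[k [hk h0 hE]]|[_ h]] := htP z.1; last by exfalso; lra.
exists k; have [_ h1] := height_in hk; rewrite -hE in h1.
have -> : z.2 = ht c r z.1 by lra.
by rewrite h1; ring.
Qed.

Lemma phi_level0_surj (p : R) : - (3 / 2) < p -> p < 3 / 2 -> p <> - (1 / 2) -> p <> 1 / 2 ->
  exists k x, c k - r k < x < c k + r k /\ phi c r x 0 = p.
Proof.
move=> p1 p2 ne0 ne1.
have inK k (q : R) : 0 < q < 1 -> exists x, [/\ c k - r k < x < c k + r k, clamp c r k x = q &
    x = c k - r k + 2 * r k * q].
  move=> /andP[q0 q1]; have rk := r_gt0 k.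
  have i1 : 0 < r k * q by rewrite mulr_gt0.
  have i2 : r k * q < r k by rewrite gtr_pMr.
  exists (c k - r k + 2 * r k * q).
  have h : c k - r k < c k - r k + 2 * r k * q < c k + r k by apply/andP; split; lra.
  split => //; have [_ _ ->] := clampE c r_gt0 k (c k - r k + 2 * r k * q).
    by field; lra.
  by case/andP: h => /ltW -> /ltW ->.
have phiE x : phi c r x 0 = clamp c r I1 x + clamp c r I2 x + clamp c r I3 x - 3 / 2.
  by rewrite /phi mul0r addr0.
have r1 := r_gt0 I1; have r2 := r_gt0 I2; have r3 := r_gt0 I3.
have s12 := sorted12; have s23 := sorted23.
have [pa|pa] := ltP p (- (1 / 2)).
  have [|x [hx cx _]] := inK I1 (p + 3 / 2); first by apply/andP; split; lra.
  exists I1, x; split => //; rewrite phiE cx; clear r1 cx.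
  have [aI2 _ _] := clampE c r_gt0 I2 x; rewrite aI2; last by case/andP: hx => ? ?; lra.
  have [aI3 _ _] := clampE c r_gt0 I3 x; rewrite aI3; last by case/andP: hx => ? ?; lra.
  lra.
have pa' : - (1 / 2) < p by rewrite lt_neqAle pa andbT eq_sym; apply/eqP.
have [pb|pb] := ltP p (1 / 2).
  have [|x [hx cx _]] := inK I2 (p + 1 / 2); first by apply/andP; split; lra.
  exists I2, x; split => //; rewrite phiE cx; clear r2 cx.
  have [_ aI1 _] := clampE c r_gt0 I1 x; rewrite aI1; last by case/andP: hx => ? ?; lra.
  have [aI3 _ _] := clampE c r_gt0 I3 x; rewrite aI3; last by case/andP: hx => ? ?; lra.
  lra.
have pb' : 1 / 2 < p by rewrite lt_neqAle pb andbT eq_sym; apply/eqP.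
have [|x [hx cx _]] := inK I3 (p - 1 / 2); first by apply/andP; split; lra.
exists I3, x; split => //; rewrite phiE cx; clear r3 cx.
have [_ aI1 _] := clampE c r_gt0 I1 x; rewrite aI1; last by case/andP: hx => ? ?; lra.
have [_ aI2 _] := clampE c r_gt0 I2 x; rewrite aI2; last by case/andP: hx => ? ?; lra.
lra.
Qed.

Lemma hmap_surj (X Y : R) : 0 <= Y -> (X, Y) <> (0, 0) -> (X, Y) <> (1, 0) ->
  exists2 z, outside z & hmap z = (X, Y).
Proof.
move=> Y0 n0 n1; suff [x ex xE] : exists2 x, hexdom c r x Y & psi c r x Y = X.
  by exists (x, Y + ht c r x); [exact: hexdom_outside|rewrite hmap_eq xE].
have [Yp|Yn] := ltP 0 Y.
  have hE x : hexdom c r x Y by left.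
  have lim (M : R) : psi c r (- M) Y <= 1 / 2 + (3 / 2 - Y * M) / den (phi c r (- M) Y) Y /\
      1 / 2 + (Y * M - 3 / 2) / den (phi c r M Y) Y <= psi c r M Y.
    have bd x : - (3 / 2) + Y * x <= phi c r x Y <= 3 / 2 + Y * x.
      rewrite /phi; have := (clamp01 c r_gt0 I1 x, clamp01 c r_gt0 I2 x, clamp01 c r_gt0 I3 x).
      by move=> [[/andP[? ?] /andP[? ?]] /andP[? ?]]; apply/andP; split; lra.
    have dp x := den_gt0 r_gt0 (hE x).
    split; rewrite /psi lerD2l ler_pM2r ?invr_gt0 //.
      by have := bd (- M); lra.
    by have := bd M; lra.
  (* So large that [den] equals Y at both ends and X lies between the values of [psi] at -M and
     M. *)
  pose M := (3 + Y * `|X - 1 / 2| + Y) / Y.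
  have MY : Y * M = 3 + Y * `|X - 1 / 2| + Y by rewrite mulrC divfK // gt_eqF.
  have aX : 0 <= Y * `|X - 1 / 2| by rewrite mulr_ge0.
  have M0 : 0 <= M by rewrite divr_ge0 // ltW //; lra.
  have dle x : 3 / 2 <= `|phi c r x Y| -> den (phi c r x Y) Y = Y.
    by move=> h; rewrite /den; case: (leP (3 / 2 - `|phi c r x Y|) Y) => // h'; lra.
  have bd x : - (3 / 2) + Y * x <= phi c r x Y <= 3 / 2 + Y * x.
    rewrite /phi; have := (clamp01 c r_gt0 I1 x, clamp01 c r_gt0 I2 x, clamp01 c r_gt0 I3 x).
    by move=> [[/andP[? ?] /andP[? ?]] /andP[? ?]]; apply/andP; split; lra.
  have [l1 l2] := lim M.
  rewrite dle in l1; last first.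
    have /andP[_ h] := bd (- M); rewrite ler0_norm; last by lra.
    by lra.
  rewrite dle in l2; last first.
    have /andP[h _] := bd M; rewrite ger0_norm; last by lra.
    by lra.
  have e1 : (3 / 2 - Y * M) / Y <= - `|X - 1 / 2|.
    by rewrite ler_pdivrMr // MY; lra.
  have e2 : `|X - 1 / 2| <= (Y * M - 3 / 2) / Y.
    by rewrite ler_pdivlMr // MY; lra.
  have := ler_norm (X - 1 / 2); have := ler_norm (- (X - 1 / 2)); rewrite normrN => a1 a2.
  have [|||x _ xE] := @psi_ivt (- M) M Y X; [lra|by []| |by exists x].
  by apply/andP; split; lra.
have Y00 : Y = 0 by lra.
(* On the boundary, p solves bend p 0 = X - 1/2; the two excluded points are those where p would be
   a gap value. *)
rewrite Y00 in n0 n1 *; pose t := X - 1 / 2; pose p := 3 / 2 * t / (1 + `|t|).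
have t1 : 0 < 1 + `|t| by rewrite ltr_wpDr.
have pn : `|p| = 3 / 2 * `|t| / (1 + `|t|).
  by rewrite /p normrM normfV (gtr0_norm t1) normrM (@ger0_norm _ (3 / 2 : R)) //; lra.
have p3 : 3 / 2 - `|p| = 3 / 2 / (1 + `|t|).
  by rewrite pn; field; lra.
have pE : p / (3 / 2 - `|p|) = t.
  by rewrite p3 /p; field; lra.
have p30 : 0 < 3 / 2 - `|p| by rewrite p3 divr_gt0 //; lra.
have fin x : phi c r x 0 = p -> psi c r x 0 = X.
  move=> h; rewrite /psi /bend /den h.
  by case: (leP (3 / 2 - `|p|) 0) => [|_]; [lra|rewrite pE /t; lra].
have absp : - (3 / 2) < p /\ p < 3 / 2.
  have := ler_norm p; have := ler_norm (- p); rewrite normrN => a1 a2.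
  by split; lra.
have ne0 : p <> - (1 / 2).
  move=> h; apply: n0; congr pair; move: pE; rewrite h normrN ger0_norm /t; last lra.
  move=> h'; have : - (1 / 2) / (3 / 2 - 1 / 2) = - (1 / 2) :> R by field.
  lra.
have ne1 : p <> 1 / 2.
  move=> h; apply: n1; congr pair; move: pE; rewrite h ger0_norm /t; last lra.
  move=> h'; have : (1 / 2) / (3 / 2 - 1 / 2) = 1 / 2 :> R by field.
  lra.
have [k [x [hk hx]]] := phi_level0_surj absp.1 absp.2 ne0 ne1.
by exists x; [right; split => //; exists k|exact: fin].
Qed.

(** Openness is relative to the closed half-plane, as the boundary arcs require. At each height near
    that of z, the values of [psi] at x0 - e3 and x0 + e3 enclose X, and the intermediate value
    theorem gives a preimage near z. *)
Lemma hmap_open z (e : R) : outside z -> 0 < e -> exists2 d : R, 0 < d & forall X Y : R,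
  `|X - (hmap z).1| < d -> `|Y - (hmap z).2| < d -> 0 <= Y ->
  exists z', [/\ outside z', `|z'.1 - z.1| < e, `|z'.2 - z.2| < e & hmap z' = (X, Y)].
Proof.
move=> zP e0; have ez := outside_hexdom zP; set x0 := z.1 in ez *; set s0 := above_height z in ez *.
have [e1 e10 He1] : exists2 e1 : R, 0 < e1 & forall x, `|x - x0| < e1 -> `|ht c r x - ht c r x0| < e / 2.
  have /cvgrPdist_lt /(_ (e / 2) ltac:(lra)) := @ht_cont _ c r x0.
  by move=> /nearP_dist[d d0 Hd]; exists d => // x /Hd; rewrite distrC.
have [e2 e20 He2] : exists2 e2 : R, 0 < e2 & forall x s, `|x - x0| <= e2 -> 0 <= s ->
    (s0 = 0 \/ `|s - s0| < e2) -> hexdom c r x s.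
  case: ez => [sp|[s00 [k /andP[k1 k2]]]].
    exists (s0 / 2); first lra.
    move=> x s _ _ [|]; first lra.
    by rewrite ltr_norml => /andP[h _]; left; lra.
  pose m := Num.min (x0 - (c k - r k)) (c k + r k - x0).
  have m0 : 0 < m by rewrite lt_min; apply/andP; split; lra.
  have m1 : m <= x0 - (c k - r k) by rewrite ge_min lexx.
  have m2 : m <= c k + r k - x0 by rewrite ge_min lexx orbT.
  exists (m / 2); first lra.
  move=> x s; rewrite ler_norml => /andP[h1 h2] sp _.
  have [s1|s1] := ltP 0 s; first by left.
  by right; split; [lra|exists k; apply/andP; split; lra].
pose e3 := Num.min (Num.min e1 e2) e / 2.
have e30 : 0 < e3 by rewrite divr_gt0 // !lt_min e10 e20 e0.
have [e31 e32 e33] : [/\ e3 < e1, e3 <= e2 & e3 < e].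
  have a1 : Num.min (Num.min e1 e2) e <= Num.min e1 e2 by rewrite ge_min lexx.
  have a2 : Num.min e1 e2 <= e1 by rewrite ge_min lexx.
  have a3 : Num.min e1 e2 <= e2 by rewrite ge_min lexx orbT.
  have a4 : Num.min (Num.min e1 e2) e <= e by rewrite ge_min lexx orbT.
  by rewrite /e3; split; lra.
have s00 : 0 <= s0 by case: ez => [/ltW|[->]].
have na : `|x0 - e3 - x0| <= e2 by rewrite addrAC subrr add0r normrN gtr0_norm.
have nb : `|x0 + e3 - x0| <= e2 by rewrite addrAC subrr add0r gtr0_norm.
have self : s0 = 0 \/ `|s0 - s0| < e2 by right; rewrite subrr normr0.
have Ea := He2 _ _ na s00 self; have Eb := He2 _ _ nb s00 self.
have la := psi_lt r_gt0 (ltac:(lra) : x0 - e3 < x0) Ea ez.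
have lb := psi_lt r_gt0 (ltac:(lra) : x0 < x0 + e3) ez Eb.
pose g := Num.min (psi c r x0 s0 - psi c r (x0 - e3) s0) (psi c r (x0 + e3) s0 - psi c r x0 s0).
have g0 : 0 < g by rewrite lt_min !subr_gt0 la lb.
have ga : g <= psi c r x0 s0 - psi c r (x0 - e3) s0 by rewrite ge_min lexx.
have gb : g <= psi c r (x0 + e3) s0 - psi c r x0 s0 by rewrite ge_min lexx orbT.
have near_s a : hexdom c r a s0 -> exists2 d : R, 0 < d & forall s, `|s - s0| < d ->
    `|psi c r a s - psi c r a s0| < g / 2.
  move=> ea.
  have c1 : {for s0, continuous (fun s : R => (a, s))}.
    by apply: cont_pair; [exact: cvg_cst|exact: cvg_id].
  have := @continuous_comp _ _ _ (fun s : R => (a, s)) (fun w : R * R => psi c r w.1 w.2)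
    s0 c1 (psi_cont r_gt0 (z := (a, s0)) ea).
  move=> /cvgrPdist_lt /(_ (g / 2) ltac:(lra)) /nearP_dist[d d0 Hd].
  by exists d => // s /Hd; rewrite distrC.
have [d1 d10 Hd1] := near_s _ Ea; have [d2 d20 Hd2] := near_s _ Eb.
exists (Num.min (Num.min (g / 2) (e / 2)) (Num.min e2 (Num.min d1 d2))).
  by rewrite !lt_min d10 d20 e20 !divr_gt0.
move=> X Y; rewrite !lt_min => /andP[/andP[X1 _] _].
move=> /andP[/andP[_ Y1] /and3P[Y2 Y3 Y4]] Y0.
have Xab : psi c r (x0 - e3) Y <= X <= psi c r (x0 + e3) Y.
  have := Hd1 _ Y3; have := Hd2 _ Y4; move: X1; rewrite /= -/x0 -/s0 !ltr_norml.
  clear na nb la lb e30 e31 e32 e33 e10 e20 d10 d20 g0 Y2 Y1 Y0 e0.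
  by move=> /andP[? ?] /andP[? ?] /andP[? ?]; apply/andP; split; lra.
clear X1 Y3 Y4 Hd1 Hd2 d10 d20 ga gb g0 la lb na nb Ea Eb e10 e20 self.
have [|||x /andP[xa xb] xE] := @psi_ivt (x0 - e3) (x0 + e3) Y X; first by clear Y1 Y2; lra.
- move=> x /andP[h1 h2]; apply: He2 => //; last by right.
  by rewrite ler_norml; apply/andP; split; lra.
- exact: Xab.
have ex : hexdom c r x Y.
  by apply: He2 => //; [rewrite ler_norml; apply/andP; split; lra|right].
exists (x, Y + ht c r x); split.
- exact: hexdom_outside.
- by rewrite /= ltr_norml; apply/andP; split; lra.
- have hx : `|x - x0| < e1 by rewrite ltr_norml; apply/andP; split; lra.
  have := He1 _ hx; move: Y1; rewrite /= {1}/above_height -/x0 !ltr_norml.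
  by move=> /andP[? ?] /andP[? ?]; apply/andP; split; lra.
- by rewrite hmap_eq xE.
Qed.

End HexagonHomeo.

(** * Moebius maps and inversions of the half-plane *)

Section Mobius.
Variable R : realType.
Implicit Types (M N : 'M[R]_2) (z : R * R).

Let mn M z := (M 1 0 * z.1 + M 1 1) ^+ 2 + (M 1 0 * z.2) ^+ 2.

Lemma mobius_den_gt0 M z : \det M != 0 -> 0 < z.2 -> 0 < mn M z.
Proof.
rewrite det2E /mn => dM y0.
have [c0|c0] := eqVneq (M 1 0) 0.
  have : M 1 1 != 0 by apply: contraNneq dM => ->; rewrite c0 !mulr0 subrr.
  by rewrite c0 !mul0r add0r expr0n addr0 /= exprn_even_gt0 //= => ->; rewrite orbT.
by rewrite ltr_wpDl ?sqr_ge0 // exprn_even_gt0 //= mulf_neq0 // gt_eqF.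
Qed.

Lemma mobius_gt0 M z : \det M != 0 -> 0 < z.2 -> 0 < (mobius M z).2.
Proof. by move=> dM y0; rewrite divr_gt0 //; exact: mobius_den_gt0. Qed.

Lemma mobiusN M z : mobius (- M) z = mobius M z.
Proof. by rewrite /mobius !mxE; congr (_ / _, _ / _); ring. Qed.

Lemma mobius1 z : mobius 1%:M z = z.
Proof.
rewrite /mobius !scalar2E !mul0r !add0r !mul1r expr1n expr0n /= !addr0 !mulr1 !divr1.
by rewrite mul0r addr0; case: z.
Qed.

(* The formula for [mobius] also makes sense when det M = -1, where it is
   z |-> (a conj z + b) / (c conj z + d). *)
Lemma mobiusM M N z : \det M != 0 -> (\det N) ^+ 2 = 1 -> 0 < z.2 ->
  mobius (M *m N) z = mobius M (mobius N z).
Proof.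
move=> dM dN y0; have dN0 : \det N != 0.
  by apply/eqP => h; move: dN; rewrite h expr0n /= => /eqP; rewrite eq_sym oner_eq0.
have n0 := mobius_den_gt0 dN0 y0.
have dMN : \det (M *m N) != 0 by rewrite det_mulmx mulf_neq0.
have l0 := mobius_den_gt0 dMN y0.
move: dN dM n0 l0; rewrite det2E /mn /mobius /= !mul2E.
case: z y0 {dN0 dMN} => x y /= y0.
move: (M 0 0) (M 0 1) (M 1 0) (M 1 1) (N 0 0) (N 0 1) (N 1 0) (N 1 1) => A B C D a b c d dN _.
set n := (c * x + d) ^+ 2 + (c * y) ^+ 2.
set u := (a * x + b) * (c * x + d) + a * c * y ^+ 2.
set l := (_ + _) ^+ 2 + _ ^+ 2 => n0 l0.
pose m := (a * x + b) ^+ 2 + (a * y) ^+ 2.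
(* The squared modulus of a z + b times the conjugate of c z + d. Its imaginary part is the
   determinant times y, so only the square of the determinant enters. *)
have um : u ^+ 2 + y ^+ 2 = n * m.
  have : u ^+ 2 + (a * d - b * c) ^+ 2 * y ^+ 2 = n * m by rewrite /u /n /m; ring.
  by rewrite dN mul1r.
have n1 : n != 0 by rewrite gt_eqF.
have lE : l = C ^+ 2 * m + 2 * C * D * u + D ^+ 2 * n by rewrite /l /m /u /n; ring.
have mE : (C * (u / n) + D) ^+ 2 + (C * (y / n)) ^+ 2 = l / n.
  have -> : (C * (u / n) + D) ^+ 2 + (C * (y / n)) ^+ 2 =
    (C ^+ 2 * (u ^+ 2 + y ^+ 2) / n + 2 * C * D * u + D ^+ 2 * n) / n by field.
  by rewrite um lE; field.
rewrite mE; have l1 : l != 0 by rewrite gt_eqF.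
congr (_, _); last by field; rewrite n1 l1.
have -> : (A * (u / n) + B) * (C * (u / n) + D) + A * C * (y / n) ^+ 2 =
  (A * C * (u ^+ 2 + y ^+ 2) / n + (A * D + B * C) * u + B * D * n) / n by field.
have -> : (A * C * (u ^+ 2 + y ^+ 2) / n + (A * D + B * C) * u + B * D * n) / n / (l / n) =
  (A * C * (u ^+ 2 + y ^+ 2) / n + (A * D + B * C) * u + B * D * n) / l by field; rewrite n1 l1.
congr (_ / _); rewrite um /m /u /n.
have -> : A * C * (n * ((a * x + b) ^+ 2 + (a * y) ^+ 2)) / n =
   A * C * ((a * x + b) ^+ 2 + (a * y) ^+ 2) by field.
ring.
Qed.

Lemma nbhs2P (z : R * R) (U : set (R * R)) : nbhs z U <->
  exists2 e : R, 0 < e & forall w, `|w.1 - z.1| < e -> `|w.2 - z.2| < e -> U w.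
Proof.
split=> [/nbhs_ballP[e e0 H]|[e e0 H]].
  by exists e => // w h1 h2; apply: H; split; rewrite /ball /= distrC.
by apply/nbhs_ballP; exists e => // w [h1 h2]; apply: H; rewrite distrC.
Qed.

Lemma mobius_cont M z : \det M != 0 -> 0 < z.2 -> {for z, continuous (mobius M)}.
Proof.
move=> dM y0; have n0 := mobius_den_gt0 dM y0.
have c1 : (fun z : R * R => z.1) @ z --> z.1 by exact: cvg_fst.
have c2 : (fun z : R * R => z.2) @ z --> z.2 by exact: cvg_snd.
have lin (a b : R) : (fun z : R * R => a * z.1 + b) @ z --> a * z.1 + b.
  by apply: cvgD; [apply: cvgMr|exact: cvg_cst].
have sq (f : R * R -> R) (l : R) : f @ z --> l -> (fun z => f z ^+ 2) @ z --> l ^+ 2.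
  by move=> h; under eq_fun do rewrite expr2; rewrite expr2; exact: cvgM.
have cn : mn M @ z --> mn M z.
  by apply: cvgD; apply: sq; [exact: lin|exact: cvgMr].
have ci : (fun z => (mn M z)^-1) @ z --> (mn M z)^-1 by apply: cvgV => //; rewrite gt_eqF.
have h1 : (fun z => ((M 0 0 * z.1 + M 0 1) * (M 1 0 * z.1 + M 1 1) + M 0 0 * M 1 0 * z.2 ^+ 2)
    * (mn M z)^-1) @ z --> (mobius M z).1.
  by apply: cvgM => //; apply: cvgD; [exact: cvgM|apply: cvgMr; exact: sq].
have h2 : (fun z => z.2 * (mn M z)^-1) @ z --> (mobius M z).2 by exact: cvgM.
exact: (cvg_pair h1 h2).
Qed.

(** Comparing z with one point straight above it already kills the lower left entry; the other
    entries follow. *)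
Lemma mobius_id_near M z : \det M = 1 -> 0 < z.2 ->
  (\forall w \near z, mobius M w = w) -> M = 1%:M \/ M = - 1%:M.
Proof.
move=> dM y0 /nbhs2P[e e0 H]; have {}dM0 : \det M != 0 by rewrite dM oner_neq0.
have key h : 0 <= h -> h < e -> let w := (z.1, z.2 + h) in
    mn M w = 1 /\ (M 0 0 * w.1 + M 0 1) * (M 1 0 * w.1 + M 1 1) + M 0 0 * M 1 0 * w.2 ^+ 2 = w.1.
  move=> h0 he w; have w0 : 0 < w.2 by rewrite /=; lra.
  have : mobius M w = w by apply: H; rewrite /= ?subrr ?normr0 // addrAC subrr add0r ger0_norm.
  have n0 := mobius_den_gt0 dM0 w0.
  rewrite /mobius -/(mn M w) {5 6}[w]surjective_pairing => -[h1 h2].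
  have n1 : mn M w = 1.
    by move: h2 => /(congr1 (fun s => s * mn M w)); rewrite divfK ?gt_eqF // => h2; nra.
  by split => //; move: h1; rewrite n1 divr1.
have [a1 a2] := key 0 (lexx 0) e0.
have [b1 b2] : _ := key (e / 2) ltac:(lra) ltac:(lra).
move: a1 a2 b1 b2; rewrite /mn /= addr0 => a1 a2 b1 b2.
have c0 : M 1 0 = 0.
  have : M 1 0 ^+ 2 * (z.2 * e + e ^+ 2 / 4) = 0 by lra.
  move/eqP; rewrite mulf_eq0 sqrf_eq0 => /orP[/eqP //|/eqP h].
  by exfalso; have := mulr_gt0 y0 e0; have := sqr_ge0 e; lra.
move: a1 a2 dM; rewrite det2E c0 !mul0r !(add0r, mulr0) expr0n !(mul0r, addr0, subr0) => d1 e1 ad.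
have da : M 1 1 = M 0 0.
  have -> : M 1 1 = M 0 0 * M 1 1 * M 1 1 by rewrite ad mul1r.
  by rewrite -mulrA -expr2 d1 mulr1.
rewrite da in ad e1; have b0 : M 0 1 = 0.
  have /eqP : M 0 0 * M 0 1 = 0 by move: e1; rewrite mulrDl mulrAC ad mul1r; lra.
  rewrite mulf_eq0 => /orP[/eqP h|/eqP //]; move: ad; rewrite h mul0r => /eqP.
  by rewrite eq_sym oner_eq0.
have : (M 0 0 - 1) * (M 0 0 + 1) = 0 by lra.
move/eqP; rewrite mulf_eq0 => /orP[/eqP h|/eqP h]; [left|right];
  by apply: mx2P; rewrite ?mxE ?c0 ?b0 ?da /= ?mulr1n ?mulr0n ?oppr0 //; lra.
Qed.

End Mobius.

Section Reflections.
Variable R : realType.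
Variables c r : idx -> R.
Hypothesis r_gt0 : forall k, 0 < r k.
Hypothesis sorted12 : c I1 + r I1 < c I2 - r I2.
Hypothesis sorted23 : c I2 + r I2 < c I3 - r I3.
Implicit Types (z w : R * R) (k : idx) (ks : seq idx).

Definition power k z : R := (z.1 - c k) ^+ 2 + z.2 ^+ 2.

Definition inv k z : R * R :=
  (c k + r k ^+ 2 * (z.1 - c k) / power k z, r k ^+ 2 * z.2 / power k z).

Definition refl k : 'M[R]_2 :=
  mk2 (c k / r k) ((r k ^+ 2 - c k ^+ 2) / r k) (r k)^-1 (- c k / r k).

Lemma det_refl k : \det (refl k) = -1.
Proof. by have r0 := r_gt0 k; rewrite det2E !mk2E; field; rewrite gt_eqF. Qed.

Lemma pw_gt0 k z : 0 < z.2 -> 0 < power k z.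
Proof. by move=> y0; rewrite ltr_wpDl ?sqr_ge0 // exprn_gt0. Qed.

Lemma invE k z : 0 < z.2 -> mobius (refl k) z = inv k z.
Proof.
move=> y0; have p0 := pw_gt0 k y0; have r0 := r_gt0 k.
rewrite /mobius !mk2E /inv.
have -> : ((r k)^-1 * z.1 + - c k / r k) ^+ 2 + ((r k)^-1 * z.2) ^+ 2 = power k z / r k ^+ 2.
  by rewrite /power; field; rewrite gt_eqF.
have p1 : power k z != 0 by rewrite gt_eqF.
have r1 : r k != 0 by rewrite gt_eqF.
congr (_, _); last by field; rewrite p1 r1.
have -> : c k + r k ^+ 2 * (z.1 - c k) / power k z = (c k * power k z + r k ^+ 2 * (z.1 - c k)) / power k z.
  by field.
rewrite invf_div mulrA; congr (_ / _); rewrite /power; field; exact: r1.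
Qed.

Lemma inv_gt0 k z : 0 < z.2 -> 0 < (inv k z).2.
Proof. by move=> y0; rewrite divr_gt0 ?pw_gt0 ?mulr_gt0 ?exprn_gt0. Qed.

Lemma pw_inv k z : 0 < z.2 -> power k (inv k z) * power k z = r k ^+ 4.
Proof.
move=> y0; have p1 : power k z != 0 by rewrite gt_eqF // pw_gt0.
rewrite {1}/power /inv /= addrAC subrr add0r.
have -> : (r k ^+ 2 * (z.1 - c k) / power k z) ^+ 2 + (r k ^+ 2 * z.2 / power k z) ^+ 2 =
  r k ^+ 4 * ((z.1 - c k) ^+ 2 + z.2 ^+ 2) / power k z ^+ 2 by field.
by rewrite -/(power k z); field.
Qed.

Lemma invK k z : 0 < z.2 -> inv k (inv k z) = z.
Proof.
move=> y0; have p1 : power k z != 0 by rewrite gt_eqF // pw_gt0.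
have r1 : r k != 0 by rewrite gt_eqF.
have h := pw_inv k y0; have {h} h : power k (inv k z) = r k ^+ 4 / power k z by rewrite -h mulfK.
rewrite {1}/inv h /= [RHS]surjective_pairing; congr (_, _); field; rewrite p1 r1 //.
Qed.

Lemma inv_circle k z : power k z = r k ^+ 2 -> inv k z = z.
Proof.
move=> h; have r1 : r k != 0 by rewrite gt_eqF.
rewrite /inv h [RHS]surjective_pairing; congr (_, _); field; exact: r1.
Qed.

Lemma inv_disc k z : 0 < z.2 -> (power k z < r k ^+ 2) = (r k ^+ 2 < power k (inv k z)).
Proof.
move=> y0; have h := pw_inv k y0; have p0 := pw_gt0 k y0.
have r2 : 0 < r k ^+ 2 by rewrite exprn_gt0.
rewrite -[RHS](ltr_pM2r p0) h (_ : r k ^+ 4 = r k ^+ 2 * r k ^+ 2); last by ring.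
by rewrite ltr_pM2l.
Qed.

Lemma inv_cont k z : 0 < z.2 -> {for z, continuous (inv k)}.
Proof.
move=> y0; have d : \det (refl k) != 0 by rewrite det_refl oppr_eq0 oner_neq0.
have h := mobius_cont d y0.
rewrite /prop_for /continuous_at -invE // => V /h.
have /nbhs2P[e e0 H] : nbhs z [set w : R * R | 0 < w.2].
  apply/nbhs2P; exists z.2 => // w _; rewrite ltr_norml => /andP[h1 h2] /=; lra.
move=> /nbhs2P[e' e0' H']; apply/nbhs2P; exists (Num.min e e'); first by rewrite lt_min e0.
move=> w; rewrite !lt_min => /andP[a1 a2] /andP[b1 b2]; have := H' w a2 b2.
by rewrite /= invE //; exact: H.
Qed.

(** The discs lie at positive distance from each other; the uniform factor above 1 is what makes
    repeated inversion terminate. *)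
Lemma gap : exists2 kp : R, 1 < kp & forall i j z, i <> j -> power j z <= r j ^+ 2 ->
  kp * r i ^+ 2 <= power i z.
Proof.
have r1 := r_gt0 I1; have r2 := r_gt0 I2; have r3 := r_gt0 I3.
have s12 := sorted12; have s23 := sorted23.
pose d := Num.min (c I2 - r I2 - (c I1 + r I1)) (c I3 - r I3 - (c I2 + r I2)).
have d0 : 0 < d by rewrite lt_min; apply/andP; split; lra.
have [da db] : d <= c I2 - r I2 - (c I1 + r I1) /\ d <= c I3 - r I3 - (c I2 + r I2).
  by rewrite !ge_min !lexx orbT.
pose s := r I1 + r I2 + r I3; have s0 : 0 < s by rewrite /s; lra.
exists (1 + d / s); first by rewrite ltrDl divr_gt0.
move=> i j z ij hj; have ri := r_gt0 i; have rj := r_gt0 j.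
have sep : r i + r j + d <= `|c i - c j|.
  by case: i j ij {ri rj hj} => -[] // _;
    try (by rewrite ler0_norm; lra); rewrite ger0_norm; lra.
have x1 : `|z.1 - c j| <= r j.
  rewrite -(ler_pXn2r (n := 2)) ?nnegrE ?(ltW rj) // real_normK ?num_real //.
  by apply: le_trans hj; rewrite lerDl sqr_ge0.
have x2 : r i + d <= `|z.1 - c i|.
  have : `|c i - c j| <= `|z.1 - c j| + `|z.1 - c i|.
    have -> : c i - c j = (z.1 - c j) - (z.1 - c i) by ring.
    exact: ler_normB.
  lra.
have ds : d / s * r i <= d.
  rewrite mulrAC ler_pdivrMr // ler_pM2l // /s; case: i {ij ri sep x2} => /=; lra.
have ds0 : 0 < d / s by rewrite divr_gt0.
have h : (1 + d / s) * r i <= `|z.1 - c i| by lra.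
have : ((1 + d / s) * r i) ^+ 2 <= (z.1 - c i) ^+ 2.
  rewrite -(real_normK (num_real (z.1 - c i))) ler_pXn2r ?nnegrE //.
  by rewrite mulr_ge0 ?(ltW ri) //; lra.
have := sqr_ge0 z.2; rewrite /power; set q := d / s in ds0 *.
have : 0 <= q * r i ^+ 2 by rewrite mulr_ge0 ?sqr_ge0 // ltW.
have : 0 <= (q * r i) ^+ 2 by rewrite sqr_ge0.
lra.
Qed.

Lemma disc_disjoint i j z : power i z <= r i ^+ 2 -> power j z <= r j ^+ 2 -> i = j.
Proof.
move=> hi hj; have [//|ij] := pselect (i = j); exfalso; have [kp k1 H] := gap.
have := H i j z ij hj; have : 0 < r i ^+ 2 by rewrite exprn_gt0.
nra.
Qed.

Lemma circle_disjoint i j z : power i z = r i ^+ 2 -> power j z <= r j ^+ 2 -> i = j.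
Proof. by move=> h; apply: disc_disjoint; rewrite h. Qed.

Definition flip (p : R * R) : R * R := (p.1, - p.2).

Definition flipn (b : bool) (p : R * R) := if b then flip p else p.

Lemma flipK : involutive flip. Proof. by case=> x y; rewrite /flip /= opprK. Qed.

Lemma flipnN b p : flipn (~~ b) p = flip (flipn b p).
Proof. by case: b; rewrite //= flipK. Qed.

Lemma flip_cont p : {for p, continuous flip}.
Proof.
have h1 : (fun p : R * R => p.1) @ p --> p.1 by exact: cvg_fst.
have h2 : (fun p : R * R => - p.2) @ p --> - p.2 by apply: cvgN; exact: cvg_snd.
exact: (cvg_pair h1 h2).
Qed.

(* [red z w b]: [w] is obtained from [z] by inverting repeatedly in the disc that
   contains the point, until it leaves the three discs; [b] is the parity of the
   number of steps. *)
Inductive red : R * R -> R * R -> bool -> Prop :=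
| red_out z : outside c r z -> red z z false
| red_in k z w b : 0 < z.2 -> power k z < r k ^+ 2 -> red (inv k z) w b -> red z w (~~ b).

Lemma red_outside z w b : red z w b -> outside c r w.
Proof. by elim. Qed.

Lemma outsideP z : 0 < z.2 -> outside c r z \/ exists k, power k z < r k ^+ 2.
Proof.
move=> y0; have [h|h] := pselect (exists k, power k z < r k ^+ 2); [by right|left].
by split=> // k; rewrite leNgt; apply/negP => hk; apply: h; exists k.
Qed.

Lemma red_fun z w b w' b' : red z w b -> red z w' b' -> w = w' /\ b = b'.
Proof.
move=> h; elim: h w' b' => {z w b} [z [y0 hz]|k z w b y0 hk _ IH] w' b' h; move: h.
  move E : z => z0 h; case: h E => [//|k ? ? ? _ hk _ E]; subst z.
  by have := hz k; rewrite leNgt -/(power k _) hk.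
move E : z => z0 h; case: h E => [? [_ hz] E|k' ? ? ? _ hk' h E]; subst z.
  by have := hz k; rewrite leNgt -/(power k _) hk.
have kk := disc_disjoint (ltW hk) (ltW hk'); subst k'.
by have [-> ->] := IH _ _ h.
Qed.

(** An inversion that lands in another disc multiplies the height by at least [kp], and no disc
    reaches above the sum of the radii. *)
Lemma red_total z : 0 < z.2 -> exists w b, red z w b.
Proof.
have r1 := r_gt0 I1; have r2 := r_gt0 I2; have r3 := r_gt0 I3.
have [kp k1 H] := gap; pose s := r I1 + r I2 + r I3.
have base z' : 0 < z'.2 -> s <= z'.2 -> outside c r z'.
  move=> y0 hs; split=> // k.
  have : r k ^+ 2 <= z'.2 ^+ 2.
    rewrite ler_pXn2r ?nnegrE ?(ltW (r_gt0 k)) ?(ltW y0) //.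
    by apply: le_trans hs; rewrite /s; case: k; lra.
  have := sqr_ge0 (z'.1 - c k); lra.
suff main n : forall z, 0 < z.2 -> s <= kp ^+ n * z.2 -> exists w b, red z w b.
  move=> y0; have [n /ltW hn] := expr_unbounded (s / z.2) k1.
  by apply: (main n) => //; rewrite -ler_pdivrMr.
elim: n => [|n IH] z' y0 hs.
  by exists z', false; constructor; apply: base => //; rewrite expr0 mul1r in hs.
have [h|[k hk]] := outsideP y0; first by exists z', false; constructor.
have y1 := inv_gt0 k y0.
suff [w [b hw]] : exists w b, red (inv k z') w b by exists w, (~~ b); exact: red_in hw.
have [h|[j hj]] := outsideP y1; first by exists (inv k z'), false; constructor.
apply: IH => //; apply: le_trans hs _.
have kj : k <> j.
  move=> kj; subst j; have := inv_disc k y0; rewrite hk => /esym h.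
  by have := lt_trans h hj; rewrite ltxx.
have h1 := H k j _ kj (ltW hj); have p0 := pw_gt0 k y0.
rewrite exprSr -mulrA ler_pM2l ?exprn_gt0 ?(lt_trans ltr01) //.
have -> : (inv k z').2 = r k ^+ 2 * z'.2 / power k z' by [].
rewrite ler_pdivlMr //.
have h2 := pw_inv k y0; have r0 : 0 < r k ^+ 2 by rewrite exprn_gt0.
have : kp * power k z' <= r k ^+ 2.
  rewrite -(ler_pM2l r0) mulrA [r k ^+ 2 * kp]mulrC.
  rewrite (_ : r k ^+ 2 * r k ^+ 2 = r k ^+ 4); last by ring.
  by rewrite -h2 ler_pM2r.
by move=> h3; rewrite mulrAC ler_pM2r.
Qed.

End Reflections.

(** * The folding map and its fibres *)

Section Folding.
Variable R : realType.
Variables c r : idx -> R.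
Hypothesis r_gt0 : forall k, 0 < r k.
Hypothesis sorted12 : c I1 + r I1 < c I2 - r I2.
Hypothesis sorted23 : c I2 + r I2 < c I3 - r I3.
Implicit Types (z w : R * R) (k : idx) (ks : seq idx).
Local Notation pw := (power c).
Local Notation inv := (inv c r).
Local Notation red := (red c r).
Local Notation outside := (outside c r).
Local Notation hmap := (hmap c r).
Local Notation refl := (refl c r).

(** The region outside the discs goes to the upper half-plane and its mirror images alternately to
    the lower and the upper one: two hexagons glued along three arcs. *)
Definition fold z : R * R :=
  xget (0, 0) [set p | exists w b, red z w b /\ p = flipn b (hmap w)].

Lemma foldE z w b : red z w b -> fold z = flipn b (hmap w).
Proof.
move=> h; apply: xget_unique; first by exists w, b.
by move=> p [w' [b' [h' ->]]]; have [-> ->] := red_fun r_gt0 sorted12 sorted23 h h'.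
Qed.

Lemma hmap_circle k z : outside z -> pw k z = r k ^+ 2 -> (hmap z).2 = 0.
Proof.
move=> hz h; have ez := outside_hexdom r_gt0 sorted12 sorted23 hz.
have s0 : 0 <= above_height c r z by case: ez => [/ltW|[->]].
have y0 := hz.1; have hk := height_le c r k z.1.
apply/eqP; rewrite eq_le s0 andbT /above_height subr_le0; apply: le_trans hk.
rewrite /height -h /pw addrAC subrr add0r sqrtr_sqr; exact: ler_norm.
Qed.

Lemma circle_outside k z : 0 < z.2 -> pw k z = r k ^+ 2 -> outside z.
Proof.
move=> y0 h; split => // j; rewrite -/(pw j z) leNgt; apply/negP => hj.
have kj := circle_disjoint r_gt0 sorted12 sorted23 h (ltW hj).
by subst j; rewrite h ltxx in hj.
Qed.

Lemma flip_id (p : R * R) : p.2 = 0 -> flip p = p.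
Proof. by case: p => x y /= ->; rewrite /flip /= oppr0. Qed.

(** Inside the circle this is a reduction step, outside it follows because inversion is an
    involution, and on the circle the value of [hmap] is real. *)
Lemma fold_inv k z : 0 < z.2 -> fold (inv k z) = flip (fold z).
Proof.
move=> y0; have y1 := inv_gt0 c r_gt0 k y0; case: (ltgtP (pw k z) (r k ^+ 2)) => h.
- have [w [b hw]] := red_total r_gt0 sorted12 sorted23 y1.
  by rewrite (foldE hw) (foldE (red_in y0 h hw)) flipnN flipK.
- have [w [b hw]] := red_total r_gt0 sorted12 sorted23 y0.
  have h' : pw k (inv k z) < r k ^+ 2 by rewrite inv_disc // invK.
  rewrite (foldE hw); rewrite -{1}(invK c r_gt0 k y0) in hw.
  by rewrite (foldE (red_in y1 h' hw)) flipnN.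
- have hz := circle_outside y0 h; rewrite (inv_circle r_gt0 h) (foldE (red_out hz)).
  by rewrite /= flip_id // (hmap_circle hz h).
Qed.

Lemma near_idx (T : topologicalType) (x : T) (P : idx -> T -> Prop) :
  (forall k, \forall w \near x, P k w) -> \forall w \near x, forall k, P k w.
Proof.
move=> H; have H1 := H I1; have H2 := H I2; have H3 := H I3.
by near=> w; case; near: w.
Unshelve. all: by end_near.
Qed.

Lemma near_gt0 z : 0 < z.2 -> \forall w \near z, 0 < w.2.
Proof.
move=> y0; apply/nbhs2P; exists z.2 => // w _; rewrite ltr_norml => /andP[h1 h2]; lra.
Qed.

Lemma pw_cont k z : {for z, continuous (pw k)}.
Proof.
have c1 : (fun z : R * R => z.1 - c k) @ z --> z.1 - c k by apply: cvgB; [exact: cvg_fst|exact: cvg_cst].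
have c2 : (fun z : R * R => z.2) @ z --> z.2 by exact: cvg_snd.
rewrite /prop_for /continuous_at /power expr2 [z.2 ^+ 2]expr2.
by under eq_fun do rewrite !expr2; apply: cvgD; exact: cvgM.
Qed.

(** A nearby point can only have crossed a circle on which z lies, and one inversion puts it back
    strictly outside all discs. *)
Lemma near_outside z : outside z -> \forall w \near z, 0 < w.2 /\
  (outside w \/ exists k, [/\ pw k z = r k ^+ 2, pw k w < r k ^+ 2 &
                           forall j, r j ^+ 2 < pw j (inv k w)]).
Proof.
move=> hz; have y0 := hz.1.
suff H k : \forall w \near z, 0 < w.2 -> pw k w < r k ^+ 2 ->
    pw k z = r k ^+ 2 /\ forall j, r j ^+ 2 < pw j (inv k w).
  have H' := near_idx H; have Hy := near_gt0 y0; near=> w.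
  have w0 : 0 < w.2 by near: w.
  split=> //; have [h|[k hk]] := outsideP c r w0; [by left|right; exists k].
  by have [] : pw k z = r k ^+ 2 /\ forall j, r j ^+ 2 < pw j (inv k w)
    by apply: (near H' w).
have := hz.2 k; rewrite -/(pw k z) le_eqVlt => /orP[/eqP h|h]; last first.
  have h0 : \forall w \near z, r k ^+ 2 < pw k w by exact: cvgr_gt (@pw_cont k z) _ h.
  apply: filterS h0 => w h' _ h''.
  by have := lt_trans h' h''; rewrite ltxx.
have H j : \forall w \near z, 0 < w.2 -> pw k w < r k ^+ 2 -> r j ^+ 2 < pw j (inv k w).
  have [jk|jk] := pselect (k = j).
    by near=> w => w0; rewrite jk inv_disc.
  have lt : r j ^+ 2 < pw j (inv k z).
    rewrite inv_circle // ltNge; apply/negP => hj.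
    exact: jk (circle_disjoint r_gt0 sorted12 sorted23 (esym h) hj).
  have ct : {for z, continuous (pw j \o inv k)}.
    by apply: continuous_comp; [exact: inv_cont|exact: pw_cont].
  have h0 : \forall w \near z, r j ^+ 2 < (pw j \o inv k) w by exact: cvgr_gt ct _ lt.
  by apply: filterS h0.
have H' := near_idx H; near=> w => w0 hw; split=> // j.
by apply: (near H' w).
Unshelve. all: by end_near.
Qed.

Lemma fold_cont z : 0 < z.2 -> {for z, continuous fold}.
Proof.
move=> y0; have [w [b h]] := red_total r_gt0 sorted12 sorted23 y0.
elim: h {y0} => {z w b} [z hz|k z w b y0 hk _ IH].
  have y0 := hz.1; have hc := hmap_cont r_gt0 sorted12 sorted23 hz.
  rewrite /prop_for /continuous_at (foldE (red_out hz)) /= => V hV.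
  have H1 : \forall w \near z, V (hmap w) by exact: hc V hV.
  have H2 := near_outside hz.
  (* Just inside the disc [fold] is the conjugate of [hmap] at the inverted point; at z itself both
     expressions agree. *)
  have H3 k : \forall w \near z, pw k z = r k ^+ 2 -> V (flip (hmap (inv k w))).
    have [e|ne] := pselect (pw k z = r k ^+ 2); last by near=> w.
    have ik := inv_circle r_gt0 e.
    have ct : {for z, continuous (@flip R \o hmap \o inv k)}.
      apply: continuous_comp; first exact: inv_cont.
      by rewrite ik; apply: continuous_comp => //; exact: flip_cont.
    have : nbhs ((@flip R \o hmap \o inv k) z) V.
      by rewrite /= ik flip_id // (hmap_circle hz e).
    move=> /ct h; have h0 : \forall w \near z, V (flip (hmap (inv k w))) by exact: h.
    by apply: filterS h0 => w hw _.
  have H4 := near_idx H3; suff : \forall w \near z, V (fold w) by [].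
  near=> w.
  have : 0 < w.2 /\ (outside w \/ exists k, [/\ pw k z = r k ^+ 2, pw k w < r k ^+ 2 &
     forall j, r j ^+ 2 < pw j (inv k w)])
    by near: w; exact: H2.
  move=> [w0 [hw|[k [e hk ho]]]].
    by rewrite /= (foldE (red_out hw)) /=; apply: (near H1 w).
  have hi : outside (inv k w) by split; [exact: inv_gt0|move=> j; exact: ltW].
  rewrite /= (foldE (red_in w0 hk (red_out hi))) /=.
  by apply: (near H4 w).
have y1 := inv_gt0 c r_gt0 k y0.
have ct : {for z, continuous (@flip R \o fold \o inv k)}.
  apply: continuous_comp; first exact: inv_cont.
  by apply: continuous_comp => //; exact: flip_cont.
rewrite /prop_for /continuous_at -[fold z]flipK -(fold_inv k) // => V /ct H0.
have H1 : \forall w \near z, V (flip (fold (inv k w))) by exact: H0.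
have H2 := near_gt0 y0; suff : \forall w \near z, V (fold w) by [].
near=> v; have v0 : 0 < v.2 by near: v.
rewrite /= -[fold v]flipK -(fold_inv k) //.
by apply: (near H1 v).
Unshelve. all: by end_near.
Qed.

Lemma fold_nbhs z U : 0 < z.2 -> nbhs z U -> nbhs (fold z) (fold @` U).
Proof.
move=> y0; have [w [b h]] := red_total r_gt0 sorted12 sorted23 y0.
elim: h U {y0} => {z w b} [z hz|k z w b y0 hk _ IH] U hU.
  have y0 := hz.1; rewrite (foldE (red_out hz)) /=.
  have [s0 _] := hmap_range r_gt0 sorted12 sorted23 hz.
  have ho e := hmap_open r_gt0 sorted12 sorted23 (e := e) hz.
  have [s1|s1] := ltP 0 (hmap z).2.
    have /nbhs2P[e e0 He] := hU; have [d d0 Hd] := ho _ e0.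
    apply/nbhs2P; exists (Num.min d (hmap z).2); first by rewrite lt_min d0.
    move=> p; rewrite !lt_min => /andP[a1 _] /andP[a2 a3].
    have p0 : 0 <= p.2 by move: a3; rewrite ltr_norml => /andP[? ?]; lra.
    have [z' [q1 b1 b2 E]] := Hd _ _ a1 a2 p0.
    exists z'; first exact: He.
    by rewrite (foldE (red_out q1)) /= E; case: (p).
  have s00 : (hmap z).2 = 0 by apply/eqP; rewrite eq_le s0 s1.
  have [k hk] := hmap_boundary r_gt0 sorted12 sorted23 hz s00.
  have ik := inv_circle r_gt0 hk.
  (* At a boundary point, targets in the closed upper half-plane come from the region itself and
     those below from its image by the inversion fixing z. *)
  have hU' : nbhs z (U `&` (inv k @^-1` U)).
    by apply: filterI => //; apply: inv_cont => //; rewrite ik.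
  have /nbhs2P[e e0 He] := hU'; have [d d0 Hd] := ho _ e0.
  apply/nbhs2P; exists d => // p a1 a2; have [p0|p0] := leP 0 p.2.
    have [z' [q1 b1 b2 E]] := Hd _ _ a1 a2 p0.
    exists z'; first by have [] := He z' b1 b2.
    by rewrite (foldE (red_out q1)) /= E; case: (p).
  have a2' : `|- p.2 - (hmap z).2| < d by move: a2; rewrite s00 !subr0 normrN.
  have [|z' [q1 b1 b2 E]] := Hd _ _ a1 a2'; first by rewrite oppr_ge0 ltW.
  exists (inv k z'); first by have [] := He z' b1 b2.
  by rewrite fold_inv ?q1.1 // (foldE (red_out q1)) /= E /flip /= opprK; case: (p).
have y1 := inv_gt0 c r_gt0 k y0.
have hU1 : nbhs (inv k z) ([set w | 0 < w.2] `&` (inv k @^-1` U)).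
  apply: filterI; first exact: near_gt0.
  by apply: inv_cont => //; rewrite invK.
have /IH := hU1; rewrite fold_inv // => H.
have h0 : \forall p \near fold z, (fold @` ([set w | 0 < w.2] `&` (inv k @^-1` U))) (flip p)
  by exact: (flip_cont (p := fold z) H).
apply: filterS h0 => p /= [w' [w0 Uw] E].
by exists (inv k w') => //; rewrite fold_inv // E flipK.
Qed.

Lemma fold_locally_inj z : 0 < z.2 -> exists2 U, nbhs z U &
  forall w w', U w -> U w' -> fold w = fold w' -> w = w'.
Proof.
move=> y0; have [w [b h]] := red_total r_gt0 sorted12 sorted23 y0.
elim: h {y0} => {z w b} [z hz|k z w b y0 hk _ [U hU HU]].
  have H := near_outside hz; eexists; first exact: H.
  have hin w k : 0 < w.2 -> pw k w < r k ^+ 2 -> (forall j, r j ^+ 2 < pw j (inv k w)) ->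
      outside (inv k w) /\ fold w = flip (hmap (inv k w)).
    move=> w0 hk ho; have hi : outside (inv k w) by split; [exact: inv_gt0|move=> j; exact: ltW].
    by rewrite (foldE (red_in w0 hk (red_out hi))).
  have hinj := hmap_inj r_gt0 sorted12 sorted23.
  have mixed w w' k : outside w -> outside (inv k w') -> (forall j, r j ^+ 2 < pw j (inv k w')) ->
      hmap w = flip (hmap (inv k w')) -> False.
    move=> hw hi ho E; have [s1 _] := hmap_range r_gt0 sorted12 sorted23 hw.
    have [s2 _] := hmap_range r_gt0 sorted12 sorted23 hi.
    have s3 : (hmap (inv k w')).2 = 0 by move: s1; rewrite E oppr_ge0 => s1; apply/eqP; rewrite eq_le s1.
    have [j hj] := hmap_boundary r_gt0 sorted12 sorted23 hi s3.
    by have := ho j; rewrite /power hj ltxx.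
  move=> w w' [w0 [hw|[k [e hk ho]]]] [w0' [hw'|[k' [e' hk' ho']]]].
  - by rewrite (foldE (red_out hw)) (foldE (red_out hw')) /=; exact: hinj.
  - have [hi ->] := hin _ _ w0' hk' ho'; rewrite (foldE (red_out hw)) /= => E.
    by case: (mixed w w' k').
  - have [hi ->] := hin _ _ w0 hk ho; rewrite (foldE (red_out hw')) /= => E.
    by case: (mixed w' w k).
  - have kk : k = k' by apply: (circle_disjoint r_gt0 sorted12 sorted23 e); rewrite e'.
    subst k'.
    have [hi ->] := hin _ _ w0 hk ho; have [hi' ->] := hin _ _ w0' hk' ho'.
    move=> /(congr1 (@flip R)); rewrite !flipK => /(hinj _ _ hi hi') /(congr1 (inv k)).
    by rewrite !invK.
exists ([set w | 0 < w.2] `&` (inv k @^-1` U)).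
  by apply: filterI; [exact: near_gt0|exact: inv_cont].
move=> w1 w2 [y1 U1] [y2 U2] E.
have : inv k w1 = inv k w2 by apply: HU => //; rewrite !fold_inv // E.
by move=> /(congr1 (inv k)); rewrite !invK.
Qed.

Definition iact ks z := foldr inv z ks.
Definition Rw ks := foldr (fun k M => refl k *m M) 1%:M ks.

Lemma iact_gt0 ks z : 0 < z.2 -> 0 < (iact ks z).2.
Proof. by move=> y0; elim: ks => //= k ks; exact: inv_gt0. Qed.

Lemma mobius_Rw ks z : 0 < z.2 -> mobius (Rw ks) z = iact ks z.
Proof.
move=> y0; have d ls : \det (Rw ls) ^+ 2 = 1.
  elim: ls => [|k ls IH] /=; first by rewrite det1 expr1n.
  by rewrite det_mulmx exprMn IH det_refl // mulr1 sqrrN expr1n.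
elim: ks => [|k ks IH] /=; first exact: mobius1.
rewrite mobiusM // ?IH ?invE ?iact_gt0 //.
by rewrite det_refl // oppr_eq0 oner_neq0.
Qed.

Lemma fold_iact ks z : 0 < z.2 -> fold (iact ks z) = flipn (odd (size ks)) (fold z).
Proof.
move=> y0; elim: ks => //= k ks IH.
by rewrite fold_inv ?iact_gt0 // IH flipnN.
Qed.

Lemma iact_rev ks z : 0 < z.2 -> iact (rev ks) (iact ks z) = z.
Proof.
elim: ks => //= k ks IH y0.
by rewrite rev_cons -cats1 /iact foldr_cat /= invK ?iact_gt0 //; exact: IH.
Qed.

Lemma red_iact z w b : red z w b -> exists2 ks, w = iact ks z & odd (size ks) = b.
Proof.
elim=> {z w b} [z _|k z w b _ _ _ [ks -> <-]]; first by exists [::].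
by exists (rcons ks k); rewrite ?size_rcons // /iact -cats1 foldr_cat.
Qed.

(** Equal parities give the same reduced point. Different parities force a real value, hence a
    reduced point on a circle, and inserting the inversion in that circle makes the word even. *)
Lemma fold_eq z w : 0 < z.2 -> 0 < w.2 -> fold z = fold w ->
  exists2 ks, w = iact ks z & ~~ odd (size ks).
Proof.
move=> z0 w0; have [z' [b hz]] := red_total r_gt0 sorted12 sorted23 z0.
have [w' [b' hw]] := red_total r_gt0 sorted12 sorted23 w0.
rewrite (foldE hz) (foldE hw) => E.
have [ks zE bE] := red_iact hz; have [ls wE bE'] := red_iact hw.
have hz' := red_outside hz; have hw' := red_outside hw.
have [s1 _] := hmap_range r_gt0 sorted12 sorted23 hz'.
have [s2 _] := hmap_range r_gt0 sorted12 sorted23 hw'.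
have hinj := hmap_inj r_gt0 sorted12 sorted23 hz' hw'.
have wE2 : w = iact (rev ls) w' by rewrite wE iact_rev.
have [bb|bb] := eqVneq b b'.
  have {}E : z' = w'.
    apply: hinj; move: E; rewrite -bb; case: b {hz hw bE bb} => //= /(congr1 (@flip R)).
    by rewrite !flipK.
  exists (rev ls ++ ks); first by rewrite wE2 -E zE /iact foldr_cat.
  by rewrite size_cat size_rev oddD bE bE' bb addbb.
have E2 : hmap z' = flip (hmap w').
  by move: E bb {bE bE' hz hw}; case: b; case: b' => //= /(congr1 (@flip R)); rewrite ?flipK.
have s3 : (hmap w').2 = 0 by move: s1; rewrite E2 oppr_ge0 => s1; apply/eqP; rewrite eq_le s1.
rewrite flip_id // in E2; have {}E2 := hinj E2.
have [k hk] := hmap_boundary r_gt0 sorted12 sorted23 hw' s3.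
have ik := inv_circle r_gt0 hk.
exists (rev ls ++ k :: ks); first by rewrite wE2 /iact foldr_cat /= -/(iact ks z) -zE E2 ik.
rewrite size_cat size_rev oddD /= bE bE'; by case: b b' bb {hz hw bE bE' E} => -[].
Qed.

Lemma fold_range : fold @` @half_plane R = @pants R.
Proof.
apply/seteqP; split=> [p [z y0 <-]|[X Y] hp].
  have [w [b h]] := red_total r_gt0 sorted12 sorted23 y0; rewrite (foldE h).
  have [_ [h0 h1]] := hmap_range r_gt0 sorted12 sorted23 (red_outside h).
  rewrite /pants /=; case: b h => /= _; last by move=> [].
  by move=> [] /(congr1 (@flip R)); rewrite flipK /flip /= oppr0.
have n0 : (X, Y) <> (0, 0) by move=> h; apply: hp; left.
have n1 : (X, Y) <> (1, 0) by move=> h; apply: hp; right.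
have [Y0|Y0] := leP 0 Y.
  have [z hz E] := hmap_surj r_gt0 sorted12 sorted23 Y0 n0 n1.
  by exists z; [exact: hz.1|rewrite (foldE (red_out hz))].
have [|||z hz E] := hmap_surj r_gt0 sorted12 sorted23 (X := X) (Y := - Y).
- by rewrite oppr_ge0 ltW.
- by move=> [_ h]; move: Y0; rewrite -oppr_gt0 h ltxx.
- by move=> [_ h]; move: Y0; rewrite -oppr_gt0 h ltxx.
exists (inv I1 z); first exact: inv_gt0 hz.1.
by rewrite fold_inv ?hz.1 // (foldE (red_out hz)) /= E /flip /= opprK.
Qed.

(** Up to sign the image of rho is the group of even words in the reflections, whose orbits are the
    fibres of [fold]. *)
Lemma fold_holonomy (rho : free2 -> 'M[R]_2) : sl2_representation rho ->
  (forall g, rho g = 1%:M \/ rho g = - 1%:M -> g = 1%g) ->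
  (forall g, exists2 ks, ~~ odd (size ks) & rho g = Rw ks \/ rho g = - Rw ks) ->
  (forall i j, exists g, rho g = refl i *m refl j \/ rho g = - (refl i *m refl j)) ->
  pants_holonomy rho.
Proof.
move=> [hdet hmul] hf G1 G2; exists fold.
have rho1 : rho 1%g = 1%:M.
  by have := hmul 1%g 1%g; rewrite mulg1 => /(congr1 (mulmx (inv2 (rho 1%g)))); rewrite mulmxA mulV2 ?mul1mx ?hdet.

have G2w n : forall ks, size ks = n.*2 -> exists g, rho g = Rw ks \/ rho g = - Rw ks.
  elim: n => [|n IH] [|i [|j ks]] //=; first by exists 1%g; left; exact: rho1.
  move=> [] /IH[g hg]; have [g' hg'] := G2 i j; exists (g' * g)%g; rewrite hmul mulmxA.
  by case: hg hg' => -> [] ->; rewrite ?(mulmxN, mulNmx) ?opprK; auto.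
have act g z : 0 < z.2 -> fold (mobius (rho g) z) = fold z.
  move=> y0; have [ks ev hks] := G1 g.
  have -> : mobius (rho g) z = iact ks z.
    by rewrite -mobius_Rw //; case: hks => ->; rewrite ?mobiusN.
  by rewrite fold_iact // (negPf ev).
split.
- exact: fold_cont.
- exact: fold_range.
- move=> U oU UH; rewrite openE => p [z Uz <-]; apply: fold_nbhs; first exact: UH.
  exact: open_nbhs_nbhs.
- move=> z w z0 w0; split=> [/(fold_eq z0 w0)[ks -> ev]|[g ->]]; last by rewrite act.
  have [|g hg] := G2w (size ks)./2 ks; first by rewrite -[LHS]odd_double_half (negPf ev).
  by exists g; rewrite -mobius_Rw //; case: hg => ->; rewrite ?mobiusN.
(* If g maps a point of U into U, local injectivity of [fold] makes that point fixed, then all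
   nearby points as well, so rho g is 1 or -1. *)
move=> z z0; have [U hU HU] := fold_locally_inj z0.
exists (U° `&` @half_plane R).
  by apply: filterI; [exact: nbhs_interior|exact: near_gt0].
move=> g g1; apply/seteqP; split=> // w [[Uw w0] [u [Uu u0] E]].
have dg : \det (rho g) != 0 by rewrite hdet oner_neq0.
have uw : u = w by apply: HU; try exact: interior_subset; rewrite -E act.
rewrite -uw in E; case: g1; apply: hf; apply: (@mobius_id_near _ _ u) => //.
have ct := mobius_cont dg u0.
have H1 : \forall u' \near u, U (mobius (rho g) u') by apply: ct; rewrite E.
have H2 : \forall u' \near u, U u' by [].
have H3 := near_gt0 u0; near=> u'.
have u'0 : 0 < u'.2 by near: u'.
by apply: HU; [near: u'|near: u'|rewrite act].
Unshelve. all: by end_near.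
Qed.

End Folding.

(** * Pairs of pants from three reflections *)

Section Pants.
Variable R : realType.
Implicit Types (rho : free2 -> 'M[R]_2) (S : idx -> 'M[R]_2) (P M N : 'M[R]_2).

Lemma pants_conj rho P : \det P = 1 -> (forall g, \det (rho g) = 1) ->
  pants_holonomy (fun g => P *m rho g *m inv2 P) -> pants_holonomy rho.
Proof.
move=> dP hdet [q [q_cont q_range q_open q_orb q_free]].
have dP0 : \det P != 0 by rewrite dP oner_neq0.
have dQ : \det (inv2 P) = 1 by rewrite det_inv2.
have dQ0 : \det (inv2 P) != 0 by rewrite dQ oner_neq0.
have g0 z : half_plane z -> half_plane (mobius P z) by exact: mobius_gt0.
have g1 z : half_plane z -> half_plane (mobius (inv2 P) z) by exact: mobius_gt0.
have PQ z : half_plane z -> mobius P (mobius (inv2 P) z) = z.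
  by move=> hz; rewrite -mobiusM ?dQ ?expr1n // mul2V // mobius1.
have QP z : half_plane z -> mobius (inv2 P) (mobius P z) = z.
  by move=> hz; rewrite -mobiusM ?dP ?expr1n // mulV2 // mobius1.
have cj g z : half_plane z -> mobius (P *m rho g *m inv2 P) (mobius P z) =
    mobius P (mobius (rho g) z).
  move=> hz; have d1 : \det (rho g) ^+ 2 = 1 by rewrite hdet expr1n.
  have d2 : \det (P *m rho g) = 1 by rewrite det_mulmx dP hdet mulr1.
  rewrite mobiusM ?dQ ?expr1n ?d2 ?oner_neq0 // ?QP ?mobiusM //.
  exact: g0.
exists (q \o mobius P); split.
- move=> z hz; apply: continuous_comp; first exact: mobius_cont.
  exact: q_cont (g0 z hz).
- rewrite -q_range; apply/seteqP; split=> [p [z hz <-]|p [z hz <-]].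
    by exists (mobius P z) => //; exact: g0.
  by exists (mobius (inv2 P) z); [exact: g1|rewrite /= PQ].
- move=> U oU UH; rewrite -image_comp; apply: q_open; last first.
    by move=> _ [z /UH hz <-]; exact: g0.
  rewrite openE => _ [z Uz <-]; have hz := UH _ Uz.
  have H1 : \forall w \near mobius P z, U (mobius (inv2 P) w).
    by apply: (mobius_cont dQ0 (g0 _ hz)); rewrite QP //; exact: open_nbhs_nbhs.
  have H2 := near_gt0 (g0 _ hz).
  suff : \forall w \near mobius P z, (mobius P @` U) w by [].
  by apply: filterS2 H1 H2 => w Uw w0; exists (mobius (inv2 P) w); rewrite ?PQ.
- move=> z w hz hw /=; rewrite q_orb; try exact: g0.
  split=> -[g E]; exists g; last by rewrite cj // E.
  rewrite -[LHS]QP // E cj // QP // /half_plane /=.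
  by apply: mobius_gt0 => //; rewrite hdet oner_neq0.
move=> z hz; have [U hU HU] := q_free _ (g0 _ hz).
exists ((mobius P @^-1` U) `&` @half_plane R).
  by apply: filterI; [exact: mobius_cont|exact: near_gt0].
move=> g hg; apply/seteqP; split=> // w [[Uw w0] [u [Uu u0] E]].
have : (U `&` (mobius (P *m rho g *m inv2 P) @` U)) (mobius P w).
  by split=> //; exists (mobius P u) => //; rewrite cj // E.
by rewrite HU.
Qed.

Definition mprod S ks := foldr (fun k M => S k *m M) 1%:M ks.

(** The folding map was built for discs ordered from left to right; permuting the indices reduces to
    that case. *)
Lemma sort3 (c r : idx -> R) : (forall k, 0 < r k) ->
  (forall i j, i <> j -> r i + r j < `|c i - c j|) ->
  exists s t : idx -> idx, [/\ cancel s t, cancel t s,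
    c (s I1) + r (s I1) < c (s I2) - r (s I2) &
    c (s I2) + r (s I2) < c (s I3) - r (s I3)].
Proof.
move=> r0 sep; have r1 := r0 I1; have r2 := r0 I2; have r3 := r0 I3.
have tri i j : i <> j -> c i + r i < c j - r j \/ c j + r j < c i - r i.
  move=> /sep; have [h|h] := leP (c i) (c j); [rewrite ler0_norm|rewrite gtr0_norm]; try lra;
    by move=> ?; [left|right]; lra.
have two i j k : i <> j -> j <> k -> i <> k -> exists s t : idx -> idx, [/\ cancel s t, cancel t s,
    s I1 = i, s I2 = j & s I3 = k].
  move=> ij jk ik; exists (fun x => match x with I1 => i | I2 => j | I3 => k end).
  exists (fun x => if pselect (x = i) then I1 else if pselect (x = j) then I2 else I3).
  split=> // x; first by case: x; do ?case: pselect => //; move=> *; subst.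
  case: pselect => //= xi; case: pselect => //= xj.
  by case: i j k x ij jk ik xi xj => -[] [] [].
have go i j k : i <> j -> j <> k -> i <> k -> c i + r i < c j - r j -> c j + r j < c k - r k ->
    exists s t : idx -> idx, [/\ cancel s t, cancel t s,
    c (s I1) + r (s I1) < c (s I2) - r (s I2) & c (s I2) + r (s I2) < c (s I3) - r (s I3)].
  move=> ij jk ik h1 h2; have [s [t [st ts e1 e2 e3]]] := two _ _ _ ij jk ik.
  by exists s, t; rewrite e1 e2 e3.
have [a|a] := tri I1 I2 ltac:(by []); have [b|b] := tri I2 I3 ltac:(by []);
  have [d|d] := tri I1 I3 ltac:(by []).
- exact: (go I1 I2 I3).
- by exfalso; lra.
- exact: (go I1 I3 I2).
- exact: (go I3 I1 I2).
- exact: (go I2 I1 I3).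
- exact: (go I2 I3 I1).
- by exfalso; lra.
- exact: (go I3 I2 I1).
Qed.

(** Trace 0, determinant -1 and a positive lower left entry characterise [refl] for centre S00 / S10
    and radius 1 / S10; tr (S_i S_j) < -2 then says exactly that the closed discs are disjoint. *)
Lemma reflection_holonomy rho S : sl2_representation rho ->
  (forall g, rho g = 1%:M \/ rho g = - 1%:M -> g = 1%g) ->
  (forall k, [/\ \tr (S k) = 0, \det (S k) = -1 & 0 < S k 1 0]) ->
  (forall i j, i <> j -> \tr (S i *m S j) < -2) ->
  (forall g, exists2 ks, ~~ odd (size ks) & rho g = mprod S ks \/ rho g = - mprod S ks) ->
  (forall i j, exists g, rho g = S i *m S j \/ rho g = - (S i *m S j)) ->
  pants_holonomy rho.
Proof.
move=> rep faith hS htr G1 G2.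
pose r k := (S k 1 0)^-1; pose c k := S k 0 0 / S k 1 0.
have r0 k : 0 < r k by have [_ _ h] := hS k; rewrite invr_gt0.
have SE k : S k = refl c r k.
  have [h1 h2 h3] := hS k; move: h1 h2; rewrite tr2E det2E => h1 h2.
  have e : S k 1 1 = - S k 0 0 by lra.
  have n : S k 1 0 != 0 by rewrite gt_eqF.
  have f : S k 0 1 = (1 - S k 0 0 ^+ 2) / S k 1 0.
    by apply: (mulIf n); rewrite divfK //; move: h2; rewrite e; lra.
  by apply: mx2P; rewrite !mk2E /r /c ?e ?f; field; rewrite ?n.
have sep i j : i <> j -> r i + r j < `|c i - c j|.
  move=> /htr; rewrite !SE tr2E.
  have ri := r0 i; have rj := r0 j; rewrite !mul2E !mk2E => h.
  have {}h : (r i ^+ 2 + r j ^+ 2 - (c i - c j) ^+ 2) / (r i * r j) < -2.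
    by move: h; congr (_ < _); field; rewrite !gt_eqF.
  rewrite ltr_pdivrMr ?mulr_gt0 // in h.
  rewrite -(ltr_pXn2r (n := 2)) ?nnegrE ?normr_ge0 ?addr_ge0 ?(ltW ri) ?(ltW rj) //.
  by rewrite real_normK ?num_real //; lra.
have [s [t [st ts h1 h2]]] := sort3 r0 sep.
have mE ks : Rw (c \o s) (r \o s) (map t ks) = mprod S ks.
  elim: ks => //= k ks ->; rewrite SE; congr (_ *m _).
  by rewrite /refl /= ts.
apply: (@fold_holonomy R (c \o s) (r \o s) _ h1 h2) => //=.
- by move=> g; have [ks e h] := G1 g; exists (map t ks); rewrite ?size_map ?mE.
- by move=> i j; have [g] := G2 (s i) (s j); rewrite !SE => h; exists g.
Qed.

Lemma diag_reflection M : \tr M = 0 -> \det M = -1 ->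
  exists2 T, \det T = 1 & M *m T = T *m mk2 1 0 0 (-1).
Proof.
rewrite tr2E det2E => h1 h2; have e : M 1 1 = - M 0 0 by lra.
have h : M 0 0 ^+ 2 + M 0 1 * M 1 0 = 1 by rewrite e in h2; lra.
have [r0|r0] := eqVneq (M 1 0) 0; last first.
  exists (mk2 (M 0 0 + 1) ((M 0 0 - 1) / (2 * M 1 0)) (M 1 0) (1 / 2)).
    by rewrite det2E !mk2E; field; rewrite r0.
  apply: mx2P; rewrite !mul2E !mk2E ?e.
  - have -> : M 0 1 * M 1 0 = 1 - M 0 0 ^+ 2 by lra.
    by ring.
  - have -> : M 0 1 = (1 - M 0 0 ^+ 2) / M 1 0 by rewrite -h [_ + _ - _]addrAC subrr add0r mulfK.
    by field; rewrite r0.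
  - by ring.
  - by field; rewrite r0.
rewrite r0 mulr0 addr0 in h.
have : (M 0 0 - 1) * (M 0 0 + 1) = 0 by lra.
move/eqP; rewrite mulf_eq0 => /orP[/eqP p|/eqP p].
  have {}p : M 0 0 = 1 by lra.
  exists (mk2 1 (- (M 0 1 / 2)) 0 1); first by rewrite det2E !mk2E; ring.
  by apply: mx2P; rewrite !mul2E !mk2E ?e ?r0 ?p; field.
have {}p : M 0 0 = -1 by lra.
exists (mk2 (M 0 1 / 2) (-1) 1 0); first by rewrite det2E !mk2E; ring.
by apply: mx2P; rewrite !mul2E !mk2E ?e ?r0 ?p; field.
Qed.

Lemma tr_mul2E M N :
  \tr (M *m N) = M 0 0 * N 0 0 + M 0 1 * N 1 0 + (M 1 0 * N 0 1 + M 1 1 * N 1 1).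
Proof. by rewrite tr2E !mul2E. Qed.

(* A point at infinity outside the three discs is moved to infinity. *)
Lemma common_sign S : (forall k, \tr (S k) = 0 /\ \det (S k) = -1) ->
  (forall i j, i <> j -> \tr (S i *m S j) < -2) ->
  exists P (e : R), [/\ \det P = 1, e = 1 \/ e = -1 &
    forall k, 0 < e * (P *m S k *m inv2 P) 1 0].
Proof.
move=> hS htr; have [h1 h2] := hS I1; have [T dT TE] := diag_reflection h1 h2.
pose D k := inv2 T *m S k *m T.
have TT : T *m inv2 T = 1%:M by exact: mul2V.
have DD i j : D i *m D j = inv2 T *m (S i *m S j) *m T.
  by rewrite /D !mulmxA -[_ *m T *m inv2 T]mulmxA TT mulmx1.
have trT M : \tr (inv2 T *m M *m T) = \tr M by rewrite mxtrace_mulC mulmxA TT mul1mx.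
have D1 : D I1 = mk2 1 0 0 (-1) by rewrite /D -mulmxA TE mulmxA mulV2 // mul1mx.
have trD k : D k 1 1 = - D k 0 0.
  by have := trT (S k); rewrite -/(D k) (hS k).1 tr2E; lra.
have detD k : D k 0 1 * D k 1 0 = 1 - D k 0 0 ^+ 2.
  have : \det (D k) = -1 by rewrite !det_mulmx det_inv2 dT (hS k).2 mul1r mulr1.
  by rewrite det2E trD; lra.
have htrD i j : i <> j -> \tr (D i *m D j) < -2 by move=> ij; rewrite DD trT htr.
have p2 : D I2 0 0 < -1 by have := htrD I1 I2; rewrite D1 tr_mul2E !mk2E trD => /(_ ltac:(by [])); lra.
have p3 : D I3 0 0 < -1 by have := htrD I1 I3; rewrite D1 tr_mul2E !mk2E trD => /(_ ltac:(by [])); lra.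
have h23 := htrD I2 I3 ltac:(by []).
have [d2 d3] := (detD I2, detD I3); rewrite tr_mul2E !trD in h23.
set P2 := D I2 0 0 in p2 h23 d2; set P3 := D I3 0 0 in p3 h23 d3.
set q2 := D I2 0 1 in h23 d2; set q3 := D I3 0 1 in h23 d3.
set r2 := D I2 1 0 in h23 d2; set r3 := D I3 1 0 in h23 d3.
have qr2 : q2 * r2 < 0 by rewrite d2; nra.
have qr3 : q3 * r3 < 0 by rewrite d3; nra.
have PP : 1 < P2 * P3 by nra.
(* With opposite signs, q2 r3 and r2 q3 would be positive and so would the trace of the product. *)
have rr : 0 < r2 * r3.
  have n2 : r2 != 0 by apply: contraTneq qr2 => ->; rewrite mulr0 ltxx.
  have n3 : r3 != 0 by apply: contraTneq qr3 => ->; rewrite mulr0 ltxx.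
  rewrite lt_neqAle eq_sym mulf_neq0 //= leNgt; apply/negP => h.
  have a1 : 0 < q2 * r3.
    have : 0 < (q2 * r3) * r2 ^+ 2.
      by rewrite (_ : _ * _ = (q2 * r2) * (r2 * r3)) ?nmulr_rgt0 //; ring.
    by rewrite pmulr_lgt0 // exprn_even_gt0.
  have a2 : 0 < r2 * q3.
    have : 0 < (r2 * q3) * r3 ^+ 2.
      by rewrite (_ : _ * _ = (q3 * r3) * (r2 * r3)) ?nmulr_rgt0 //; ring.
    by rewrite pmulr_lgt0 // exprn_even_gt0.
  lra.
have [e [he e2 e3]] : exists e : R, [/\ e = 1 \/ e = -1, 0 < e * r2 & 0 < e * r3].
  have [h|h] := ltP 0 r2.
    by exists 1; rewrite !mul1r h; split; [left| |rewrite -(pmulr_rgt0 _ h)].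
  have {}h : r2 < 0 by rewrite lt_neqAle h andbT; apply: contraTneq qr2 => ->; rewrite mulr0 ltxx.
  exists (-1); rewrite !mulN1r !oppr_gt0 h; split; [by right|by []|].
  by rewrite -(nmulr_rgt0 _ h).
have ee : e * e = 1 by case: he => ->; rewrite ?mulrNN mulr1.
(* The lower left entry after conjugation by a lower unipotent matrix. The bound on x lets the
   linear term cost at most half of the constant one. *)
have pos p q r' x : p < -1 -> q * r' < 0 -> 0 < e * r' -> 0 < x -> x <= e * r' / (- (4 * p)) ->
    0 < e * (r' + 2 * p * (e * x) - q * (e * x) ^+ 2).
  move=> hp hq hr hx; rewrite ler_pdivlMr; last by lra.
  move=> hx'; have eq0 : 0 < - (e * q).
    rewrite oppr_gt0 -(pmulr_llt0 _ hr).
    have -> : e * q * (e * r') = e * e * (q * r') by ring.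
    by rewrite ee mul1r.
  have a1 : 0 < - (e * q) * x ^+ 2 by rewrite mulr_gt0 // exprn_gt0.
  have -> : e * (r' + 2 * p * (e * x) - q * (e * x) ^+ 2) =
    e * r' + 2 * p * (e * e) * x - (e * e) * (e * q) * x ^+ 2 by ring.
  rewrite ee; lra.
pose x := Num.min (e * r2 / (- (4 * P2))) (e * r3 / (- (4 * P3))).
have x0 : 0 < x by rewrite lt_min !divr_gt0 //; lra.
have x2 : x <= e * r2 / (- (4 * P2)) by rewrite ge_min lexx.
have x3 : x <= e * r3 / (- (4 * P3)) by rewrite ge_min lexx orbT.
exists (mk2 1 0 (e * x) 1 *m inv2 T), e.
have dL : \det (mk2 1 0 (e * x) 1) = 1 by rewrite det2E !mk2E; ring.
have iE : inv2 (mk2 1 0 (e * x) 1 *m inv2 T) = T *m inv2 (mk2 1 0 (e * x) 1).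
  apply/esym/inv2_unique; first by rewrite det_mulmx dL det_inv2 dT mulr1.
  by rewrite !mulmxA -[_ *m inv2 T *m T]mulmxA mulV2 // mulmx1 mul2V.
split => //; first by rewrite det_mulmx dL det_inv2 dT mulr1.
move=> k; have -> : (mk2 1 0 (e * x) 1 *m inv2 T *m S k *m inv2 (mk2 1 0 (e * x) 1 *m inv2 T)) 1 0 =
    D k 1 0 + 2 * D k 0 0 * (e * x) - D k 0 1 * (e * x) ^+ 2.
  rewrite iE !mulmxA -[_ *m inv2 T *m S k]mulmxA -[_ *m (inv2 T *m S k) *m T]mulmxA -/(D k).
  move: (D k) (trD k) => N hN; rewrite !mul2E !mk2E hN; ring.
case: k; [|exact: pos|exact: pos].
rewrite D1 !mk2E; have -> : e * (0 + 2 * 1 * (e * x) - 0 * (e * x) ^+ 2) = 2 * (e * e) * x by ring.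
by rewrite ee; lra.
Qed.

End Pants.

Section Generation.

Definition generates (al be : free2) := forall Q : free2 -> Prop, Q 1%g ->
  (forall x y, Q x -> Q y -> Q (x * y)%g) -> (forall x, Q x -> Q x^-1%g) ->
  Q al -> Q be -> forall g, Q g.

Lemma generates_ab : generates gen_a gen_b.
Proof.
move=> Q Q1 QM QV Qa Qb.
suff H n : forall g, size (word g) = n -> Q g by move=> g; exact: (H _ g erefl).
elim: n => [|n IH] [w hw] /=.
  by move=> /size0nil w0; rewrite (_ : Free2 hw = 1%g) //; apply/val_inj.
case: w hw => [//|l w] hw /= [sw].
have rw : reduced w by exact: path_sorted hw.
have rl : reduced [:: l] by [].
have -> : Free2 hw = (Free2 rl * Free2 rw)%g.
  by apply/val_inj => /=; case: w hw {sw rw} => //= l' w /andP[/negPf -> _].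
apply: QM; last exact: IH.
case: l rl {hw} => -[] [] rl.
- by rewrite (_ : Free2 rl = gen_b^-1)%g; [exact: QV|exact/val_inj].
- by rewrite (_ : Free2 rl = gen_b)%g //; exact/val_inj.
- by rewrite (_ : Free2 rl = gen_a^-1)%g; [exact: QV|exact/val_inj].
- by rewrite (_ : Free2 rl = gen_a)%g //; exact/val_inj.
Qed.

Lemma reach_generates al be : reach al be -> generates al be.
Proof.
elim=> {al be} [|al be _ IH|al be _ IH|al be _ IH].
- exact: generates_ab.
- move=> Q Q1 QM QV Qa Qab; apply: IH => //.
  by rewrite -[be](mulKg al); apply: QM => //; exact: QV.
- by move=> Q Q1 QM QV Qa Qb; apply: IH => //; rewrite -[al]invgK; exact: QV.
- by move=> Q Q1 QM QV Qa Qb; apply: IH.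
Qed.

End Generation.

Section Pants2.
Variable R : realType.
Implicit Types (rho : free2 -> 'M[R]_2) (S : idx -> 'M[R]_2) (P M N : 'M[R]_2).

Lemma pants_of_reflections rho S : sl2_representation rho ->
  (forall g, rho g = 1%:M \/ rho g = - 1%:M -> g = 1%g) ->
  (forall k, \tr (S k) = 0 /\ \det (S k) = -1) ->
  (forall i j, i <> j -> \tr (S i *m S j) < -2) ->
  (forall g, exists2 ks, ~~ odd (size ks) & rho g = mprod S ks \/ rho g = - mprod S ks) ->
  (forall i j, exists g, rho g = S i *m S j \/ rho g = - (S i *m S j)) ->
  pants_holonomy rho.
Proof.
move=> [hdet hmul] faith hS htr G1 G2.
have [P [e [dP he hpos]]] := common_sign hS htr.
have ee : e * e = 1 by case: he => ->; rewrite ?mulrNN mulr1.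
have PV := mul2V dP; have VP := mulV2 dP.
have PVM M N : P *m M *m inv2 P *m (P *m N *m inv2 P) = P *m (M *m N) *m inv2 P.
  by rewrite !mulmxA -[_ *m inv2 P *m P]mulmxA VP mulmx1.
have trP M : \tr (P *m M *m inv2 P) = \tr M by rewrite mxtrace_mulC mulmxA VP mul1mx.
apply: (pants_conj dP hdet).
apply: (@reflection_holonomy R _ (fun k => e *: (P *m S k *m inv2 P))).
- split=> [g|g h]; first by rewrite !det_mulmx det_inv2 hdet dP !mulr1.
  by rewrite hmul PVM.
- move=> g hg; apply: faith; case: hg => /(congr1 (fun M => inv2 P *m M *m P));
    rewrite !mulmxA VP mul1mx -mulmxA VP mulmx1 ?mulmxN ?mulNmx mulmx1 VP; auto.
- move=> k; have [h1 h2] := hS k; split; last by rewrite mxE.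
    by rewrite linearZ /= trP h1 mulr0.
  by rewrite detZ !det_mulmx det_inv2 h2 dP expr2 ee mul1r mulr1 mul1r.
- move=> i j ij; rewrite -scalemxAl -scalemxAr scalerA ee scale1r PVM trP; exact: htr.
- move=> g; have [ks ev h] := G1 g; exists ks => //.
  have mE ls : mprod (fun k => e *: (P *m S k *m inv2 P)) ls =
      e ^+ size ls *: (P *m mprod S ls *m inv2 P).
    elim: ls => [|k ls IH] /=; first by rewrite mulmx1 PV scale1r.
    by rewrite IH -scalemxAl -scalemxAr scalerA PVM exprS.
  rewrite mE -[size ks]odd_double_half (negPf ev) add0n -muln2 mulnC exprM expr2 ee expr1n scale1r.
  by case: h => ->; [left|right]; rewrite // mulmxN mulNmx.
- move=> i j; have [g h] := G2 i j; exists g.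
  rewrite -scalemxAl -scalemxAr scalerA ee scale1r PVM.
  by case: h => ->; [left|right]; rewrite // mulmxN mulNmx.
Qed.

Lemma rep_1 rho : sl2_representation rho -> rho 1%g = 1%:M.
Proof.
move=> [hdet hmul]; have := hmul 1%g 1%g; rewrite mulg1.
by move=> /(congr1 (mulmx (inv2 (rho 1%g)))); rewrite mulmxA mulV2 ?mul1mx.
Qed.

Lemma rep_V rho g : sl2_representation rho -> rho g^-1%g = inv2 (rho g).
Proof.
move=> rep; apply: inv2_unique; first exact: rep.1.
by rewrite -rep.2 mulgV rep_1.
Qed.

Lemma neg_sign (x : R) : 2 < `|x| -> exists e : R, e * e = 1 /\ e * x < -2.
Proof.
have [x0|x0] := leP 0 x; [rewrite ger0_norm //|rewrite ltr0_norm //] => h.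
  by exists (-1); split; lra.
by exists 1; split; lra.
Qed.

(** V, proportional to A B - B A, is the reflection in the common perpendicular of the two axes: V,
    A V and V B all have trace 0. Their pairwise products are A, B and A B up to sign, and the
    negative product of traces permits signs e, f bringing the three traces below -2. *)
Lemma pants_of_traces rho al be : sl2_representation rho ->
  (forall g, rho g = 1%:M \/ rho g = - 1%:M -> g = 1%g) -> generates al be ->
  let A := rho al in let B := rho be in
  2 < `|\tr A| -> 2 < `|\tr B| -> 2 < `|\tr (A *m B)| ->
  \tr A * \tr B * \tr (A *m B) < 0 -> 2 < kap A B -> pants_holonomy rho.
Proof.
move=> rep faith gen A B; set X := \tr A; set Y := \tr B; set Z := \tr (A *m B).
move=> hX hY hZ neg hk; have [dA dB] : \det A = 1 /\ \det B = 1 by split; exact: rep.1.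
have [e [ee eX]] := neg_sign hX; have [f [ff fY]] := neg_sign hY.
have efZ : e * f * Z < -2.
  have lt0 : e * f * Z < 0.
    have p : 0 < (e * X) * (f * Y) by nra.
    rewrite -(pmulr_llt0 _ p).
    have -> : e * f * Z * (e * X * (f * Y)) = (e * e) * (f * f) * (X * Y * Z) by ring.
    by rewrite ee ff !mul1r.
  have : (e * f * Z) ^+ 2 = Z ^+ 2.
    have -> : (e * f * Z) ^+ 2 = (e * e) * (f * f) * Z ^+ 2 by ring.
    by rewrite ee ff !mul1r.
  rewrite -(real_normK (num_real Z)) => sq.
  have h4 : 2 * 2 < `|Z| ^+ 2 by clear -hZ; nra.
  by clear -sq h4 lt0; nra.
pose N := A *m B - B *m A; pose s := Num.sqrt (kap A B - 2).
have s0 : 0 < s by rewrite sqrtr_gt0 subr_gt0.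
have ss : s ^+ 2 = kap A B - 2 by rewrite sqr_sqrtr // subr_ge0 ltW.
pose V := s^-1 *: N.
have trN : \tr N = 0 by rewrite /N tr2E !mxE !sum2; ring.
have detN : \det N = 2 - kap A B.
  pose M := A *m B *m inv2 A *m inv2 B.
  have NE : N = (M - 1%:M) *m (B *m A).
    rewrite mulmxBl mul1mx; congr (_ - _).
    by rewrite /M !mulmxA -[_ *m inv2 B *m B]mulmxA mulV2 // mulmx1 -[_ *m inv2 A *m A]mulmxA mulV2 // mulmx1.
  have dM : \det M = 1 by rewrite !det_mulmx !det_inv2 dA dB !mulr1.
  rewrite NE !det_mulmx dA dB !mulr1 -(fricke dA dB) -/M.
  by move: dM; rewrite tr2E !det2E !mxE /= ?mulr1n ?mulr0n; lra.
have trAN : \tr (A *m N) = 0 by rewrite /N tr_mul2E !mxE !sum2; ring.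
have trNB : \tr (N *m B) = 0 by rewrite /N tr_mul2E !mxE !sum2; ring.
have detV : \det V = -1.
  rewrite detZ detN exprVn ss.
  by rewrite -[2 - _]opprB mulrN mulVf // gt_eqF // subr_gt0.
have trV : \tr V = 0 by rewrite /V linearZ /= trN mulr0.
have VV : V *m V = 1%:M.
  rewrite cayley detV trV scale0r sub0r.
  by apply: mx2P; rewrite !mxE /= ?mulr1n ?mulr0n ?opprK ?oppr0.
pose S k := match k with I1 => e *: (A *m V) | I2 => V | I3 => f *: (V *m B) end.
have S12 : S I1 *m S I2 = e *: A by rewrite /= -scalemxAl -mulmxA VV mulmx1.
have S23 : S I2 *m S I3 = f *: B by rewrite /= -scalemxAr mulmxA VV mul1mx.
have S13 : S I1 *m S I3 = (e * f) *: (A *m B).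
  rewrite /= -scalemxAl -scalemxAr scalerA; congr (_ *: _).
  by rewrite mulmxA -[A *m V *m V]mulmxA VV mulmx1.
have hS k : \tr (S k) = 0 /\ \det (S k) = -1.
  have trAV : \tr (A *m V) = 0 by rewrite -scalemxAr linearZ /= trAN mulr0.
  have trVB : \tr (V *m B) = 0 by rewrite -scalemxAl linearZ /= trNB mulr0.
  case: k; rewrite /S.
  - by rewrite linearZ /= trAV mulr0 detZ expr2 ee mul1r det_mulmx dA mul1r.
  - by [].
  - by rewrite linearZ /= trVB mulr0 detZ expr2 ff mul1r det_mulmx dB mulr1.
have SS k : S k *m S k = 1%:M.
  have [h1 h2] := hS k; rewrite cayley h1 h2 scale0r sub0r.
  by apply: mx2P; rewrite !mxE /= ?mulr1n ?mulr0n ?opprK ?oppr0.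
have htr i j : i <> j -> \tr (S i *m S j) < -2.
  have t12 : \tr (S I1 *m S I2) < -2 by rewrite S12 linearZ.
  have t23 : \tr (S I2 *m S I3) < -2 by rewrite S23 linearZ.
  have t13 : \tr (S I1 *m S I3) < -2 by rewrite S13 linearZ.
  by case: i; case: j => // _; rewrite // mxtrace_mulC.
have sgn (g : R) M T : g * g = 1 -> T = g *: M -> M = T \/ M = - T.
  move=> gg ->; have : (g - 1) * (g + 1) = 0 by lra.
  move/eqP; rewrite mulf_eq0 => /orP[/eqP h|/eqP h].
    by left; rewrite (_ : g = 1) ?scale1r //; lra.
  by right; rewrite (_ : g = -1) ?scaleN1r ?opprK //; lra.
have efef : e * f * (e * f) = 1 by rewrite mulrACA ee ff mulr1.
have RV g M M' : M *m M' = 1%:M -> \det M = 1 -> rho g = M \/ rho g = - M ->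
    rho g^-1%g = M' \/ rho g^-1%g = - M'.
  move=> MM dM; have M'E := inv2_unique dM MM; rewrite (rep_V g rep).
  case=> ->; [by left|right]; rewrite M'E.
  by apply: mx2P; rewrite [RHS]mxE !mk2E mxE.
have dSS i j : \det (S i *m S j) = 1 by rewrite det_mulmx (hS i).2 (hS j).2 mulrNN mulr1.
apply: (@pants_of_reflections rho S rep faith hS htr).
  move=> g; apply: (gen (fun g => exists2 ks, ~~ odd (size ks) & rho g = mprod S ks \/ rho g = - mprod S ks)).
  - by exists [::] => //; left; exact: rep_1.
  - move=> x y [ks ev hx] [ls ev' hy]; exists (ks ++ ls).
      by rewrite size_cat oddD (negPf ev) (negPf ev').
    have -> : mprod S (ks ++ ls) = mprod S ks *m mprod S ls.
      by elim: ks {ev hx} => [|k ks IH] /=; rewrite ?mul1mx // IH mulmxA.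
    by rewrite rep.2; case: hx hy => -> [] ->; rewrite ?(mulmxN, mulNmx) ?opprK; auto.
  - move=> x [ks ev hx]; exists (rev ks); first by rewrite size_rev.
    have [d1 d2] : \det (mprod S ks) = (-1) ^+ odd (size ks) /\ mprod S ks *m mprod S (rev ks) = 1%:M.
      elim: ks {ev hx} => [|k ks [IH1 IH2]] /=; first by rewrite det1 mul1mx.
      rewrite det_mulmx (hS k).2 IH1; split; first by rewrite signrN mulN1r.
      have -> : mprod S (rev (k :: ks)) = mprod S (rev ks) *m S k.
        rewrite rev_cons; elim: (rev ks) => [|j ls IH] /=; first by rewrite /mprod /= mul1mx mulmx1.
        by rewrite IH mulmxA.
      rewrite !mulmxA -[S k *m _ *m _]mulmxA IH2 mulmx1.
      exact: SS.
    by rewrite (negPf ev) expr0 in d1; exact: RV d2 d1 hx.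
  - exists [:: I1; I2] => //; rewrite /mprod /= mulmx1.
    exact: sgn S12.
  - exists [:: I2; I3] => //; rewrite /mprod /= mulmx1.
    exact: sgn S23.
have flip i j : (exists g, rho g = S i *m S j \/ rho g = - (S i *m S j)) ->
    exists g, rho g = S j *m S i \/ rho g = - (S j *m S i).
  move=> [g hg]; exists g^-1%g; apply: RV (dSS i j) hg.
  by rewrite !mulmxA -[S i *m _ *m _]mulmxA SS mulmx1 SS.
have g12 : exists g, rho g = S I1 *m S I2 \/ rho g = - (S I1 *m S I2).
  by exists al; exact: sgn S12.
have g23 : exists g, rho g = S I2 *m S I3 \/ rho g = - (S I2 *m S I3).
  by exists be; exact: sgn S23.
have g13 : exists g, rho g = S I1 *m S I3 \/ rho g = - (S I1 *m S I3).
  by exists (al * be)%g; rewrite rep.2; exact: sgn S13.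
have gkk k : exists g, rho g = S k *m S k \/ rho g = - (S k *m S k).
  by exists 1%g; left; rewrite SS rep_1.
by case; case; try exact: gkk; try assumption; apply: flip.
Qed.

End Pants2.

(** * The spectrum *)

Section Growth.
Variables (R : realType) (rho : free2 -> 'M[R]_2).
Hypothesis rep : sl2_representation rho.
Implicit Types (al be g : free2) (u v t : R).

Definition dir al be u v : R * R :=
  (u * abn R false al + v * abn R false be, u * abn R true al + v * abn R true be).

(** The constant depends neither on the starting point nor on the orbit, so the bound can be
    integrated over the torus; likewise in [fast]. *)
Definition slow (theta : R * R) := forall e : R, 0 < e -> exists C : R, forall t x c,
  0 <= t -> cell x -> c 0 = (1%g, x) -> orb gen_a gen_b theta.1 theta.2 t c ->
  ln (nm (rho (c t).1)) <= e * t + C.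

Definition fast (theta : R * R) := exists2 e : R, 0 < e & exists C : R, forall t x c,
  0 <= t -> cell x -> c 0 = (1%g, x) -> orb gen_a gen_b theta.1 theta.2 t c ->
  e * t - C <= ln (nm (rho (c t).1)).

Lemma nm_rho_ge1 g : 1 <= nm (rho g).
Proof. by apply: nm_sl2; exact: rep.1. Qed.

Lemma nm_rhoV g : nm (rho g^-1%g) = nm (rho g).
Proof. by rewrite rep_V // nm_inv2. Qed.

Lemma rho_evw al be w : rho (evw al be w) = mxw (rho al) (rho be) w.
Proof. by elim: w => [|b w IH] /=; [exact: rep_1|rewrite rep.2 IH; case: b]. Qed.

Lemma rho_max (hs : seq free2) : exists2 K : R, 1 <= K & forall h, h \in hs -> nm (rho h) <= K.
Proof.
elim: hs => [|h hs [K K1 HK]]; first by exists 1.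
exists (K + nm (rho h)); first by have := nm_ge0 (rho h); lra.
by move=> h'; rewrite inE => /orP[/eqP -> |/HK]; [lra|have := nm_ge0 (rho h); lra].
Qed.

(** The transport is a positive word in A and B between two factors from the list of [reach_orb]; K
    absorbs their logarithms for all times at once. *)
Lemma state_word al be u v : reach al be -> 0 <= u -> 0 <= v -> exists K : R,
  forall t x c, 0 <= t -> cell x -> c 0 = (1%g, x) ->
  orb gen_a gen_b (dir al be u v).1 (dir al be u v).2 t c -> exists w,
  [/\ `|ln (nm (rho (c t).1)) - ln (nm (mxw (rho al) (rho be) w))| <= K,
      t * u - 1 < (count negb w)%:R < t * u + 1 & t * v - 1 < (count id w)%:R < t * v + 1].
Proof.
move=> /(@reach_orb R)[hs Hhs] u0 v0; have [K K1 HK] := rho_max hs.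
have Kp : 0 < K by lra.
exists (ln K + ln K) => t x c t0 cx c0 oc.
have [c' oc' Hc'] := Hhs u v t c oc.
have [|w [w1 w2 w3 _]] := orb_word u0 v0 t0 oc' (s := t); first by rewrite t0 lexx.
have cnt (n : nat) (y d : R) : 0 <= y < 1 -> n%:Z = Num.floor (y + d) -> d - 1 < n%:R < d + 1.
  move=> /andP[y0 y1] h; have := floor_itv (y + d); rewrite -h intrD => /andP[h1 h2].
  by rewrite -pmulrn in h1 h2; apply/andP; split; lra.
have [|[_ ] _] := oc' 0; first by rewrite lexx t0.
have [|/cellP[y1 y2 _] _] := oc' 0; first by rewrite lexx t0.
move=> _; exists w; split; [|exact: cnt w2|exact: cnt w3].
have [h0 hh0 E0] := Hc' 0; have [h1 hh1 E1] := Hc' t.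
rewrite c0 mul1g in E0; rewrite {}E0 {}E1 in w1.
have e1 : (c t).1 = (h0 * evw al be w * h1^-1)%g by rewrite -w1 mulgK.
have e2 : evw al be w = (h0^-1 * (c t).1 * h1)%g by rewrite -mulgA w1 mulKg.
have n1 : nm (rho (c t).1) <= K * nm (mxw (rho al) (rho be) w) * K.
  rewrite e1 !rep.2 rho_evw; apply: le_trans (nmM _ _) _.
  apply: ler_pM; rewrite ?nm_ge0 ?nm_rhoV ?HK //.
  by apply: le_trans (nmM _ _) _; rewrite ler_wpM2r ?nm_ge0 ?HK.
have n2 : nm (mxw (rho al) (rho be) w) <= K * nm (rho (c t).1) * K.
  rewrite -rho_evw e2 !rep.2; apply: le_trans (nmM _ _) _.
  apply: ler_pM; rewrite ?nm_ge0 ?HK //.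
  by apply: le_trans (nmM _ _) _; rewrite ler_wpM2r ?nm_ge0 ?nm_rhoV ?HK.
have p1 : 0 < nm (rho (c t).1) by apply: lt_le_trans (nm_rho_ge1 _); lra.
have p2 : 0 < nm (mxw (rho al) (rho be) w).
  by rewrite -rho_evw; apply: lt_le_trans (nm_rho_ge1 _); lra.
have key (x1 x2 : R) : 0 < x1 -> 0 < x2 -> x1 <= K * x2 * K -> ln x1 <= ln x2 + (ln K + ln K).
  move=> a1 a2 h; have : ln x1 <= ln (K * x2 * K) by rewrite ler_ln ?posrE ?mulr_gt0.
  by rewrite !lnM ?posrE ?mulr_gt0 //; lra.
have := key _ _ p1 p2 n1; have := key _ _ p2 p1 n2.
by rewrite ler_norml => ? ?; apply/andP; split; lra.
Qed.

Lemma size_count (w : seq bool) : size w = (count negb w + count id w)%N.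
Proof. by rewrite addnC -(count_predC id). Qed.

Lemma escape_fast al be u v : reach al be -> 2 < kap (rho al) (rho be) ->
  escape (rho al) (rho be) -> 0 <= u -> 0 <= v -> 0 < u + v -> fast (dir al be u v).
Proof.
move=> hr hk he u0 v0 uv.
have [k [d [k1 d0 H]]] := escape_growth (rep.1 al) (rep.1 be) hk he.
have [K HK] := state_word hr u0 v0; have lk : 0 < ln k by rewrite ln_gt0.
exists ((u + v) * ln k); first exact: mulr_gt0.
exists (2 * ln k - ln d + K) => t x c t0 cx c0 oc.
have [w [h1 /andP[h2 _] /andP[h3 _]]] := HK t x c t0 cx c0 oc.
have : ln (d * k ^+ size w) <= ln (nm (mxw (rho al) (rho be) w)).
  rewrite ler_ln ?posrE ?H //; first by rewrite mulr_gt0 // exprn_gt0 //; lra.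
  by apply: lt_le_trans (H w); rewrite mulr_gt0 // exprn_gt0 //; lra.
rewrite lnM ?posrE ?exprn_gt0 //; try lra.
rewrite lnXn; last by lra.
have : (t * (u + v) - 2) * ln k <= ln k *+ size w.
  by rewrite -[X in _ <= X]mulr_natl ler_wpM2r ?(ltW lk) // size_count natrD; lra.
move: h1; rewrite ler_norml => /andP[h1 _]; lra.
Qed.

Lemma mxw_negb (A B : 'M[R]_2) w : count id w = 0%N -> mxw A B w = A ^+ size w.
Proof.
elim: w => [|b w IH] //; case: b => //= h.
by rewrite IH // exprS.
Qed.

Lemma axis_slow al be u : reach al be -> 0 <= u -> `|\tr (rho al)| < 2 -> slow (dir al be u 0).
Proof.
move=> hr u0 htr e e0; have [C HC] := elliptic_bounded (rep.1 al) htr.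
have [K HK] := state_word hr u0 (lexx 0).
exists (ln C + K) => t x c t0 cx c0 oc.
have [w [h1 _ /andP[_ h3]]] := HK t x c t0 cx c0 oc.
(* With v = 0 the number of letters [be] is below 1. *)
have w0 : count id w = 0%N by apply/eqP; rewrite -leqn0 -ltnS -(ltr_nat R); lra.
rewrite (mxw_negb _ _ w0) in h1.
have p : 0 < nm (rho al ^+ size w).
  rewrite -(mxw_negb _ (rho be) w0) -rho_evw.
  by apply: lt_le_trans (nm_rho_ge1 _); lra.
have : ln (nm (rho al ^+ size w)) <= ln C.
  by rewrite ler_ln ?posrE ?HC //; apply: lt_le_trans (HC (size w)).
have et : 0 <= e * t by rewrite mulr_ge0 // ltW.
move: h1; rewrite ler_norml => /andP[_ h1]; lra.
Qed.

Lemma axis_fast al be u : reach al be -> 0 < u -> 2 < `|\tr (rho al)| -> fast (dir al be u 0).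
Proof.
move=> hr u0 htr; have [k [d [k1 d0 H]]] := hyp_growth (rep.1 al) htr.
have [K HK] := state_word hr (ltW u0) (lexx 0); have lk : 0 < ln k by rewrite ln_gt0.
exists (u * ln k); first exact: mulr_gt0.
exists (ln k - ln d + K) => t x c t0 cx c0 oc.
have [w [h1 /andP[h2 _] /andP[_ h3]]] := HK t x c t0 cx c0 oc.
have w0 : count id w = 0%N by apply/eqP; rewrite -leqn0 -ltnS -(ltr_nat R); lra.
rewrite (mxw_negb _ _ w0) in h1.
have : ln (d * k ^+ size w) <= ln (nm (rho al ^+ size w)).
  rewrite ler_ln ?posrE ?H //; first by rewrite mulr_gt0 // exprn_gt0 //; lra.
  by apply: lt_le_trans (H (size w)); rewrite mulr_gt0 // exprn_gt0 //; lra.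
rewrite lnM ?posrE ?exprn_gt0 //; try lra.
rewrite lnXn; last by lra.
have : (t * u - 1) * ln k <= ln k *+ size w.
  by rewrite -[X in _ <= X]mulr_natl ler_wpM2r ?(ltW lk) // size_count w0 addn0; lra.
move: h1; rewrite ler_norml => /andP[h1 _]; lra.
Qed.

(** About t (u + v) letters of norm at most N give a growth rate of at most (u + v) ln N, for each
    basis whose sector contains theta. *)
Lemma word_slow theta : (forall e : R, 0 < e -> exists al be u v N,
    [/\ reach al be, 0 <= u, 0 <= v, theta = dir al be u v &
     [/\ nm (rho al) <= N, nm (rho be) <= N & (u + v) * ln N <= e]]) -> slow theta.
Proof.
move=> H e e0; have [al [be [u [v [N [hr u0 v0 -> [hA hB hN]]]]]]] := H e e0.
have [K HK] := state_word hr u0 v0; have N1 : 1 <= N by apply: le_trans hA; exact: nm_rho_ge1.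
have lN : 0 <= ln N by rewrite ln_ge0.
exists (ln 2 + 2 * ln N + K) => t x c t0 cx c0 oc.
have [w [h1 /andP[_ h2] /andP[_ h3]]] := HK t x c t0 cx c0 oc.
have p : 0 < nm (mxw (rho al) (rho be) w).
  by rewrite -rho_evw; apply: lt_le_trans (nm_rho_ge1 _); lra.
have hw : nm (mxw (rho al) (rho be) w) <= N ^+ size w * 2.
  elim: w {h1 h2 h3 p} => [|b w IH] /=; first by rewrite nm1 expr0 mul1r.
  apply: le_trans (nmM _ _) _; rewrite exprS -mulrA.
  by apply: ler_pM; rewrite ?nm_ge0 //; case: b.
have : ln (nm (mxw (rho al) (rho be) w)) <= ln (N ^+ size w * 2).
  by rewrite ler_ln ?posrE //; apply: lt_le_trans hw.
have N0 : 0 < N by lra.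
rewrite lnM ?posrE ?exprn_gt0 // lnXn //.
have : ln N *+ size w <= (t * (u + v) + 2) * ln N.
  by rewrite -[X in X <= _]mulr_natl ler_wpM2r // size_count natrD; lra.
have : t * ((u + v) * ln N) <= t * e by rewrite ler_wpM2l.
move: h1; rewrite ler_norml => /andP[_ h1]; lra.
Qed.

End Growth.

(** * The subtractive Euclidean algorithm *)

Section Euclid.
Variable R : realType.

Definition estep (p : R * R) : R * R :=
  if p.2 <= p.1 then (p.1 - p.2, p.2) else (p.1, p.2 - p.1).

(* Each run of equal steps ends with s <= 2 m, where m bounds the decrements of s
   and is nonincreasing and summable, whence k m_k -> 0. *)
Lemma euclid_small (p : R * R) :
  (forall k, 0 < (iter k estep p).1 /\ 0 < (iter k estep p).2) ->
  forall (e : R) (K : nat), 0 < e -> exists2 k, (K <= k)%N &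
    k.+1%:R * ((iter k estep p).1 + (iter k estep p).2) < e.
Proof.
pose x k := iter k estep p; rewrite -/x => pos e K e0.
pose s k := (x k).1 + (x k).2; pose m k := Num.min (x k).1 (x k).2.
have xS k : x k.+1 = estep (x k) by [].
have sS k : s k.+1 = s k - m k.
  by rewrite /s /m xS /estep; case: leP => /= _; ring.
have mS k : m k.+1 <= m k.
  rewrite /m xS /estep; case: (leP (x k).2 (x k).1) => h /=; first by rewrite ge_min lexx orbT.
  by rewrite ge_min lexx.
have m0 k : 0 < m k by have [h1 h2] := pos k; rewrite /m lt_min h1 h2.
have s0 k : 0 < s k by have [h1 h2] := pos k; rewrite /s addr_gt0.
have block j n : n.+1%:R * m (j + n)%N <= s j - s (j + n).+1.
  elim: n => [|n IH]; first by rewrite addn0 mul1r sS opprB addrC subrK.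
  have h1 := mS (j + n)%N; have h2 := sS (j + n).+1; rewrite -addnS in h1 h2 IH *.
  have h3 : n.+1%:R * m (j + n.+1)%N <= n.+1%:R * m (j + n)%N by rewrite ler_wpM2l.
  rewrite -[n.+2%:R]natr1 mulrDl mul1r.
  lra.
have cauchy (d : R) : 0 < d -> exists J, forall n, s J - s (J + n)%N < d.
  move=> d0; apply: contrapT => H.
  have H' J : exists n, d <= s J - s (J + n)%N.
    apply: contrapT => h; apply: H; exists J => n; rewrite ltNge; apply/negP => h'.
    by apply: h; exists n.
  have dec i : exists J, s J <= s 0 - i%:R * d.
    elim: i => [|i [J hJ]]; first by exists 0; rewrite mul0r subr0.
    by have [n hn] := H' J; exists (J + n)%N; rewrite -natr1 mulrDl mul1r; lra.
  have [J hJ] := dec (Num.truncn (s 0 / d)).+1.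
  have : s 0 < (Num.truncn (s 0 / d)).+1%:R * d by rewrite -ltr_pdivrMr // truncnS_gt.
  by have := s0 J; lra.
have [J HJ] := cauchy (e / 4) ltac:(lra).
(* The decrements from J to k are at least m k and sum to less than e / 4; k >= 2 J + 2 makes their
   number at least half of k + 2. *)
have small k : (J + J + 2 <= k)%N -> k.+2%:R * m k < e / 2.
  move=> hk; have [n kE] : exists n, k = (J + n)%N by exists (k - J)%N; rewrite subnKC //; lia.
  have := HJ n.+1; rewrite addnS; have := block J n; rewrite -kE => h1 h2.
  have : k.+2%:R <= 2 * n.+1%:R :> R by rewrite -natrM ler_nat; lia.
  by move=> h3; have : k.+2%:R * m k <= 2 * n.+1%:R * m k by [rewrite ler_wpM2r // ltW]; lra.
pose K1 := (K + (J + J + 2))%N.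
suff [k hk hs] : exists2 k, (K1 <= k)%N & s k.+1 <= 2 * m k.
  exists k.+1; first by move: hk; rewrite /K1; lia.
  rewrite -/(s k.+1); have := small k ltac:(move: hk; rewrite /K1; lia).
  have : k.+2%:R * s k.+1 <= k.+2%:R * (2 * m k) by rewrite ler_wpM2l.
  lra.
(* Otherwise the same coordinate stays the larger one for ever and loses the same amount at each
   step, which exhausts it. *)
apply: contrapT => H.
have H' k : (K1 <= k)%N -> 2 * m k < s k.+1.
  by move=> hk; rewrite ltNge; apply/negP => h; apply: H; exists k.
have [h|h] := leP (x K1).2 (x K1).1.
  have runL n : (x (K1 + n)%N).2 = (x K1).2 /\ (x (K1 + n)%N).1 = (x K1).1 - n%:R * (x K1).2 /\
      (x (K1 + n)%N).2 <= (x (K1 + n)%N).1.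
    elim: n => [|n [h1 [h2 h3]]]; first by rewrite addn0 mul0r subr0.
    have := H' (K1 + n)%N ltac:(lia); rewrite addnS /s /m xS /estep h3 /= min_r //.
    by rewrite h1 h2 -natr1 mulrDl mul1r => ?; split; [|split]; lra.
  have [hn _] := pos K1; have [_ hv] := pos K1.
  have [_ [h2 h3]] := runL (Num.truncn ((x K1).1 / (x K1).2)).+1.
  have : (x K1).1 < (Num.truncn ((x K1).1 / (x K1).2)).+1%:R * (x K1).2.
    by rewrite -ltr_pdivrMr // truncnS_gt.
  have [h4 _] := pos (K1 + (Num.truncn ((x K1).1 / (x K1).2)).+1)%N.
  lra.
have runR n : (x (K1 + n)%N).1 = (x K1).1 /\ (x (K1 + n)%N).2 = (x K1).2 - n%:R * (x K1).1 /\
    (x (K1 + n)%N).1 < (x (K1 + n)%N).2.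
  elim: n => [|n [h1 [h2 h3]]]; first by rewrite addn0 mul0r subr0.
  have := H' (K1 + n)%N ltac:(lia); rewrite addnS /s /m xS /estep leNgt h3 /= min_l ?ltW //.
  by rewrite h1 h2 -natr1 mulrDl mul1r => ?; split; [|split]; lra.
have [hu _] := pos K1.
have [_ [h2 h3]] := runR (Num.truncn ((x K1).2 / (x K1).1)).+1.
have : (x K1).2 < (Num.truncn ((x K1).2 / (x K1).1)).+1%:R * (x K1).1.
  by rewrite -ltr_pdivrMr // truncnS_gt.
have [_ h4] := pos (K1 + (Num.truncn ((x K1).2 / (x K1).1)).+1)%N.
lra.
Qed.

End Euclid.

(** * Traces and norms along the Euclidean path *)

Section Path.
Variables (R : realType) (rho : free2 -> 'M[R]_2).
Hypothesis rep : sl2_representation rho.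
Local Notation state := ((free2 * free2) * (R * R))%type.
Implicit Types (al be g : free2) (s : state).

Definition step s : state :=
  if s.2.2 <= s.2.1 then ((s.1.1, (s.1.1 * s.1.2)%g), (s.2.1 - s.2.2, s.2.2))
  else (((s.1.1 * s.1.2)%g, s.1.2), (s.2.1, s.2.2 - s.2.1)).

Lemma iter_step_estep k s : (iter k step s).2 = iter k (@estep R) s.2.
Proof. by elim: k => //= k <-; rewrite /step /estep; case: ifP. Qed.

Local Notation A s := (rho s.1.1).
Local Notation B s := (rho s.1.2).
Definition sdir s := dir s.1.1 s.1.2 s.2.1 s.2.2.

Definition dot al be : R :=
  abn R false al * abn R false be + abn R true al * abn R true be.

(* [s] describes the direction [sdir s] in a sector of angle at most pi/2. *)
Definition good s := [/\ reach s.1.1 s.1.2, 0 <= s.2.1, 0 <= s.2.2,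
  0 <= dot s.1.1 s.1.2 & 1 <= dot s.1.1 s.1.1 /\ 1 <= dot s.1.2 s.1.2].

Lemma sdir_step s : sdir (step s) = sdir s.
Proof.
by rewrite /sdir /step /dir; case: ifP => _ /=; rewrite !abnM; congr (_, _); ring.
Qed.

Lemma good_step s : good s -> good (step s).
Proof.
move=> [hr u0 v0 d0 [d1 d2]]; rewrite /step /good.
have e1 : dot s.1.1 (s.1.1 * s.1.2)%g = dot s.1.1 s.1.1 + dot s.1.1 s.1.2.
  by rewrite /dot !abnM; ring.
have e2 : dot (s.1.1 * s.1.2)%g s.1.2 = dot s.1.2 s.1.2 + dot s.1.1 s.1.2.
  by rewrite /dot !abnM; ring.
have e3 : dot (s.1.1 * s.1.2)%g (s.1.1 * s.1.2)%g =
    dot s.1.1 s.1.1 + 2 * dot s.1.1 s.1.2 + dot s.1.2 s.1.2.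
  by rewrite /dot !abnM; ring.
case: (leP s.2.2 s.2.1) => h /=; split; rewrite ?e1 ?e2 ?e3; try lra.
- exact: reachL.
- exact: reachR.
Qed.

Lemma good_iter k s : good s -> good (iter k step s) /\ sdir (iter k step s) = sdir s.
Proof.
move=> gs; elim: k => //= k [IH1 IH2]; split; first exact: good_step.
by rewrite sdir_step.
Qed.

Definition ell s := `|\tr (A s)| <= 2 \/ `|\tr (B s)| <= 2.

Lemma notell s : ~ ell s -> 2 < `|\tr (A s)| /\ 2 < `|\tr (B s)|.
Proof.
by move=> h; split; rewrite ltNge; apply/negP => h'; apply: h; [left|right].
Qed.

Lemma tr_mulr (M N : 'M[R]_2) : \det N = 1 ->
  \tr (M *m N *m N) = \tr N * \tr (M *m N) - \tr M.
Proof.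
by move=> dN; rewrite -mulmxA cayley dN mulmxBr mulmx1 -scalemxAr linearB linearZ.
Qed.

Lemma kap_frk (M N : 'M[R]_2) : kap M N = frk (\tr M) (\tr N) (\tr (M *m N)).
Proof. by []. Qed.

(** [descent] applied to the new basis, where Y is the trace of the element that the step
    discards. *)
Lemma not_escape_step s : 2 < kap (A s) (B s) -> ~ escape (A (step s)) (B (step s)) ->
  ~ ell (step s) -> (s.2.2 <= s.2.1 ->
     `|\tr (A s *m B s)| + Num.sqrt (kap (A s) (B s) - 2) <= `|\tr (B s)| /\ 2 < `|\tr (B s)|) /\
  (~~ (s.2.2 <= s.2.1) ->
     `|\tr (A s *m B s)| + Num.sqrt (kap (A s) (B s) - 2) <= `|\tr (A s)| /\ 2 < `|\tr (A s)|).
Proof.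
move=> hk hne /notell[]; move: hne; rewrite /step; case: (s.2.2 <= s.2.1) => /= hne h1 h2; split=> // _.
  rewrite rep.2 in h2 hne; rewrite kap_frk in hk *.
  have hn : ~ (1 <= 2 * (\tr (A s) * \tr (A s *m B s) - \tr (B s)) / (\tr (A s) * \tr (A s *m B s))).
    by move=> h'; apply: hne; split => //; rewrite tr_mulL //; exact: rep.1.
  split; first exact: descent hn.
  exact: descent_gt2 hn.
rewrite rep.2 in h1 hne.
have hk' : frk (\tr (B s)) (\tr (A s)) (\tr (A s *m B s)) = kap (A s) (B s).
  by rewrite /frk /kap; ring.
rewrite -hk' in hk *.
have hn : ~ (1 <= 2 * (\tr (B s) * \tr (A s *m B s) - \tr (A s)) / (\tr (B s) * \tr (A s *m B s))).
  move=> h'; apply: hne; split => //; rewrite tr_mulr ?rep.1 //.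
  by rewrite [X in _ / X]mulrC.
split; first exact: descent hn.
exact: descent_gt2 hn.
Qed.

Section Irrational.
Variable s0 : state.
Hypothesis s0_good : good s0.
Hypothesis kap_reach : forall al be, reach al be -> kap (rho al) (rho be) = kap (A s0) (B s0).
Hypothesis kap_gt2 : 2 < kap (A s0) (B s0).
Hypothesis no_escape : forall k, ~ escape (A (iter k step s0)) (B (iter k step s0)).

Let st k := iter k step s0.

Lemma kap_st k : kap (A (st k)) (B (st k)) = kap (A s0) (B s0).
Proof. by apply: kap_reach; have [[]] := good_iter k s0_good. Qed.

(** Were both traces of the new basis above 2, [descent_gt2] would put the discarded one above 2 as
    well, hence both traces of the old basis. *)
Lemma ell_next k : ell (st k) -> ell (st k.+1).
Proof.
move=> hl; apply: contrapT => hn; have hk := kap_gt2; rewrite -(kap_st k) in hk.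
have [h1 h2] := not_escape_step hk (no_escape (k := k.+1)) hn.
have [n1 n2] := notell hn; move: n1 n2 h1 h2; rewrite /st /= -/(st k) /step.
case: ((st k).2.2 <= _) => /= n1 n2 h1 h2.
  have [_ h3] := h1 isT; case: hl => h4; first by have := le_lt_trans h4 n1; rewrite ltxx.
  by have := le_lt_trans h4 h3; rewrite ltxx.
have [_ h3] := h2 isT; case: hl => h4; last by have := le_lt_trans h4 n2; rewrite ltxx.
by have := le_lt_trans h4 h3; rewrite ltxx.
Qed.

(** As long as [ell] fails, the sum of the two absolute traces loses at least [d] at each step. *)
Lemma ell_eventually : exists k0, forall k, (k0 <= k)%N -> ell (st k).
Proof.
suff [k0 hk0] : exists k0, ell (st k0).
  exists k0 => k /subnKC <-; elim: (k - k0)%N => [|n IH]; first by rewrite addn0.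
  by rewrite addnS; exact: ell_next.
pose d := Num.sqrt (kap (A s0) (B s0) - 2).
have hkap := kap_gt2; have d0 : 0 < d by rewrite sqrtr_gt0 subr_gt0.
pose f k := `|\tr (A (st k))| + `|\tr (B (st k))|.
suff H n : forall k, f k < n%:R * d -> exists k0, ell (st k0).
  apply: (H (Num.truncn (f 0 / d)).+1 0); by rewrite -ltr_pdivrMr // truncnS_gt.
elim: n => [|n IH] k hk.
  by move: hk; rewrite mul0r /f => hk; have := normr_ge0 (\tr (A (st k))); have := normr_ge0 (\tr (B (st k))); lra.
have [hl|hn] := pselect (ell (st k.+1)); first by exists k.+1.
apply: (IH k.+1); have hkk := kap_gt2; rewrite -(kap_st k) in hkk.
have [h1 h2] := not_escape_step hkk (no_escape (k := k.+1)) hn.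
move: hk; rewrite -natr1 mulrDl mul1r => hk.
suff : f k.+1 + d <= f k by lra.
rewrite /f /st /= -/(st k) {1 2}/step /d -(kap_st k).
case: ((st k).2.2 <= _) h1 h2 => /= h1 h2; rewrite rep.2.
  by have [h3 _] := h1 isT; lra.
by have [h3 _] := h2 isT; lra.
Qed.

Definition tri s : R := nm (A s) + nm (B s) + nm (A s *m B s).

(** The new product is tr A (A B) - B, or its mirror form, so one trace governs the growth. Either
    it is at most 2, or the other side has trace at most 2 both before and after the step and
    [frk_bound] applies; 7 is the 6 of that bound plus 1 for A B itself. *)
Lemma tri_next k : ell (st k) -> ell (st k.+1) ->
  tri (st k.+1) <= (kap (A s0) (B s0) + 7) * tri (st k).
Proof.
move=> h1 h2; have hk := kap_gt2; rewrite -(kap_st k) in hk *.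
move: h1 h2; rewrite /ell /tri /st /= -/(st k) /step.
move: (st k) hk => s hk h1 h2.
have nA := nm_ge0 (A s); have nB := nm_ge0 (B s); have nAB := nm_ge0 (A s *m B s).
have hb : forall t : R, 0 <= t -> t <= kap (A s) (B s) + 6 ->
    t * nm (A s *m B s) <= (kap (A s) (B s) + 6) * nm (A s *m B s).
  by move=> t t0 ht; rewrite ler_wpM2r.
case: ifP h2 => h /= h2; rewrite rep.2 in h2 *.
  have hX : `|\tr (A s)| <= kap (A s) (B s) + 6.
    case: h1 => [h1|h1]; first by lra.
    case: h2 => h2; first by lra.
    by rewrite kap_frk in hk *; exact: frk_bound hk h1 h2.
  have -> : A s *m (A s *m B s) = \tr (A s) *: (A s *m B s) - B s.
    by rewrite mulmxA cayley rep.1 mulmxBl mul1mx scalemxAl.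
  have : nm (\tr (A s) *: (A s *m B s) - B s) <= `|\tr (A s)| * nm (A s *m B s) + nm (B s).
    by rewrite -nmZ -[nm (B s)]nmN; exact: nmD.
  have := hb _ (normr_ge0 (\tr (A s))) hX.
  have : 0 <= (kap (A s) (B s) + 6) * nm (A s) by rewrite mulr_ge0 //; lra.
  have : 0 <= (kap (A s) (B s) + 5) * nm (B s) by rewrite mulr_ge0 //; lra.
  lra.
have hk' : frk (\tr (B s)) (\tr (A s)) (\tr (A s *m B s)) = kap (A s) (B s).
  by rewrite /frk /kap; ring.
have hY : `|\tr (B s)| <= kap (A s) (B s) + 6.
  case: h1 => [h1|h1]; last by lra.
  case: h2 => h2; last by lra.
  by rewrite -hk' in hk *; exact: frk_bound hk h1 h2.
have -> : A s *m B s *m B s = \tr (B s) *: (A s *m B s) - A s.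
  by rewrite -mulmxA cayley rep.1 mulmxBr mulmx1 scalemxAr.
have : nm (\tr (B s) *: (A s *m B s) - A s) <= `|\tr (B s)| * nm (A s *m B s) + nm (A s).
  by rewrite -nmZ -[nm (A s)]nmN; exact: nmD.
have := hb _ (normr_ge0 (\tr (B s))) hY.
have : 0 <= (kap (A s) (B s) + 6) * nm (B s) by rewrite mulr_ge0 //; lra.
have : 0 <= (kap (A s) (B s) + 5) * nm (A s) by rewrite mulr_ge0 //; lra.
lra.
Qed.

Lemma irrational_slow : (forall k, 0 < (st k).2.1 /\ 0 < (st k).2.2) -> slow rho (sdir s0).
Proof.
move=> pos; have [k0 hk0] := ell_eventually; have hkap := kap_gt2.
set kp := kap _ _ in hkap.
have grow n : tri (st (k0 + n)) <= (kp + 7) ^+ n * tri (st k0).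
  elim: n => [|n IH]; first by rewrite addn0 expr0 mul1r.
  rewrite addnS exprS -mulrA; apply: le_trans (tri_next _ _) _; try (apply: hk0; lia).
  by rewrite ler_pM2l // -/kp; lra.
have tri1 k : 1 <= tri (st k).
  have := nm_rho_ge1 rep (st k).1.1; have := nm_ge0 (B (st k)).
  by have := nm_ge0 (A (st k) *m B (st k)); rewrite /tri; lra.
(* From k0 on, ln (tri) is at most (k + 1) L; the added 1 keeps L positive. *)
pose L := ln (tri (st k0)) + ln (kp + 7) + 1.
have l1 : 0 <= ln (tri (st k0)) by rewrite ln_ge0.
have l2 : 0 <= ln (kp + 7) by rewrite ln_ge0 //; lra.
apply: word_slow => // e e0.
have pos' k : 0 < (iter k (@estep R) s0.2).1 /\ 0 < (iter k (@estep R) s0.2).2.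
  by rewrite -iter_step_estep; exact: pos.
have [k hk] := euclid_small pos' k0 (e := e / L) ltac:(by rewrite divr_gt0 // /L; lra).
rewrite -iter_step_estep -/(st k) => hs.
have [[hr u0 v0 _ _] hd] := good_iter k s0_good.
exists (st k).1.1, (st k).1.2, (st k).2.1, (st k).2.2, (tri (st k)); split => //.
have nA := nm_ge0 (A (st k)); have nB := nm_ge0 (B (st k)).
have nAB := nm_ge0 (A (st k) *m B (st k)).
split; [rewrite /tri; lra|rewrite /tri; lra|].
have lk : ln (tri (st k)) <= k.+1%:R * L.
  have := grow (k - k0)%N; rewrite subnKC //; move: (k - k0)%N (leq_subr k0 k) => n hn hg.
  have p : 0 < (kp + 7) ^+ n by rewrite exprn_gt0 //; lra.
  have t0 : 0 < tri (st k0) by have := tri1 k0; lra.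
  have : ln (tri (st k)) <= ln ((kp + 7) ^+ n * tri (st k0)).
    by rewrite ler_ln ?posrE ?mulr_gt0 //; have := tri1 k; lra.
  rewrite lnM ?posrE // lnXn; last by lra.
  rewrite -[ln (kp + 7) *+ n]mulr_natl.
  have : n%:R * ln (kp + 7) <= k%:R * ln (kp + 7) by rewrite ler_wpM2r // ler_nat.
  have : 0 <= k%:R * ln (tri (st k0)) by rewrite mulr_ge0.
  have : 0 <= k%:R :> R by [].
  rewrite -[k.+1%:R]natr1 /L; move: l2.
  move: (ln (kp + 7)) (ln (tri (st k0))) (ln _) (k%:R) (n%:R) l1.
  by clear; move=> b a z y x *; lra.
have sk : 0 <= (st k).2.1 + (st k).2.2 by lra.
have L0 : 0 < L by rewrite /L; lra.
apply: (@le_trans _ _ (((st k).2.1 + (st k).2.2) * (k.+1%:R * L))); first by rewrite ler_wpM2l.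
move: hs; rewrite ltr_pdivlMr // => hs; lra.
Qed.

End Irrational.

End Path.

(** * Directions, bases and angles *)

Section Directions.
Variable R : realType.
Implicit Types (al be g : free2) (theta : R * R).

Definition crs al be : R :=
  abn R false al * abn R true be - abn R true al * abn R false be.

Lemma crs_sq al be : reach al be -> crs al be * crs al be = 1.
Proof. by move=> /(reach_cross R); rewrite expr2. Qed.

Lemma dot_gt0 al be : reach al be -> 0 < dot R al al.
Proof.
move=> /crs_sq; rewrite /crs /dot => h.
move: (abn R false al) (abn R true al) h => x y h.
rewrite -!expr2 lt_neqAle eq_sym paddr_eq0 ?sqr_ge0 // !sqrf_eq0 addr_ge0 ?sqr_ge0 // andbT.
apply/negP => /andP[/eqP x0 /eqP y0]; move: h; rewrite x0 y0 !mul0r subrr mul0r => /eqP.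
by rewrite eq_sym oner_eq0.
Qed.

Definition udir al : R * R :=
  (abn R false al / Num.sqrt (dot R al al), abn R true al / Num.sqrt (dot R al al)).

Lemma udirE al be : udir al = dir al be (Num.sqrt (dot R al al))^-1 0.
Proof. by rewrite /udir /dir !mul0r !addr0; congr (_, _); exact: mulrC. Qed.

Lemma udir_circle al : 0 < dot R al al -> circle (udir al).
Proof.
move=> d0; rewrite /circle /udir /= !expr_div_n -mulrDl sqr_sqrtr ?ltW // !expr2.
by rewrite divff // gt_eqF.
Qed.

Lemma axis_udir al be (u : R) : reach al be -> 0 <= u -> circle (dir al be u 0) -> dir al be u 0 = udir al.
Proof.
move=> /dot_gt0 d0 u0; rewrite /circle /dir /= !mul0r !addr0 => h.
have e : (u * Num.sqrt (dot R al al)) ^+ 2 = 1.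
  by rewrite exprMn sqr_sqrtr ?ltW // -h /dot; ring.
have s0 : 0 < Num.sqrt (dot R al al) by rewrite sqrtr_gt0.
have : u * Num.sqrt (dot R al al) = 1.
  by apply/eqP; rewrite -(@eqrXn2 _ 2) ?expr1n ?e ?mulr_ge0 ?(ltW s0).
move=> /(canRL (mulfK (lt0r_neq0 s0))); rewrite mul1r => ->.
by rewrite /udir; congr (_, _); exact: mulrC.
Qed.

(* |theta - e/|e||^2 = 2 - 2 cos <= 2 sin^2 for an angle at most pi/2. *)
Lemma udir_near theta al (d : R) : circle theta -> 0 < dot R al al ->
  0 <= theta.1 * abn R false al + theta.2 * abn R true al -> 0 < d ->
  2 * (theta.1 * abn R true al - theta.2 * abn R false al) ^+ 2 < d ^+ 2 * dot R al al ->
  `|(udir al).1 - theta.1| < d /\ `|(udir al).2 - theta.2| < d.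
Proof.
rewrite /circle /udir /= => hc n0 dt d0 hx.
set n := Num.sqrt _; have np : 0 < n by rewrite sqrtr_gt0.
have nn : n ^+ 2 = dot R al al by rewrite sqr_sqrtr ?ltW.
move: hx dt; rewrite -nn; move: nn; rewrite {1}/dot.
move: (abn R false al) (abn R true al) => x y nn hx dt.
have n1 : n != 0 by rewrite gt_eqF.
pose p := theta.1 * x + theta.2 * y; pose q := theta.1 * y - theta.2 * x.
have pq : p ^+ 2 + q ^+ 2 = n ^+ 2.
  have -> : p ^+ 2 + q ^+ 2 = (theta.1 ^+ 2 + theta.2 ^+ 2) * (x * x + y * y) by rewrite /p /q; ring.
  by rewrite hc nn mul1r.
have pn : p <= n.
  by rewrite -(ler_pXn2r (n := 2)) ?nnegrE ?(ltW np) // -pq lerDl sqr_ge0.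
have key : ((x / n - theta.1) ^+ 2 + (y / n - theta.2) ^+ 2) * n ^+ 2 = 2 * n ^+ 2 - 2 * p * n.
  have -> : ((x / n - theta.1) ^+ 2 + (y / n - theta.2) ^+ 2) * n ^+ 2 =
      (x * x + y * y) + (theta.1 ^+ 2 + theta.2 ^+ 2) * n ^+ 2 - 2 * p * n by rewrite /p; field.
  by rewrite hc -nn; ring.
have lt : (x / n - theta.1) ^+ 2 + (y / n - theta.2) ^+ 2 < d ^+ 2.
  rewrite -(ltr_pM2r (_ : 0 < n ^+ 2)) ?exprn_gt0 // key; apply: le_lt_trans hx.
  rewrite -/q; have -> : q ^+ 2 = n ^+ 2 - p ^+ 2 by lra.
  have : 0 <= p * (n - p) by rewrite mulr_ge0 // subr_ge0.
  lra.
split; rewrite -(ltr_pXn2r (n := 2)) ?nnegrE ?(ltW d0) // real_normK ?num_real //;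
  apply: le_lt_trans lt; [rewrite lerDl|rewrite lerDr]; exact: sqr_ge0.
Qed.

Lemma chart al be : reach al be -> exists2 K : R, 0 < K & forall u v theta d,
  `|theta.1 - (dir al be u v).1| < d -> `|theta.2 - (dir al be u v).2| < d ->
  exists u' v', [/\ theta = dir al be u' v', `|u' - u| < K * d & `|v' - v| < K * d].
Proof.
move=> /crs_sq; rewrite /crs /dir /=.
move: (abn R false al) (abn R true al) (abn R false be) (abn R true be) => x y z w hc.
exists (1 + `|x| + `|y| + `|z| + `|w|).
  by have := (normr_ge0 x, normr_ge0 y, normr_ge0 z, normr_ge0 w) => -[[[? ?] ?] ?]; lra.
move=> u v th d h1 h2; set s := x * w - y * z in hc.
have d0 : 0 < d by apply: le_lt_trans h1.
have s1 : `|s| = 1.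
  by apply/eqP; rewrite -(@eqrXn2 _ 2) // real_normK ?num_real // expr2 hc expr1n.
exists (s * (th.1 * w - th.2 * z)), (s * (x * th.2 - y * th.1)).
have bd (a b : R) : `|s * (a * (th.1 - (u * x + v * z)) - b * (th.2 - (u * y + v * w)))| <= (`|a| + `|b|) * d.
  rewrite normrM s1 mul1r; apply: le_trans (ler_normB _ _) _; rewrite !normrM mulrDl.
  by apply: lerD; rewrite ler_wpM2l ?normr_ge0 // ltW.
have n (x' : R) : 0 <= `|x'| * d by rewrite mulr_ge0 // ltW.
have nx := n x; have ny := n y; have nz := n z; have nw := n w.
split.
- rewrite [LHS]surjective_pairing; congr (_, _).
    have -> : s * (th.1 * w - th.2 * z) * x + s * (x * th.2 - y * th.1) * z = s * s * th.1 by rewrite /s; ring.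
    by rewrite hc mul1r.
  have -> : s * (th.1 * w - th.2 * z) * y + s * (x * th.2 - y * th.1) * w = s * s * th.2 by rewrite /s; ring.
  by rewrite hc mul1r.
- have -> : s * (th.1 * w - th.2 * z) - u = s * (th.1 * w - th.2 * z) - s * s * u by rewrite hc mul1r.
  have -> : s * (th.1 * w - th.2 * z) - s * s * u =
    s * (w * (th.1 - (u * x + v * z)) - z * (th.2 - (u * y + v * w))) by rewrite /s; ring.
  by apply: le_lt_trans (bd _ _) _; lra.
- have -> : s * (x * th.2 - y * th.1) - v = s * (x * th.2 - y * th.1) - s * s * v by rewrite hc mul1r.
  have -> : s * (x * th.2 - y * th.1) - s * s * v =
    s * ((- y) * (th.1 - (u * x + v * z)) - (- x) * (th.2 - (u * y + v * w))) by rewrite /s; ring.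
  by apply: le_lt_trans (bd _ _) _; rewrite !normrN; lra.
Qed.

Lemma quadrant theta : exists2 s, good s & sdir s = theta.
Proof.
have [al [u [u0 ha e1 e2]]] : exists al u, [/\ 0 <= u, al = gen_a \/ al = gen_a^-1%g,
    u * abn R false al = theta.1 & abn R true al = 0].
  have [h|h] := leP 0 theta.1.
    by exists gen_a, theta.1; split; [|left| |]; rewrite ?abn_a ?mulr1.
  exists gen_a^-1%g, (- theta.1); split; [lra|by right| |]; rewrite abnV abn_a ?oppr0 //.
  by rewrite mulrNN mulr1.
have [be [v [v0 hb e3 e4]]] : exists be v, [/\ 0 <= v, be = gen_b \/ be = gen_b^-1%g,
    v * abn R true be = theta.2 & abn R false be = 0].
  have [h|h] := leP 0 theta.2.
    by exists gen_b, theta.2; split; [|left| |]; rewrite ?abn_b ?mulr1.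
  exists gen_b^-1%g, (- theta.2); split; [lra|by right| |]; rewrite abnV abn_b ?oppr0 //.
  by rewrite mulrNN mulr1.
have hr : reach al be.
  have r2 : reach gen_a be by case: hb => ->; [|apply/reachS/reachF/reachS]; exact: reach_root.
  by case: ha => ->; [|apply: reachF].
exists ((al, be), (u, v)); last first.
  by rewrite /sdir /dir /= e1 e2 e3 e4 mulr0 addr0 mulr0 add0r [RHS]surjective_pairing.
split=> //=; first by rewrite /dot e2 e4 mulr0 mul0r addr0.
rewrite /dot e2 e4 !mulr0 addr0 add0r.
by split; [case: ha => ->|case: hb => ->]; rewrite ?abnV ?abn_a ?abn_b ?mulrNN mulr1.
Qed.

End Directions.

(** * Topology of the spectrum *)

Section Spectrum.
Variables (R : realType) (rho : free2 -> 'M[R]_2).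
Hypothesis rep : sl2_representation rho.
Hypothesis faithful : forall g, rho g = 1%:M \/ rho g = - 1%:M -> g = 1%g.
Hypothesis no_parabolic : forall g, ~ parabolic (rho g).
Hypothesis kap_gt2 : 2 < kap (rho gen_a) (rho gen_b).
Variable m : bundle_metric rho.
Implicit Types (al be g : free2) (theta : R * R).

Local Notation S := (spectrum m).

Lemma kap_const al be : reach al be -> kap (rho al) (rho be) = kap (rho gen_a) (rho gen_b).
Proof.
elim=> {al be} // [al be _ <-|al be _ <-|al be _ <-].
- by rewrite rep.2 kapL // rep.1.
- by rewrite rep_V // kapV.
- exact: kapC.
Qed.

Lemma tr_neq2 al be : reach al be -> `|\tr (rho al)| != 2.
Proof.
move=> hr; apply/eqP => h; apply: (no_parabolic (g := al)).
have a1 : al <> 1%g by have := reach_tors R hr (ltn0Sn 0); rewrite expg1.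
split; [|by move=> h1; apply: a1; apply: faithful; left|by move=> h1; apply: a1; apply: faithful; right].
have [h0|h0] := leP 0 (\tr (rho al)); [left; rewrite ger0_norm // in h|right; rewrite ltr0_norm // in h].
by rewrite -h opprK.
Qed.

(** In the degenerate case the commutator h of al with a conjugate of its inverse has trace 2.
    Without parabolics it is the identity, so B^2 = -1 and be has order 2, which a basis element
    cannot have. *)
Lemma kap_neq al be : reach al be -> 2 < `|\tr (rho al)| ->
  kap (rho al) (rho be) != \tr (rho al) ^+ 2 - 2.
Proof.
move=> hr htr; apply/eqP => hk.
have [h1 h2] := kap_degenerate (rep.1 al) (rep.1 be) htr hk.
pose g := (be * al^-1 * be^-1)%g; pose h := (al * g * al^-1 * g^-1)%g.
have gE : rho g = rho be *m inv2 (rho al) *m inv2 (rho be) by rewrite /g !rep.2 !rep_V.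
have hE : rho h = rho al *m rho g *m inv2 (rho al) *m inv2 (rho g).
  by rewrite /h; move: g {gE h} => g; rewrite !rep.2 !rep_V.
rewrite -gE -hE in h1 h2.
have e1 : rho h = 1%:M.
  apply: contrapT => h3; apply: (no_parabolic (g := h)); split; [by left|exact: h3|].
  by move=> h4; move: h1; rewrite h4 linearN /= mxtrace1; lra.
have b2 : (be * be)%g = 1%g by apply: faithful; right; rewrite rep.2 h2.
by apply: (reach_tors R (reachS hr) (ltn0Sn 1)); rewrite expgS expg1.
Qed.

Lemma tr_cases al be : reach al be -> `|\tr (rho al)| < 2 \/ 2 < `|\tr (rho al)|.
Proof. by move=> /tr_neq2; rewrite neq_lt => /orP[]; [left|right]. Qed.

Lemma slow_in theta : circle theta -> slow rho theta -> S theta.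
Proof. by move=> hc hs; split => //; exact: zero_exponent. Qed.

Lemma fast_notin theta : fast rho theta -> ~ S theta.
Proof.
move=> hf [hc]; apply: nonzero_exponent => //.
by move=> h; move: hc; rewrite h /circle /= expr0n /= addr0 => /eqP; rewrite eq_sym oner_eq0.
Qed.

Lemma udir_in al be : reach al be -> `|\tr (rho al)| < 2 -> S (udir R al).
Proof.
move=> hr htr; apply: slow_in; first exact: udir_circle (dot_gt0 _ hr).
by rewrite (udirE _ _ be); apply: axis_slow => //; rewrite invr_ge0 sqrtr_ge0.
Qed.

Lemma udir_fast al be : reach al be -> 2 < `|\tr (rho al)| -> fast rho (udir R al).
Proof.
move=> hr htr; rewrite (udirE _ _ be); apply: axis_fast => //.
by rewrite invr_gt0 sqrtr_gt0; exact: dot_gt0 hr.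
Qed.

Lemma reach_powL al be n : reach al be -> reach al (al ^+ n * be)%g.
Proof.
move=> hr; elim: n => [|n IH]; first by rewrite expg0 mul1g.
by rewrite expgS -mulgA; exact: reachL.
Qed.

Lemma rho_pow g n : rho (g ^+ n)%g = rho g ^+ n.
Proof. by elim: n => [|n IH]; rewrite ?expg0 ?rep_1 ?expr0 // expgS rep.2 IH exprS. Qed.

Lemma elliptic_accumulation al be (d : R) : reach al be -> `|\tr (rho al)| < 2 -> 0 < d ->
  (exists theta, [/\ S theta, theta <> udir R al, `|theta.1 - (udir R al).1| < d &
     `|theta.2 - (udir R al).2| < d]) /\
  (exists theta, [/\ circle theta, ~ S theta, `|theta.1 - (udir R al).1| < d &
     `|theta.2 - (udir R al).2| < d]).
Proof.
move=> hr htr d0; have n0 := dot_gt0 R hr; set nn := dot R al al in n0.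
have hc := udir_circle n0.
have tors n : (0 < n)%N -> rho al ^+ n <> 1.
  by move=> np; rewrite -rho_pow => h; apply: (reach_tors R hr np); apply: faithful; left.
have hk := kap_gt2; rewrite -(kap_const hr) in hk.
(* For n >= N the scalar product with al is at least 2 / d + 1. The determinant being 1 or -1, this
   makes the angle to al small. *)
pose M := `|dot R al be| + (2 / d + 1); have dn := normr_ge0 (dot R al be).
have d2 : 0 < 2 / d by rewrite divr_gt0.
pose N := (Num.truncn (M / nn)).+1.
have nearby n : (N <= n)%N -> let g := (al ^+ n * be)%g in
    [/\ reach g al, `|(udir R g).1 - (udir R al).1| < d,
      `|(udir R g).2 - (udir R al).2| < d & udir R g <> udir R al].
  move=> hn g; have hg : reach al g by exact: reach_powL.
  have g0 := dot_gt0 R (reachS hg).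
  have ge : 2 / d + 1 <= dot R al g.
    have -> : dot R al g = n%:R * nn + dot R al be by rewrite /dot /g !abnM !abnX /nn /dot; ring.
    have : M < n%:R * nn.
      rewrite -ltr_pdivrMr //; apply: lt_le_trans (truncnS_gt _) _.
      by rewrite ler_nat.
    by rewrite /M; have := ler_norm (- dot R al be); rewrite normrN; lra.
  set sq := Num.sqrt nn; have s0 : 0 < sq by rewrite sqrtr_gt0.
  have ss : sq ^+ 2 = nn by rewrite sqr_sqrtr // ltW.
  have E1 : (udir R al).1 * abn R false g + (udir R al).2 * abn R true g = dot R al g / sq.
    by rewrite /udir /dot /= -/nn -/sq; field; rewrite gt_eqF.
  have E2 : (udir R al).1 * abn R true g - (udir R al).2 * abn R false g = crs R al g / sq.
    by rewrite /udir /crs /= -/nn -/sq; field; rewrite gt_eqF.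
  have cc := crs_sq R hg.
  have near : `|(udir R g).1 - (udir R al).1| < d /\ `|(udir R g).2 - (udir R al).2| < d.
    apply: udir_near => //; first by rewrite E1 divr_ge0 ?(ltW s0) //; lra.
    rewrite E2 expr_div_n ss expr2 cc mul1r.
    (* Lagrange's identity turns the bound on the sine into one on the scalar product. *)
    have lag : dot R al g ^+ 2 + crs R al g * crs R al g = nn * dot R g g.
      by rewrite /nn /dot /crs; ring.
    rewrite ltr_pdivrMr // -mulrA [_ * nn]mulrC -lag cc mulrDr mulr1.
    have h2 : (2 / d) ^+ 2 <= dot R al g ^+ 2.
      by rewrite ler_pXn2r ?nnegrE //; lra.
    have h3 : d ^+ 2 * (2 / d) ^+ 2 = 4 by field; rewrite gt_eqF.
    have h4 : d ^+ 2 * (2 / d) ^+ 2 <= d ^+ 2 * dot R al g ^+ 2 by rewrite ler_pM2l // exprn_gt0.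
    have : 0 < d ^+ 2 by rewrite exprn_gt0.
    lra.
  split; [exact: reachS|exact: near.1|exact: near.2|].
  move=> h; have : crs R al g / sq = 0.
    by rewrite -E2 -h /udir /=; ring.
  move=> /eqP; rewrite mulf_eq0 invr_eq0 (gt_eqF s0) orbF => /eqP c0.
  by move: cc; rewrite c0 mul0r => /eqP; rewrite eq_sym oner_eq0.
have [[n hn hl] [n' hn' hl']] := elliptic_dense N (rep.1 al) (rep.1 be) hk htr tors.
have [hr1 a1 a2 a3] := nearby n hn; have [hr2 b1 b2 b3] := nearby n' hn'.
rewrite -rho_pow -rep.2 in hl; rewrite -rho_pow -rep.2 in hl'.
split; first by exists (udir R (al ^+ n * be)%g); split => //; exact: udir_in hr1 hl.
exists (udir R (al ^+ n' * be)%g); split => //; first exact: udir_circle (dot_gt0 R hr2).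
exact: fast_notin (udir_fast hr2 hl').
Qed.

Lemma escape_near al be (u v : R) : reach al be -> escape (rho al) (rho be) -> 0 < u -> 0 < v ->
  exists2 d : R, 0 < d & forall theta, `|theta.1 - (dir al be u v).1| < d ->
    `|theta.2 - (dir al be u v).2| < d -> fast rho theta.
Proof.
move=> hr he u0 v0; have [K K0 HK] := chart R hr.
pose w := Num.min u v; have w0 : 0 < w by rewrite lt_min u0.
have [wu wv] : w <= u /\ w <= v by rewrite !ge_min !lexx orbT.
exists (w / K); first by rewrite divr_gt0.
move=> theta h1 h2; have [u' [v' [-> h3 h4]]] := HK u v theta _ h1 h2.
move: h3 h4; rewrite mulrC divfK ?gt_eqF // !ltr_norml => /andP[h3 _] /andP[h4 _].
by apply: escape_fast => //; rewrite ?(kap_const hr) //; lra.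
Qed.

Lemma hyperbolic_near al be (u : R) : reach al be -> 2 < `|\tr (rho al)| -> 0 < u ->
  exists2 d : R, 0 < d & forall theta, `|theta.1 - (dir al be u 0).1| < d ->
    `|theta.2 - (dir al be u 0).2| < d -> fast rho theta.
Proof.
move=> hr htr u0; have [K K0 HK] := chart R hr.
have hr' : reach al be^-1%g by apply/reachS/reachF/reachS.
have [n hn] := hyp_escape (rep.1 al) (rep.1 be) htr (kap_neq hr htr).
have [n' hn'] := hyp_escape (rep.1 al) (rep.1 be^-1%g) htr (kap_neq hr' htr).
rewrite -rho_pow -rep.2 in hn; rewrite -rho_pow -rep.2 in hn'.
(* With x = u / L one has |v'| < x and u' > (L - 1) x, so u' - n |v'| stays positive and the
   direction lies in an escaping sector, on either side of the axis. *)
pose L := 2 + n%:R + n'%:R : R; have nn : 0 <= n%:R :> R by []; have nn' : 0 <= n'%:R :> R by [].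
have L0 : 0 < L by rewrite /L; lra.
exists (u / L / K); first by rewrite !divr_gt0.
move=> theta h1 h2; have [u' [v' [-> h3 h4]]] := HK u 0 theta _ h1 h2.
move: h3 h4; rewrite mulrC divfK ?gt_eqF // subr0 => h3 h4.
have [x xE] : exists x, x = u / L by exists (u / L).
rewrite -xE in h3 h4; have uE : u = x * L by rewrite xE divfK // gt_eqF.
have x0 : 0 < x by rewrite xE divr_gt0.
move: h3; rewrite ltr_norml => /andP[h3 _].
have fin g (k : nat) (t : R) : reach al g -> escape (rho al) (rho (al ^+ k * g)%g) ->
    0 <= t -> t < x -> k%:R + 2 <= L -> fast rho (dir al g u' t).
  move=> hg he t0 tx kL.
  have -> : dir al g u' t = dir al (al ^+ k * g)%g (u' - k%:R * t) t.
    by rewrite /dir !abnM !abnX; congr (_, _); ring.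
  have hg' := reach_powL k hg.
  have kt : k%:R * t <= k%:R * x by rewrite ler_wpM2l // ltW.
  have kx : x * (k%:R + 2) <= x * L by rewrite ler_pM2l.
  apply: escape_fast => //; rewrite ?(kap_const hg') //; lra.
have [v0|v0] := leP 0 v'.
  apply: (fin be n) => //; last by rewrite /L; lra.
  by move: h4; rewrite ger0_norm.
have -> : dir al be u' v' = dir al be^-1%g u' (- v').
  by rewrite /dir !abnV !mulrNN.
apply: (fin be^-1%g n') => //; [lra| |by rewrite /L; lra].
by move: h4; rewrite ltr0_norm.
Qed.

Lemma rational_or_path theta : circle theta ->
  (exists al be u, [/\ reach al be, 0 < u, theta = dir al be u 0 & theta = udir R al]) \/
  exists2 s, good s /\ sdir s = theta & forall k, 0 < (iter k (@step R) s).2.1 /\ 0 < (iter k (@step R) s).2.2.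
Proof.
move=> hc; have [s gs sE] := quadrant theta.
have [h|h] := pselect (forall k, 0 < (iter k (@step R) s).2.1 /\ 0 < (iter k (@step R) s).2.2).
  by right; exists s.
left; have [k hk] : exists k, ~ (0 < (iter k (@step R) s).2.1 /\ 0 < (iter k (@step R) s).2.2).
  by apply: contrapT => h'; apply: h => k; apply: contrapT => h''; apply: h'; exists k.
have [[hr u0 v0 _ _] sE'] := good_iter k gs; rewrite sE /sdir in sE'.
move: hk hr u0 v0 sE'; move: (iter k _ s) => [[al be] [u v]] /= hk hr u0 v0 sE'.
have pos al' be' w : reach al' be' -> 0 <= w -> theta = dir al' be' w 0 ->
    exists al be u, [/\ reach al be, 0 < u, theta = dir al be u 0 & theta = udir R al].
  move=> hr' w0 E; exists al', be', w; split => //; last by rewrite {1}E axis_udir // -E.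
  rewrite lt_neqAle eq_sym w0 andbT; apply/eqP => h0; move: hc; rewrite E h0 /circle /dir /=.
  by rewrite !mul0r !addr0 expr0n /= addr0 => /eqP; rewrite eq_sym oner_eq0.
have [v1|v1] := ltP 0 v; last first.
  by apply: (pos al be u) => //; rewrite -sE'; congr dir; apply/eqP; rewrite eq_le v0 v1.
have [u1|u1] := ltP 0 u; first by case: hk.
apply: (pos be al v) => //; first exact: reachS.
have uz : u = 0 by apply/eqP; rewrite eq_le u0 u1.
by rewrite -sE' uz /dir !mul0r !addr0 !add0r.
Qed.

Lemma path_in_or_escape s : good s -> circle (sdir s) ->
  (forall k, 0 < (iter k (@step R) s).2.1 /\ 0 < (iter k (@step R) s).2.2) ->
  (exists k, escape (rho (iter k (@step R) s).1.1) (rho (iter k (@step R) s).1.2)) \/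
  ((forall k, ~ escape (rho (iter k (@step R) s).1.1) (rho (iter k (@step R) s).1.2)) /\
   S (sdir s)).
Proof.
move=> gs hc pos; have [h|h] := pselect (exists k, escape (rho (iter k (@step R) s).1.1) (rho (iter k (@step R) s).1.2)).
  by left.
have ne k : ~ escape (rho (iter k (@step R) s).1.1) (rho (iter k (@step R) s).1.2).
  by move=> he; apply: h; exists k.
right; split => //; apply: slow_in => //.
have [hr _ _ _ _] := gs; have hs := kap_const hr.
apply: irrational_slow => // [al be|]; first by rewrite hs; exact: kap_const.
by rewrite hs.
Qed.

Lemma notin_near theta : circle theta -> ~ S theta ->
  exists2 d : R, 0 < d & forall theta', `|theta'.1 - theta.1| < d ->
    `|theta'.2 - theta.2| < d -> fast rho theta'.
Proof.
move=> hc hn; have [[al [be [u [hr u0 E E']]]]|[s [gs sE] pos]] := rational_or_path hc.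
  have [h|h] := tr_cases hr; first by case: hn; rewrite E'; exact: udir_in hr h.
  by rewrite E; exact: hyperbolic_near.
rewrite -sE in hc hn *; have [[k he]|[_ h]] := path_in_or_escape gs hc pos; last by [].
have [[hr _ _ _ _] <-] := good_iter k gs; have [u0 v0] := pos k.
exact: escape_near.
Qed.

Lemma in_near theta (d : R) : S theta -> 0 < d -> exists al be,
  [/\ reach al be, `|\tr (rho al)| < 2, `|(udir R al).1 - theta.1| < d &
      `|(udir R al).2 - theta.2| < d].
Proof.
move=> hS d0; have hc := hS.1.
have [[al [be [u [hr u0 E E']]]]|[s [gs sE] pos]] := rational_or_path hc.
  exists al, be; have [h|h] := tr_cases hr.
    by split; rewrite -?E' ?subrr ?normr0.
  by case: (fast_notin (udir_fast hr h)); rewrite -E'.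
rewrite -sE in hc hS *; have [[k he]|[ne _]] := path_in_or_escape gs hc pos.
  have [[hr _ _ _ _] sk] := good_iter k gs; have [u0 v0] := pos k.
  case: (@fast_notin (sdir s)) => //; rewrite -sk; apply: escape_fast => //; try exact: ltW.
    by rewrite kap_const.
  exact: addr_gt0.
have [hr0 _ _ _ _] := gs; have hs := kap_const hr0; have hk := kap_gt2; rewrite -hs in hk.
have [k0 hk0] := ell_eventually rep gs (fun al be h => etrans (kap_const h) (esym hs)) hk ne.
have pos' k : 0 < (iter k (@estep R) s.2).1 /\ 0 < (iter k (@estep R) s.2).2.
  by rewrite -iter_step_estep; exact: pos.
have [k hk1] := euclid_small pos' k0 (e := d / 2) ltac:(by rewrite divr_gt0).
rewrite -iter_step_estep => small; have [u0 v0] := pos k.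
have [[hr _ _ hd [d1 d2]] sk] := good_iter k gs.
have {hk0} el := hk0 k hk1; rewrite -sk in hc *.
move: (iter k _ s) u0 v0 hr hd d1 d2 small el hc => [[al be] [u v]] /= u0 v0 hr hd d1 d2 small el hc.
rewrite /sdir /= in hc *.
have uv : u + v < d / 2.
  have : 1 * (u + v) <= k.+1%:R * (u + v) by rewrite ler_pM2r ?ler1n //; lra.
  lra.
have cc := crs_sq R hr.
(* The sine of the angle to al' is, up to sign, v' divided by the length of al', which is at least
   1. *)
have near1 al' be' u' v' : reach al' be' -> 0 < u' -> 0 < v' -> v' < d / 2 -> 0 <= dot R al' be' ->
    1 <= dot R al' al' -> circle (dir al' be' u' v') ->
    `|(udir R al').1 - (dir al' be' u' v').1| < d /\ `|(udir R al').2 - (dir al' be' u' v').2| < d.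
  move=> hr' u'0 v'0 vd hd' d1' hc'; have cc' := crs_sq R hr'.
  have E2 : (dir al' be' u' v').1 * abn R true al' - (dir al' be' u' v').2 * abn R false al' = - (v' * crs R al' be').
    by rewrite /dir /crs /=; ring.
  have q1 : 0 <= (dir al' be' u' v').1 * abn R false al' + (dir al' be' u' v').2 * abn R true al'.
    have -> : (dir al' be' u' v').1 * abn R false al' + (dir al' be' u' v').2 * abn R true al' =
      u' * dot R al' al' + v' * dot R al' be' by rewrite /dir /dot /=; ring.
    by rewrite addr_ge0 // mulr_ge0 ?(ltW u'0) ?(ltW v'0) //; lra.
  have q2 : 2 * ((dir al' be' u' v').1 * abn R true al' - (dir al' be' u' v').2 * abn R false al') ^+ 2
      < d ^+ 2 * dot R al' al'.
    rewrite E2 sqrrN exprMn [crs _ _ _ ^+ 2]expr2 cc' mulr1.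
    have h1 : d ^+ 2 * 1 <= d ^+ 2 * dot R al' al' by rewrite ler_pM2l ?exprn_gt0.
    have h2 : v' * v' < d / 2 * (d / 2) by apply: ltr_pM => //; exact: ltW.
    have h3 : 0 < d ^+ 2 by rewrite exprn_gt0.
    by move: (dot R al' al') h1 => D h1; lra.
  exact: udir_near hc' (lt_le_trans ltr01 d1') q1 d0 q2.
have strict al' be' : reach al' be' -> `|\tr (rho al')| <= 2 -> `|\tr (rho al')| < 2.
  by move=> h h'; rewrite lt_neqAle h' (tr_neq2 h).
case: el => h.
  have [a1 a2] := near1 _ _ _ _ hr u0 v0 ltac:(lra) hd d1 hc.
  by exists al, be; split => //; exact: strict hr h.
have sw : dir al be u v = dir be al v u by rewrite /dir; congr (_, _); exact: addrC.
have hd' : 0 <= dot R be al by move: hd; rewrite /dot; lra.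
rewrite sw in hc; have [a1 a2] := near1 _ _ _ _ (reachS hr) v0 u0 ltac:(lra) hd' d2 hc.
rewrite -sw in a1 a2; exists be, al.
by split => //; [exact: reachS|exact: strict (reachS hr) h].
Qed.

End Spectrum.

(** Were all bases hyperbolic, the descent from a basis that does not escape would end at a sink,
    hence at a pair of pants. So every basis would escape; for (a, b) and (a^-1, b) together this
    forces tr (A B) = (tr A)(tr B) / 2, and then [kap] is below 2. *)
Lemma elliptic_exists (R : realType) (rho : free2 -> 'M[R]_2) : sl2_representation rho ->
  (forall g, rho g = 1%:M \/ rho g = - 1%:M -> g = 1%g) ->
  (forall g, ~ parabolic (rho g)) -> 2 < kap (rho gen_a) (rho gen_b) ->
  ~ pants_holonomy rho -> exists al be, reach al be /\ `|\tr (rho al)| < 2.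
Proof.
move=> rep faith npar kap_gt2 npants; apply: contrapT => H.
have big al be : reach al be -> 2 < `|\tr (rho al)|.
  move=> hr; have [h|//] := tr_cases faith npar hr.
  by case: H; exists al, be.
pose d := Num.sqrt (kap (rho gen_a) (rho gen_b) - 2).
have d0 : 0 < d by rewrite sqrtr_gt0 subr_gt0.
have go n : forall al be, reach al be -> ~ escape (rho al) (rho be) ->
    `|\tr (rho al)| + `|\tr (rho be)| < n%:R * d -> False.
  elim: n => [|n IH] al be hr ne lt.
    by have := big _ _ hr; have := big _ _ (reachS hr); rewrite mul0r in lt; lra.
  have hX := big _ _ hr; have hY := big _ _ (reachS hr); have hZ := big _ _ (reachR hr).
  have hk : 2 < kap (rho al) (rho be) by rewrite (kap_const rep hr).
  have dE : d = Num.sqrt (kap (rho al) (rho be) - 2) by rewrite (kap_const rep hr).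
  rewrite -natr1 mulrDl mul1r dE in lt; rewrite dE in IH.
  have [dA dB] : \det (rho al) = 1 /\ \det (rho be) = 1 by split; exact: rep.1.
  rewrite rep.2 in hZ; have hk' := hk; rewrite kap_frk in hk'.
  have hk2 : frk (\tr (rho be)) (\tr (rho al)) (\tr (rho al *m rho be)) = kap (rho al) (rho be).
    by rewrite /frk /kap; ring.
  have [eL|eL] := pselect (escape (rho al) (rho (al * be)%g)); last first.
    apply: (IH al (al * be)%g) => //; first exact: reachL.
    have hn : ~ (1 <= 2 * (\tr (rho al) * \tr (rho al *m rho be) - \tr (rho be)) /
        (\tr (rho al) * \tr (rho al *m rho be))).
      by move=> h; apply: eL; rewrite rep.2; split => //; rewrite tr_mulL.
    by have := descent hX hZ hk' hn; rewrite rep.2 -kap_frk; lra.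
  have [eR|eR] := pselect (escape (rho (al * be)%g) (rho be)); last first.
    apply: (IH (al * be)%g be) => //; first exact: reachR.
    have hn : ~ (1 <= 2 * (\tr (rho be) * \tr (rho al *m rho be) - \tr (rho al)) /
        (\tr (rho be) * \tr (rho al *m rho be))).
      by move=> h; apply: eR; rewrite rep.2; split => //; rewrite tr_mulr // [X in _ / X]mulrC.
    have hk3 := hk; rewrite -hk2 in hk3.
    by have := descent hY hZ hk3 hn; rewrite rep.2 hk2; lra.
  (* Both neighbours escape while the basis itself does not: this is the sink. *)
  apply: npants; apply: (pants_of_traces rep faith (reach_generates hr)) => //.
  rewrite rep.2 in eL eR; case: eL => _ _; rewrite tr_mulL // => eL.
  case: eR => _ _; rewrite tr_mulr // [X in _ / X]mulrC => eR.
  apply: sink => // h; exact: ne.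
have start al be : reach al be -> escape (rho al) (rho be).
  move=> hr; apply: contrapT => ne.
  apply: (go (Num.truncn ((`|\tr (rho al)| + `|\tr (rho be)|) / d)).+1 _ _ hr ne).
  by rewrite -ltr_pdivrMr // truncnS_gt.
have [hX hY h1] := start _ _ reach_root.
have [_ _ h2] := start _ _ (reachF reach_root).
move: h1 h2; rewrite rep_V // tr_mulV tr_inv2; set X := \tr _ in hX *; set Y := \tr _ in hY *.
set Z := \tr _ => h1 h2.
have xy : X * Y != 0.
  have nz (x : R) : 2 < `|x| -> x != 0 by move=> h; rewrite -normr_gt0; lra.
  exact: mulf_neq0 (nz _ hX) (nz _ hY).
have e : 2 * (X * Y - Z) / (X * Y) = 2 - 2 * Z / (X * Y).
  by rewrite mulrBr mulrBl mulfK.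
rewrite e in h2; have : 2 * Z / (X * Y) = 1 by lra.
move=> /(congr1 (fun t => t * (X * Y))); rewrite divfK // mul1r => e2.
have : 0 < (X ^+ 2 - 4) * (Y ^+ 2 - 4).
  have sq (x : R) : 2 < `|x| -> 0 < x ^+ 2 - 4.
    by move=> hx; rewrite -(real_normK (num_real x)); nra.
  by rewrite mulr_gt0 // sq.
have : kap (rho gen_a) (rho gen_b) - 2 = - ((X ^+ 2 - 4) * (Y ^+ 2 - 4)) / 4.
  rewrite /kap -/X -/Y -/Z; have -> : Z = X * Y / 2 by lra.
  by field.
have := kap_gt2; lra.
Qed.

Theorem theorem0p2 (R : realType) (rho : free2 -> 'M[R]_2)
  (rho_rep : sl2_representation rho)
  (rho_nsf : ~ simple_fuchsian rho)
  (rho_inj : injective rho)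
  (rho_npar : forall g : free2, ~ parabolic (rho g))
  (m : bundle_metric rho) :
  cantor_in_circle (spectrum m).
Proof.
have r1 := rep_1 rho_rep.
have faith g : rho g = 1%:M \/ rho g = - 1%:M -> g = 1%g.
  case=> h; first by apply: rho_inj; rewrite h r1.
  (* Injectivity passes to PSL(2,R): rho g = -1 gives rho (g g) = 1, and the free group has no
     element of order 2. *)
  by apply: free2_sq; apply: rho_inj; rewrite rho_rep.2 h r1 mulmxN mulNmx opprK mul1mx.
have cE : \tr (rho (gen_a * gen_b * gen_a^-1 * gen_b^-1)%g) = kap (rho gen_a) (rho gen_b).
  by rewrite !rho_rep.2 !rep_V // fricke //; exact: rho_rep.1.
have c2 : 2 < kap (rho gen_a) (rho gen_b).
  (* c < 2 is the first simple Fuchsian case, and c = 2 would make the commutator parabolic. *)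
  rewrite -cE ltNge le_eqVlt; apply/negP => /orP[/eqP h|h]; last by apply: rho_nsf; left.
  apply: (rho_npar (gen_a * gen_b * gen_a^-1 * gen_b^-1)%g).
  by split; [left|move=> h1; apply: comm_ab_neq1; apply: faith; auto|
                  move=> h1; apply: comm_ab_neq1; apply: faith; auto].
have npants : ~ pants_holonomy rho by move=> h; apply: rho_nsf; right; rewrite cE.
split.
- by move=> theta [].
- have [al [be [hr h]]] := elliptic_exists rho_rep faith rho_npar c2 npants.
  by exists (udir R al); exact: udir_in hr h.
- have c_cont (z : R * R) : {for z, continuous (fun z : R * R => z.1 ^+ 2 + z.2 ^+ 2)}.
    have := @pw_cont R (fun=> 0) I1 z; rewrite /prop_for /continuous_at /power subr0.
    by under eq_fun do rewrite subr0.
  rewrite -[spectrum m]setCK; apply: open_closedC; rewrite openE => theta hn.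
  have [hc|hc] := pselect (circle theta).
    have [d d0 hd] := notin_near rho_rep faith rho_npar c2 hc hn.
    apply/nbhs2P; exists d; first exact: d0.
    move=> w h1 h2; have hf := hd w h1 h2.
    exact: (fast_notin rho_rep (m := m) hf).
  have ct : (fun z : R * R => z.1 ^+ 2 + z.2 ^+ 2 - 1) @ theta --> theta.1 ^+ 2 + theta.2 ^+ 2 - 1.
    by apply: cvgB; [exact: c_cont|exact: cvg_cst].
  have ne : theta.1 ^+ 2 + theta.2 ^+ 2 - 1 != 0.
    by rewrite subr_eq0; apply/eqP.
  have h : \forall w \near theta, w.1 ^+ 2 + w.2 ^+ 2 - 1 != 0 by exact: cvgr_neq0 ct ne.
  suff : \forall w \near theta, (~` spectrum m) w by [].
  by apply: filterS h => w /eqP hw [hc' _]; apply: hw; rewrite hc' subrr.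
(* A point of the spectrum is within e / 2 of an elliptic axis, itself within e / 2 of a direction
   outside the spectrum. *)
- move=> U oU hU; apply/seteqP; split=> // theta [Ut hc].
  have hS := hU _ (conj Ut hc); have /nbhs2P[e e0 He] := open_nbhs_nbhs (conj oU Ut).
  have [|al [be [hr htr a1 a2]]] := in_near rho_rep faith rho_npar c2 hS (d := e / 2).
    by rewrite divr_gt0.
  have [|_ [th [thc thn b1 b2]]] := elliptic_accumulation rho_rep faith c2 m hr htr (d := e / 2).
    by rewrite divr_gt0.
  case: thn; apply: hU; split => //; apply: He.
    by apply: le_lt_trans (ler_distD (udir R al).1 _ _) _; lra.
  by apply: le_lt_trans (ler_distD (udir R al).2 _ _) _; lra.
apply/seteqP; split=> // theta [/set_mem hS [V /nbhs2P[e e0 He] VE]].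
have uniq th : spectrum m th -> `|th.1 - theta.1| < e -> `|th.2 - theta.2| < e -> th = theta.
  move=> h h1 h2; have : (V `&` spectrum m) th by split; [exact: He|exact: h].
  by rewrite VE.
(* An isolated point would coincide with a nearby elliptic axis, at which other points of the
   spectrum accumulate. *)
have [al [be [hr htr a1 a2]]] := in_near rho_rep faith rho_npar c2 hS e0.
have E := uniq _ (udir_in rho_rep m hr htr) a1 a2.
have [[th [thS thn b1 b2]] _] := elliptic_accumulation rho_rep faith c2 m hr htr e0.
by apply: thn; rewrite E in b1 b2 *; exact: uniq.
Qed.
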